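(* There exists an absolute constant $K>0$ such that the following holds. Let $\mathbf{W}_1,\dots,\mathbf{W}_n\in\mathbb{C}^{d\times d}$ be independent, centered, self-adjoint random matrices, and let $M=\max_{1\le k\le n}\|\mathbf{W}_k\|$. Let $\varepsilon_1,\dots,\varepsilon_n$ be independent symmetric Bernoulli (random sign) variables, independent of $\mathbf{W}_1,\dots,\mathbf{W}_n$, and set $\boldsymbol{\Delta}_k=\varepsilon_k\mathbf{W}_k\mathbf{1}\{\|\mathbf{W}_k\|>24\,\mathbb{E}M\}$. Let $\mathbf{V}_n^2$ be a (deterministic, self-adjoint) matrix satisfying $\mathbf{V}_n^2\succeq\sum_{k=1}^n\mathbb{E}\,\mathbf{W}_k^2\mathbf{1}\{\|\mathbf{W}_k\|\le24\,\mathbb{E}M\}$, and let $\sigma^2=\|\mathbf{V}_n^2\|$. For $p\ge1$ put $$R_p=\inf\left\{s>0:\ \mathbb{P}\left(\Big\|\sum_{k=1}^n\boldsymbol{\Delta}_k\Big\|>s/2\right)\le\frac18\,3^{-p}\right\},\qquad q=\log(r(\mathbf{V}_n^2))\vee p.$$ Then for all $p\ge1$, $$\mathbb{E}^{1/p}\Big\|\sum_{k=1}^n\mathbf{W}_k\Big\|^p\le K\left(\sqrt q\,\sigma+q\,\mathbb{E}M+R_p+\mathbb{E}^{1/p}M^p\right).$$ In particular, for all $p\ge1$, $$\mathbb{E}^{1/p}\Big\|\sum_{k=1}^n\mathbf{W}_k\Big\|^p\le K\left(\sqrt q\,\sigma+q\,\mathbb{E}M+\frac{p}{\log(ep)}\,\mathbb{E}^{1/p}M^p\right)$$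 and $$\mathbb{E}^{1/p}\Big\|\sum_{k=1}^n\mathbf{W}_k\Big\|^p\le K\left(\sqrt q\,\sigma+\log(r(\mathbf{V}_n^2))\,\mathbb{E}M+p\,\|M\|_{\psi_1}\right).$$
   Context: $\|\cdot\|$ is the operator (spectral) norm of a matrix. Centered means $\mathbb{E}\mathbf{W}_k=\mathbf{0}_{d\times d}$ (entrywise expectation). For self-adjoint matrices, $\mathbf{A}\succeq\mathbf{B}$ means that $\mathbf{A}-\mathbf{B}$ is positive semidefinite. For a nonnegative definite matrix $\mathbf{A}$, the effective rank is $r(\mathbf{A})=\mathrm{trace}(\mathbf{A})/\|\mathbf{A}\|$, with the convention $r(\mathbf{0}_{d\times d})=0$; in the degenerate case $\mathbf{V}_n^2=\mathbf{0}$ the quantity $\log(r(\mathbf{V}_n^2))$ is read as $0$. For a nonnegative random variable $Z$, $\mathbb{E}^{1/p}Z^p:=(\mathbb{E}Z^p)^{1/p}$ (possibly $+\infty$), and for a random variable $Z$, $\|Z\|_{\psi_1}=\inf\{r>0:\ \mathbb{E}e^{|Z|/r}\le2\}$ (possibly $+\infty$). $a\vee b=\max(a,b)$. ''Absolute constant'' means that $K$ does not depend on $n,d,p$, the matrix $\mathbf{V}_n^2$ or the distributions of the $\mathbf{W}_k$. A symmetric Bernoulli variable takes the values $\pm1$ with probability $1/2$ each. *)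

(* Defs.v *)
From HB Require Import structures.
From mathcomp Require Import all_boot all_order all_algebra.
From mathcomp Require Import all_classical all_reals all_analysis.
From mathcomp Require Import complex.
Set Implicit Arguments.
Unset Strict Implicit.
Unset Printing Implicit Defensive.
Import Order.TTheory GRing.Theory Num.Theory.
Import numFieldNormedType.Exports.
Local Open Scope classical_set_scope.
Local Open Scope sesquilinear_scope.
Local Open Scope ring_scope.

Section Matrices.
Context {R : realType} {d : nat}.
Implicit Types (x : 'cV[R[i]]_d) (A B : 'M[R[i]]_d).

Definition l2norm x : R :=
  Num.sqrt (\sum_(i < d) (complex.Re (x i 0) ^+ 2 + complex.Im (x i 0) ^+ 2)).

Definition opnorm A : R := sup [set l2norm (A *m x) | x in [set x | l2norm x <= 1]].

(* The order of R[i] is such that [0 <= z] means that z is real and nonnegative. *)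
Definition psdmx A : Prop :=
  A \is hermsymmx /\ forall x, 0 <= (x ^t* *m A *m x) 0 0.

(* Loewner order: A is above B. *)
Definition loewner_ge A B : Prop := psdmx (A - B).

(* Only meant for positive semidefinite A, whose trace is real. Since y / 0 = 0,
   eff_rank 0 = 0, and since ln vanishes at 0, ln (eff_rank 0) = 0. *)
Definition eff_rank A : R := complex.Re (\tr A) / opnorm A.

(* Cylinder sets generating the Borel sigma-algebra of the space of matrices,
   seen as a product of copies of R (real and imaginary parts of the entries). *)
Definition mx_cylinder : set (set 'M[R[i]]_d) :=
  [set C : set 'M[R[i]]_d | exists (i j : 'I_d) (B : set R), measurable B /\
     (C = [set A : 'M[R[i]]_d | B (complex.Re (A i j))] \/
      C = [set A : 'M[R[i]]_d | B (complex.Im (A i j))])].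

Definition mx_borel : set (set 'M[R[i]]_d) := <<s mx_cylinder >>.

End Matrices.

Section Probability.
Context {dT : measure_display} {T : measurableType dT} {R : realType}.
Variable P : probability T R.

Definition rv_sigma (Z : T -> R) : set (set T) := preimage_set_system setT Z measurable.

Definition mx_sigma (d : nat) (X : T -> 'M[R[i]]_d) : set (set T) :=
  preimage_set_system setT X mx_borel.

Definition random_mx (d : nat) (X : T -> 'M[R[i]]_d) : Prop :=
  mx_sigma X `<=` measurable.

Definition mutual_indep (I : finType) (F : I -> set (set T)) : Prop :=
  forall (J : {set I}) (E : I -> set T), (forall k, k \in J -> F k (E k)) ->
    P (\bigcap_(k in [set` J]) E k) = (\prod_(k in J) P (E k))%E.

Definition indep (F G : set (set T)) : Prop :=
  forall A B, F A -> G B -> P (A `&` B) = (P A * P B)%E.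

Definition joint_sigma (I : Type) (F : I -> set (set T)) : set (set T) :=
  <<s \bigcup_k F k >>.

Definition symmetric_bernoulli (Z : T -> R) : Prop :=
  P [set w | Z w = 1] = (2^-1)%:E /\ P [set w | Z w = - 1] = (2^-1)%:E.

Definition integrable_mx (d : nat) (X : T -> 'M[R[i]]_d) : Prop :=
  forall i j,
    P.-integrable setT (fun w => (complex.Re (X w i j))%:E) /\
    P.-integrable setT (fun w => (complex.Im (X w i j))%:E).

Definition mean_mx (d : nat) (X : T -> 'M[R[i]]_d) : 'M[R[i]]_d :=
  \matrix_(i, j) Complex (fine ('E_P[fun w => complex.Re (X w i j)])%E)
                         (fine ('E_P[fun w => complex.Im (X w i j)])%E).

Definition centered (d : nat) (X : T -> 'M[R[i]]_d) : Prop :=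
  integrable_mx X /\ mean_mx X = 0.

(* For nonnegative Z this is E^{1/p} Z^p, possibly +oo. *)
Definition pmoment (p : R) (Z : T -> R) : \bar R :=
  ('E_P[fun w => (Z w `^ p)%R] `^ p^-1)%E.

Definition psi1_norm (Z : T -> R) : \bar R :=
  ereal_inf [set r%:E | r in
    [set r : R | 0 < r /\ ('E_P[fun w => expR (`|Z w| / r)%R] <= 2%:E)%E]].

Section Sums.
Context {d n : nat}.
Variable W : 'I_n -> T -> 'M[R[i]]_d.

Definition maxnorm (w : T) : R := \big[Num.max/0]_(k < n) opnorm (W k w).

Definition level : \bar R := (24%:E * 'E_P[maxnorm])%E.

Definition truncated_variance : 'M[R[i]]_d :=
  \sum_(k < n) mean_mx (fun w =>
    if ((opnorm (W k w))%:E <= level)%E then W k w *m W k w else 0).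

Definition Delta (eps : 'I_n -> T -> R) (k : 'I_n) (w : T) : 'M[R[i]]_d :=
  if (level < (opnorm (W k w))%:E)%E then (eps k w)%:C%C *: W k w else 0.

Definition tail_quantile (eps : 'I_n -> T -> R) (p : R) : R :=
  inf [set s : R | 0 < s /\
    (P [set w | (s / 2 < opnorm (\sum_(k < n) Delta eps k w))%R]
       <= (8^-1 * 3 `^ (- p))%R%:E)%E].

End Sums.
End Probability.

(* Main.v *)
Require Import Defs.
From HB Require Import structures.
From mathcomp Require Import all_boot all_order all_algebra.
From mathcomp Require Import all_classical all_reals all_analysis.
From mathcomp Require Import measurable_realfun complex ring lra.
Set Implicit Arguments.
Unset Strict Implicit.
Unset Printing Implicit Defensive.
Import Order.TTheory GRing.Theory Num.Theory.
Import numFieldNormedType.Exports.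
Local Open Scope classical_set_scope.
Local Open Scope sesquilinear_scope.
Local Open Scope ring_scope.

(* Cut the summands at the level u = 24 E M. After symmetrization it suffices to
   bound the p-th moments of the two signed sums, averaged over all sign patterns.

   Small summands. For Hermitian A, B the traces tr(A^a B^b) are of the form
   sum_ij p_ij lam_i^a mu_j^b with p_ij >= 0, so scalar inequalities (mean value,
   Young) transfer to traces. Flipping one sign at a time gives the matrix
   Khintchine inequality, which bounds tr (signed sum)^(2m) by (2m)^m tr S^m with
   S = sum_k A_k^2; exchanging one summand for an independent copy bounds E tr S^m
   by tr V (2 (|V| + m u^2))^(m-1). Taking m close to q, (tr V / |V|)^(1/2m) is
   bounded, which is how the effective rank replaces the dimension.

   Large summands. Hoffmann-Jorgensen's inequality for the sign-averaged tails
   bounds the moments by a quantile and by the moments of M. Since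
   P(M > u) <= 1/24, E max_k g(|W_k|) controls sum_k E g(|W_k|) for g supported
   on (u, oo), hence the exponential moments of the sum of the large norms;
   this bounds the quantile in terms of the moments or of the psi_1 norm of M. *)

(** * Traces and norms of Hermitian matrices *)

(** The signs are a finite average over [{ffun 'I_n -> bool}], so that flips, reflections and
    independence of blocks of signs become reindexings of a finite sum; the given variables [eps]
    enter only through the tail quantile. An independent copy of the summands is likewise a second
    integration over the same probability space, through [mix]. The delicate point for a bound free
    of d is where the moment recursion starts: it must stop at tr V and never reach tr S^0 = d. The
    level 3^-p / 8 of the quantile is dictated by the passage from tails to moments. Tripling the
    threshold multiplies its p-th power by 3^p while the tail is squared up to constants, so a tail
    of order 3^-p makes the weighted series contract. The p-th moment of the sum may be infinite a
    priori. Bounds are therefore proved for finitely many layers, uniformly in their number, and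
    passed to the limit. *)

Section Tracial.
Variables (V : pzRingType) (R : realType) (t : V -> R).
Hypotheses (tD : forall x y, t (x + y) = t x + t y) (tN : forall x, t (- x) = - t x)
  (tC : forall x y, t (x * y) = t (y * x)).

(** Under a tracial functional every word that occurs here equals some A^a B^b. The zeroth powers
    are kept so that each term has the shape evaluated by [herm_pair]. *)
Lemma tracial_mean_value_lhs (A B : V) N :
  t ((A - B) * (A ^+ N.+1 - B ^+ N.+1)) =
  t (A ^+ N.+2 * B ^+ 0) - t (A ^+ 1 * B ^+ N.+1)
  - t (A ^+ N.+1 * B ^+ 1) + t (A ^+ 0 * B ^+ N.+2).
Proof.
rewrite (tC (A ^+ N.+1)) !expr0 mulr1 mul1r !expr1 mulrBr !mulrBl -!exprS.
rewrite !(tD, tN); ring.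
Qed.

Lemma tracial_mean_value_rhs (A B : V) N :
  t ((A - B) ^+ 2 * (A ^+ N + B ^+ N)) =
  t (A ^+ N.+2 * B ^+ 0) - 2 * t (A ^+ N.+1 * B ^+ 1) + t (A ^+ N * B ^+ 2)
  + (t (A ^+ 2 * B ^+ N) - 2 * t (A ^+ 1 * B ^+ N.+1) + t (A ^+ 0 * B ^+ N.+2)).
Proof.
have e1 : t (A * B * A ^+ N) = t (A ^+ N.+1 * B).
  by rewrite tC mulrA -exprSr.
have e2 : t (B * A * A ^+ N) = t (A ^+ N.+1 * B).
  by rewrite -mulrA -exprS tC.
have e3 : t (B * B * A ^+ N) = t (A ^+ N * B ^+ 2) by rewrite tC expr2.
have e4 : t (A * B * B ^+ N) = t (A * B ^+ N.+1) by rewrite -mulrA -exprS.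
have e5 : t (B * A * B ^+ N) = t (A * B ^+ N.+1) by rewrite tC mulrA -exprSr tC.
rewrite mulrDr expr2 mulrBr !mulrBl !(tD, tN) e1 e2 e3 e4 e5.
rewrite !expr0 mulr1 mul1r !expr1 -!mulrA -!exprS mulrA -expr2; ring.
Qed.

Lemma tracial_parallelogram (A B C : V) :
  t ((A - B) ^+ 2 * C) + t ((A + B) ^+ 2 * C) = 2 * t (A ^+ 2 * C) + 2 * t (B ^+ 2 * C).
Proof.
rewrite !expr2 !(mulrBr, mulrDr) !(mulrBl, mulrDl) !(tD, tN); ring.
Qed.
End Tracial.

Section LinearAlgebra.
Context {R : realType}.
Implicit Types (d : nat) (z : R[i]).

Local Notation Re := (@complex.Re R).
Local Notation Im := (@complex.Im R).

Definition csq z : R := Re z ^+ 2 + Im z ^+ 2.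

Lemma csq_ge0 z : 0 <= csq z.
Proof. by rewrite addr_ge0 // sqr_ge0. Qed.

Lemma csqE z : (csq z)%:C%C = z^* * z.
Proof. by rewrite add_Re2_Im2 sqr_normc mulrC. Qed.

Lemma ReM (a : R) z : Re (a%:C%C * z) = a * Re z.
Proof. by case: z => x y /=; rewrite mul0r subr0. Qed.

Lemma Re_sum (I : Type) (r : seq I) (Q : pred I) (F : I -> R[i]) :
  Re (\sum_(i <- r | Q i) F i) = \sum_(i <- r | Q i) Re (F i).
Proof. exact: raddf_sum. Qed.

Lemma Im_sum (I : Type) (r : seq I) (Q : pred I) (F : I -> R[i]) :
  Im (\sum_(i <- r | Q i) F i) = \sum_(i <- r | Q i) Im (F i).
Proof. exact: raddf_sum. Qed.

(** Taking the real part gives a real-valued functional that is additive and tracial, as the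
    previous section asks. *)
Definition rtr d (A : 'M[R[i]]_d) : R := Re (\tr A).

Definition rdot d (x y : 'cV[R[i]]_d) : R := Re ((x ^t* *m y) 0 0).

Lemma rtrD d (A B : 'M[R[i]]_d) : rtr (A + B) = rtr A + rtr B.
Proof. by rewrite /rtr !raddfD. Qed.

Lemma rtrN d (A : 'M[R[i]]_d) : rtr (- A) = - rtr A.
Proof. by rewrite /rtr !raddfN. Qed.

Lemma rtrB d (A B : 'M[R[i]]_d) : rtr (A - B) = rtr A - rtr B.
Proof. by rewrite rtrD rtrN. Qed.

Lemma rtr_sum d (I : Type) (r : seq I) (Q : pred I) (F : I -> 'M[R[i]]_d) :
  rtr (\sum_(i <- r | Q i) F i) = \sum_(i <- r | Q i) rtr (F i).
Proof. elim/big_ind2: _ => [|A x B y <- <-|//]; by [rewrite /rtr !raddf0|rewrite rtrD]. Qed.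

Lemma rtrC d (A B : 'M[R[i]]_d) : rtr (A * B) = rtr (B * A).
Proof. by rewrite /rtr -!mulmxE mxtrace_mulC. Qed.

Lemma rtrZ d (a : R) (A : 'M[R[i]]_d) : rtr (a%:C%C *: A) = a * rtr A.
Proof. by rewrite /rtr mxtraceZ ReM. Qed.

Lemma adjmxM m n p (A : 'M[R[i]]_(m, n)) (B : 'M[R[i]]_(n, p)) :
  (A *m B) ^t* = B ^t* *m A ^t*.
Proof. by rewrite trmx_mul map_mxM. Qed.

Lemma adjmxD m n (A B : 'M[R[i]]_(m, n)) : (A + B) ^t* = A ^t* + B ^t*.
Proof. by rewrite linearD map_mxD. Qed.

Lemma adjmxN m n (A : 'M[R[i]]_(m, n)) : (- A) ^t* = - A ^t*.
Proof. by rewrite linearN map_mxN. Qed.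

Lemma adjmxZ m n (a : R) (A : 'M[R[i]]_(m, n)) : (a%:C%C *: A) ^t* = a%:C%C *: A ^t*.
Proof.
rewrite linearZ map_mxZ; congr (_ *: _); exact: conjc_real.
Qed.

Lemma hermP d (A : 'M[R[i]]_d) : (A \is hermsymmx) <-> A ^t* = A.
Proof.
split=> [/is_hermitianmxP|h]; first by rewrite expr0 scale1r => <-.
by apply/is_hermitianmxP; rewrite expr0 scale1r h.
Qed.

Lemma herm0 d : (0 : 'M[R[i]]_d) \is hermsymmx.
Proof. by apply/hermP; rewrite trmx0 map_mx0. Qed.

Lemma hermD d (A B : 'M[R[i]]_d) :
  A \is hermsymmx -> B \is hermsymmx -> A + B \is hermsymmx.
Proof. by move=> /hermP hA /hermP hB; apply/hermP; rewrite adjmxD hA hB. Qed.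

Lemma hermN d (A : 'M[R[i]]_d) : A \is hermsymmx -> - A \is hermsymmx.
Proof. by move=> /hermP hA; apply/hermP; rewrite adjmxN hA. Qed.

Lemma hermZ d (a : R) (A : 'M[R[i]]_d) : A \is hermsymmx -> a%:C%C *: A \is hermsymmx.
Proof. by move=> /hermP hA; apply/hermP; rewrite adjmxZ hA. Qed.

Lemma herm_sum d (I : Type) (r : seq I) (Q : pred I) (F : I -> 'M[R[i]]_d) :
  (forall i, F i \is hermsymmx) -> \sum_(i <- r | Q i) F i \is hermsymmx.
Proof.
move=> h; elim/big_ind: _ => [|A B|i _]; [exact: herm0|exact: hermD|exact: h].
Qed.

Lemma herm_spectral d (A : 'M[R[i]]_d) : A \is hermsymmx ->
  exists (U : 'M[R[i]]_d) (lam : 'I_d -> R),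
    [/\ U *m U ^t* = 1%:M, U ^t* *m U = 1%:M &
      A = U ^t* *m diag_mx (\row_i (lam i)%:C%C) *m U].
Proof.
move=> hA; have := hermitian_normalmx hA; move/orthomx_spectralP => E.
have Uu := spectral_unitarymx A.
exists (spectralmx A), (fun i => Re (spectral_diag A 0 i)); split.
- exact/unitarymxP.
- by rewrite -(invmx_unitary Uu) mulVmx // unitarymx_unit.
- rewrite [LHS]E [X in X *m _ *m _](invmx_unitary Uu).
  apply: congr2 => //; apply: congr2 => //; congr diag_mx.
  apply/rowP => i; rewrite mxE.
  have /mxOverP/(_ 0 i) := hermitian_spectral_diag_real hA.
  by move=> h; exact/esym/RRe_real.
Qed.

Lemma spectral_exp d (U : 'M[R[i]]_d) (lam : 'I_d -> R) k :
  U *m U ^t* = 1%:M -> U ^t* *m U = 1%:M ->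
  (U ^t* *m diag_mx (\row_i (lam i)%:C%C) *m U) ^+ k =
  U ^t* *m diag_mx (\row_i (lam i ^+ k)%:C%C) *m U.
Proof.
move=> h1 h2; elim: k => [|k IH].
  rewrite expr0; rewrite (_ : diag_mx _ = 1%:M) ?mulmx1 ?h2 //.
  by apply/matrixP => i j; rewrite !mxE expr0.
rewrite exprS IH -mulmxE !mulmxA -(mulmxA _ U (U ^t*)) h1 mulmx1.
congr (_ *m _); rewrite -mulmxA; congr (_ *m _).
rewrite mulmx_diag; congr diag_mx; apply/rowP => i.
by rewrite !mxE exprS rmorphM.
Qed.

(** The entries of U V^* are the inner products of the two eigenbases, so the weights are |<u_i,
    v_j>|^2. *)
Lemma rtr_spectral d (A B : 'M[R[i]]_d) (U V : 'M[R[i]]_d) (lam mu : 'I_d -> R) :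
  A = U ^t* *m diag_mx (\row_i (lam i)%:C%C) *m U ->
  B = V ^t* *m diag_mx (\row_i (mu i)%:C%C) *m V ->
  rtr (A * B) = \sum_i \sum_j lam i * mu j * csq ((U *m V ^t*) i j).
Proof.
move=> -> ->; rewrite /rtr -mulmxE mxtrace_mulC.
rewrite -!mulmxA mxtrace_mulC -!mulmxA.
set Q := U *m V ^t*.
have -> : V *m (U ^t* *m (diag_mx (\row_i (lam i)%:C%C) *m (U *m V ^t*)))
   = Q ^t* *m (diag_mx (\row_i (lam i)%:C%C) *m Q).
  by rewrite /Q adjmxM trmxCK !mulmxA.
rewrite /mxtrace Re_sum exchange_big /=; apply: eq_bigr => j _.
rewrite mul_diag_mx mxE mxE mxE ReM.
rewrite Re_sum mulr_sumr; apply: eq_bigr => i _.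
rewrite mul_diag_mx !mxE mulrCA ReM.
by rewrite -csqE /= mulrCA mulrA.
Qed.

Lemma rdot_norm d (x : 'cV[R[i]]_d) : rdot x x = \sum_i csq (x i 0).
Proof.
rewrite /rdot mxE Re_sum; apply: eq_bigr => i _.
by rewrite !mxE -csqE.
Qed.

Lemma rdot_ge0 d (x : 'cV[R[i]]_d) : 0 <= rdot x x.
Proof. by rewrite rdot_norm sumr_ge0 // => i _; exact: csq_ge0. Qed.

Lemma l2norm_sqr d (x : 'cV[R[i]]_d) : l2norm x ^+ 2 = rdot x x.
Proof.
rewrite rdot_norm /l2norm sqr_sqrtr //.
by apply: sumr_ge0 => i _; exact: csq_ge0.
Qed.

Lemma l2norm_ge0 d (x : 'cV[R[i]]_d) : 0 <= l2norm x.
Proof. exact: sqrtr_ge0. Qed.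

Lemma rdotDr d (x y z : 'cV[R[i]]_d) : rdot x (y + z) = rdot x y + rdot x z.
Proof. by rewrite /rdot mulmxDr mxE raddfD. Qed.

Lemma rdotDl d (x y z : 'cV[R[i]]_d) : rdot (x + y) z = rdot x z + rdot y z.
Proof. by rewrite /rdot adjmxD mulmxDl mxE raddfD. Qed.

Lemma rdotZr d a (x y : 'cV[R[i]]_d) : rdot x (a%:C%C *: y) = a * rdot x y.
Proof. by rewrite /rdot -scalemxAr mxE ReM. Qed.

Lemma rdotZl d a (x y : 'cV[R[i]]_d) : rdot (a%:C%C *: x) y = a * rdot x y.
Proof. by rewrite /rdot adjmxZ -scalemxAl mxE ReM. Qed.

Lemma rdotC d (x y : 'cV[R[i]]_d) : rdot x y = rdot y x.
Proof.
rewrite /rdot !mxE !Re_sum; apply: eq_bigr => i _; rewrite !mxE.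
by case: (x i 0) (y i 0) => a b [c e] /=; ring.
Qed.

Lemma rdotMl d (A : 'M[R[i]]_d) (x y : 'cV[R[i]]_d) : rdot (A *m x) y = rdot x (A ^t* *m y).
Proof. by rewrite /rdot adjmxM mulmxA. Qed.

(** Cauchy-Schwarz: the quadratic t -> |x + t y|^2 is nonnegative at its minimizer. *)
Lemma rdot_le d (x y : 'cV[R[i]]_d) : rdot x y <= l2norm x * l2norm y.
Proof.
have key t : 0 <= l2norm x ^+ 2 + 2 * t * rdot x y + t ^+ 2 * l2norm y ^+ 2.
  have := rdot_ge0 (x + t%:C%C *: y).
  rewrite !rdotDr !rdotDl !rdotZr !rdotZl (rdotC y x) -!l2norm_sqr.
  by congr (0 <= _); ring.
have := l2norm_ge0 x; have := l2norm_ge0 y.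
move: (l2norm x) (l2norm y) (rdot x y) key => a b c key b0 a0.
have [bz|bn] := eqVneq b 0.
  rewrite bz mulr0; rewrite leNgt; apply/negP => c0.
  (* For |y| = 0 the expression is affine in t, and this t gives it the value -1. *)
  have := key (- (a ^+ 2 + 1) / (2 * c)); rewrite bz expr0n mulr0 addr0.
  rewrite (_ : 2 * _ * c = - (a ^+ 2 + 1)); last by field; rewrite gt_eqF.
  by lra.
have bp : 0 < b by rewrite lt_neqAle eq_sym bn.
have [c0|c0] := leP c 0; first by rewrite (le_trans c0) // mulr_ge0.
rewrite -(@ler_pXn2r _ 2) ?nnegrE ?mulr_ge0 //; last exact: ltW.
have := key (- c / b ^+ 2).
rewrite (_ : 2 * _ * c = - 2 * (c ^+ 2 / b ^+ 2)); last by field.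
rewrite (_ : _ ^+ 2 * b ^+ 2 = c ^+ 2 / b ^+ 2); last by field.
rewrite exprMn -ler_pdivrMr ?exprn_gt0 //; lra.
Qed.

Lemma l2normD d (x y : 'cV[R[i]]_d) : l2norm (x + y) <= l2norm x + l2norm y.
Proof.
rewrite -(@ler_pXn2r _ 2) ?nnegrE ?addr_ge0 ?l2norm_ge0 //.
rewrite l2norm_sqr rdotDr !rdotDl (rdotC y x) -!l2norm_sqr.
have := rdot_le x y; lra.
Qed.

Lemma l2normZ d a (x : 'cV[R[i]]_d) : l2norm (a%:C%C *: x) = `|a| * l2norm x.
Proof.
apply/eqP; rewrite -(@eqrXn2 _ 2) ?mulr_ge0 ?l2norm_ge0 ?normr_ge0 //.
by rewrite exprMn !l2norm_sqr rdotZr rdotZl mulrA -expr2 real_normK // num_real.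
Qed.

Lemma l2norm0 d : l2norm (0 : 'cV[R[i]]_d) = 0.
Proof. by apply/eqP; rewrite -sqrf_eq0 l2norm_sqr /rdot mulmx0 mxE. Qed.

Lemma l2norm_unitary d (U : 'M[R[i]]_d) x : U ^t* *m U = 1%:M -> l2norm (U *m x) = l2norm x.
Proof.
move=> h; apply/eqP; rewrite -(@eqrXn2 _ 2) ?l2norm_ge0 //.
by rewrite !l2norm_sqr rdotMl mulmxA h mul1mx.
Qed.

Lemma rdot_diag d (lam : 'I_d -> R) (x : 'cV[R[i]]_d) :
  rdot x (diag_mx (\row_i (lam i)%:C%C) *m x) = \sum_i lam i * csq (x i 0).
Proof.
rewrite /rdot mxE Re_sum; apply: eq_bigr => i _.
by rewrite mul_diag_mx !mxE mulrCA -csqE ReM.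
Qed.

(* The eigenvalues of [A^* A] are the squared singular values of [A]. *)
Lemma singular_values d (A : 'M[R[i]]_d) :
  exists (U : 'M[R[i]]_d) (lam : 'I_d -> R),
    [/\ U *m U ^t* = 1%:M, U ^t* *m U = 1%:M,
      A ^t* *m A = U ^t* *m diag_mx (\row_i (lam i)%:C%C) *m U,
      forall x, l2norm (A *m x) ^+ 2 = \sum_i lam i * csq ((U *m x) i 0) &
      forall i, lam i = l2norm (A *m (U ^t* *m delta_mx i 0)) ^+ 2].
Proof.
have hN : A ^t* *m A \is hermsymmx by apply/hermP; rewrite adjmxM trmxCK.
have [U [lam [h1 h2 E]]] := herm_spectral hN.
have h3 x : l2norm (A *m x) ^+ 2 = \sum_i lam i * csq ((U *m x) i 0).
  rewrite l2norm_sqr rdotMl mulmxA E -!mulmxA.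
  by rewrite -rdotMl rdot_diag.
exists U, lam; split => // i.
rewrite h3 mulmxA h1 mul1mx (bigD1 i) //= big1 ?addr0 => [|j ji].
  by rewrite mxE !eqxx /csq /= expr1n expr0n /= addr0 mulr1.
by rewrite mxE (negbTE ji) /csq /= expr0n /= addr0 mulr0.
Qed.

(** [sup] has a default value on unbounded sets, so every use of [opnorm] rests on this. The
    eigenvalues of A^* A give a crude bound that suffices. *)
Lemma opnorm_has_sup d (A : 'M[R[i]]_d) :
  has_sup [set l2norm (A *m x) | x in [set x | l2norm x <= 1]].
Proof.
split; first by exists (l2norm (A *m 0)), 0; rewrite //= l2norm0 ler01.
have [U [lam [h1 h2 _ hx _]]] := singular_values A.
exists (Num.sqrt (\sum_i `|lam i|)) => _ [x /= x1 <-].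
have l0 : 0 <= \sum_i `|lam i| by apply: sumr_ge0.
rewrite -(@ler_pXn2r _ 2) ?nnegrE ?l2norm_ge0 ?sqrtr_ge0 //.
rewrite hx sqr_sqrtr // ler_sum // => i _.
have c1 : csq ((U *m x) i 0) <= 1.
  apply: (@le_trans _ _ (l2norm (U *m x) ^+ 2)).
    rewrite l2norm_sqr rdot_norm (bigD1 i) //= lerDl sumr_ge0 // => j _.
    exact: csq_ge0.
  by rewrite l2norm_unitary // exprn_ile1 ?l2norm_ge0.
rewrite (le_trans (ler_norm _)) // normrM (ger0_norm (csq_ge0 _)).
by rewrite ler_piMr.
Qed.

Lemma opnorm_ge0 d (A : 'M[R[i]]_d) : 0 <= opnorm A.
Proof.
apply: (@le_trans _ _ (l2norm (A *m 0))); first exact: l2norm_ge0.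
apply: sup_upper_bound; first exact: opnorm_has_sup.
by exists 0; rewrite //= l2norm0 ler01.
Qed.

Lemma opnorm_mul d (A : 'M[R[i]]_d) x : l2norm (A *m x) <= opnorm A * l2norm x.
Proof.
have [x0|xn] := eqVneq (l2norm x) 0.
  have -> : x = 0.
    apply/colP => i; rewrite mxE; apply/eqP.
    have : csq (x i 0) = 0.
      have /eqP := l2norm_sqr x; rewrite x0 expr0n /= eq_sym rdot_norm psumr_eq0 => [/allP/(_ i)|j _].
        by rewrite mem_index_enum => /(_ isT)/eqP.
      exact: csq_ge0.
    rewrite /csq => /eqP; rewrite paddr_eq0 ?sqr_ge0 // !sqrf_eq0.
    by rewrite eq_complex.
  by rewrite mulmx0 l2norm0 mulr0.
have xp : 0 < l2norm x by rewrite lt_neqAle eq_sym xn l2norm_ge0.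
rewrite -ler_pdivrMr //.
have -> : l2norm (A *m x) / l2norm x = l2norm (A *m ((l2norm x)^-1%:C%C *: x)).
  by rewrite -scalemxAr l2normZ ger0_norm ?invr_ge0 ?l2norm_ge0 // mulrC.
apply: sup_upper_bound; first exact: opnorm_has_sup.
exists ((l2norm x)^-1%:C%C *: x) => //=.
by rewrite l2normZ ger0_norm ?invr_ge0 ?l2norm_ge0 // mulVf.
Qed.

Lemma opnorm_le d (A : 'M[R[i]]_d) c : 0 <= c ->
  (forall x, l2norm (A *m x) <= c * l2norm x) -> opnorm A <= c.
Proof.
move=> c0 h; apply: ge_sup; first by case: (opnorm_has_sup A).
move=> _ [x /= x1 <-]; apply: (le_trans (h x)).
by rewrite ler_piMr.
Qed.

Lemma opnormD d (A B : 'M[R[i]]_d) : opnorm (A + B) <= opnorm A + opnorm B.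
Proof.
apply: opnorm_le => [|x]; first by rewrite addr_ge0 ?opnorm_ge0.
rewrite mulmxDl mulrDl (le_trans (l2normD _ _)) //.
by rewrite lerD ?opnorm_mul.
Qed.

Lemma opnorm0 d : opnorm (0 : 'M[R[i]]_d) = 0.
Proof.
apply/eqP; rewrite eq_le opnorm_ge0 andbT; apply: opnorm_le => // x.
by rewrite mul0mx l2norm0 mul0r.
Qed.

Lemma opnorm_sum d (I : Type) (r : seq I) (Q : pred I) (F : I -> 'M[R[i]]_d) :
  opnorm (\sum_(i <- r | Q i) F i) <= \sum_(i <- r | Q i) opnorm (F i).
Proof.
elim/big_ind2: _ => [|A x B y h1 h2|//]; first by rewrite opnorm0.
by rewrite (le_trans (opnormD _ _)) // lerD.
Qed.

Lemma opnormZ_le d a (A : 'M[R[i]]_d) : opnorm (a%:C%C *: A) <= `|a| * opnorm A.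
Proof.
apply: opnorm_le => [|x]; first by rewrite mulr_ge0 ?opnorm_ge0.
by rewrite -scalemxAl l2normZ -mulrA ler_wpM2l ?opnorm_mul.
Qed.

Lemma opnormZ d a (A : 'M[R[i]]_d) : opnorm (a%:C%C *: A) = `|a| * opnorm A.
Proof.
apply/eqP; rewrite eq_le opnormZ_le /=.
have [->|a0] := eqVneq a 0; first by rewrite normr0 mul0r opnorm_ge0.
have := opnormZ_le a^-1 (a%:C%C *: A).
rewrite scalerA -(rmorphM (real_complex R)) mulVf //= scale1r normfV.
by rewrite mulrC ler_pdivlMr ?normr_gt0 // mulrC.
Qed.

Lemma opnormN d (A : 'M[R[i]]_d) : opnorm (- A) = opnorm A.
Proof.
have := opnormZ (-1) A; rewrite normrN1 mul1r => <-.
by rewrite rmorphN rmorph1 scaleN1r.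
Qed.

Lemma rdot_opnorm d (A : 'M[R[i]]_d) x : `|rdot x (A *m x)| <= opnorm A * l2norm x ^+ 2.
Proof.
have h (B : 'M[R[i]]_d) : rdot x (B *m x) <= opnorm B * l2norm x ^+ 2.
  rewrite (le_trans (rdot_le _ _)) // mulrC expr2 mulrA ler_wpM2r ?l2norm_ge0 //.
  exact: opnorm_mul.
rewrite ler_norml h andbT lerNl; have := h (- A).
rewrite opnormN mulNmx; have := rdotZr (-1) x (A *m x).
by rewrite rmorphN rmorph1 scaleN1r mulN1r => ->.
Qed.

(** In an orthonormal eigenbasis A acts diagonally, hence |A x| <= max |lam| |x|, and eigenvectors
    give the converse. For d = 0 there is no index at which the maximum could be attained. *)
Lemma herm_spectral_norm d (A : 'M[R[i]]_d) : A \is hermsymmx ->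
  exists (U : 'M[R[i]]_d) (lam : 'I_d -> R),
    [/\ U *m U ^t* = 1%:M, U ^t* *m U = 1%:M,
      A = U ^t* *m diag_mx (\row_i (lam i)%:C%C) *m U,
      forall i, `|lam i| <= opnorm A &
      (0 < d)%N -> exists i, `|lam i| = opnorm A].
Proof.
move=> hA; have [U [lam [h1 h2 E]]] := herm_spectral hA.
exists U, lam.
have le_lam i : `|lam i| <= opnorm A.
  have e1 : l2norm (U ^t* *m delta_mx i 0) = 1.
    rewrite l2norm_unitary ?trmxCK //; apply/eqP.
    rewrite -(@eqrXn2 _ 2) ?l2norm_ge0 // l2norm_sqr rdot_norm (bigD1 i) //= big1 => [|j ji].
      by rewrite mxE !eqxx /csq /= !expr1n expr0n /= !addr0.
    by rewrite mxE (negbTE ji) /csq /= expr0n /= addr0.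
  have := opnorm_mul A (U ^t* *m delta_mx i 0); rewrite e1 mulr1.
  rewrite {1}E -!mulmxA (mulmxA U) h1 mul1mx mul_diag_mx.
  rewrite (_ : (\matrix_(_, _) _) = (lam i)%:C%C *: delta_mx i 0); last first.
    apply/matrixP => k l; rewrite !mxE; have [->|] := eqVneq k i => //=.
    by rewrite !mulr0.
  by rewrite -scalemxAr l2normZ e1 mulr1.
split => // d0.
pose j0 := Ordinal d0.
exists [arg max_(i > j0) `|lam i|]%O.
case: Order.TotalTheory.arg_maxP => // i _ hi.
apply/eqP; rewrite eq_le le_lam /=; apply: opnorm_le => // x.
rewrite -(@ler_pXn2r _ 2) ?nnegrE ?mulr_ge0 ?l2norm_ge0 //.
rewrite {1}E -!mulmxA l2norm_unitary ?trmxCK // exprMn.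
rewrite -[l2norm x](l2norm_unitary _ h2) !l2norm_sqr !rdot_norm mulr_sumr ler_sum // => j _.
rewrite mul_diag_mx mxE mxE.
have -> : csq ((lam j)%:C%C * (U *m x) j 0) = lam j ^+ 2 * csq ((U *m x) j 0).
  by case: ((U *m x) j 0) => a b; rewrite /csq /=; ring.
rewrite ler_wpM2r ?csq_ge0 // -[lam j ^+ 2]real_normK ?num_real //.
by rewrite lerXn2r ?nnegrE //; exact: hi.
Qed.

(** * Positive semidefinite matrices and the transfer of scalar inequalities to traces *)

Definition psd d (A : 'M[R[i]]_d) : Prop :=
  A \is hermsymmx /\ forall x, 0 <= rdot x (A *m x).

Lemma psdmx_psd d (A : 'M[R[i]]_d) : psdmx A -> psd A.
Proof.
move=> [hA h]; split => // x; have := h x.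
by rewrite /rdot mulmxA lecE => /andP[_].
Qed.

Lemma psdD d (A B : 'M[R[i]]_d) : psd A -> psd B -> psd (A + B).
Proof.
move=> [a1 a2] [b1 b2]; split; first exact: hermD.
by move=> x; rewrite mulmxDl rdotDr addr_ge0.
Qed.

Lemma psd0 d : psd (0 : 'M[R[i]]_d).
Proof. by split; [exact: herm0|move=> x; rewrite mul0mx /rdot mulmx0 mxE]. Qed.

Lemma psd_sum d (I : Type) (r : seq I) (Q : pred I) (F : I -> 'M[R[i]]_d) :
  (forall i, psd (F i)) -> psd (\sum_(i <- r | Q i) F i).
Proof.
by move=> h; elim/big_ind: _ => [|A B|i _]; [exact: psd0|exact: psdD|exact: h].
Qed.

Lemma psd_spectral d (U : 'M[R[i]]_d) (lam : 'I_d -> R) :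
  U *m U ^t* = 1%:M ->
  psd (U ^t* *m diag_mx (\row_i (lam i)%:C%C) *m U) -> forall i, 0 <= lam i.
Proof.
move=> h [_ /(_ (U ^t* *m delta_mx _ 0)) h2] i; have := h2 i.
rewrite -!mulmxA -rdotMl (mulmxA U) h mul1mx rdot_diag (bigD1 i) //= big1 ?addr0 => [|j ji].
  by rewrite mxE !eqxx /csq /= expr1n expr0n /= addr0 mulr1.
by rewrite mxE (negbTE ji) /csq /= expr0n /= addr0 mulr0.
Qed.

Lemma spectral_psd d (U : 'M[R[i]]_d) (lam : 'I_d -> R) :
  (forall i, 0 <= lam i) -> psd (U ^t* *m diag_mx (\row_i (lam i)%:C%C) *m U).
Proof.
move=> h; split.
  apply/hermP; rewrite !adjmxM trmxCK mulmxA; congr (_ *m _ *m _).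
  rewrite tr_diag_mx map_diag_mx; congr diag_mx; apply/rowP => i; rewrite !mxE.
  exact: conjc_real.
move=> x; rewrite -!mulmxA -rdotMl rdot_diag sumr_ge0 // => i _.
by rewrite mulr_ge0 ?csq_ge0.
Qed.

Lemma psdX d (A : 'M[R[i]]_d) k : psd A -> psd (A ^+ k).
Proof.
move=> pA; have [U [lam [h1 h2 E]]] := herm_spectral pA.1.
have l0 : forall i, 0 <= lam i by apply: (psd_spectral h1); rewrite -E.
by rewrite E spectral_exp //; apply: spectral_psd => i; rewrite exprn_ge0.
Qed.

Lemma psd_even d (A : 'M[R[i]]_d) k : A \is hermsymmx -> psd (A ^+ (2 * k)).
Proof.
move=> hA; have [U [lam [h1 h2 E]]] := herm_spectral hA.
by rewrite E spectral_exp //; apply: spectral_psd => i; rewrite exprM exprn_ge0 // sqr_ge0.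
Qed.

Lemma rtr_exp d (U : 'M[R[i]]_d) (lam : 'I_d -> R) k :
  U *m U ^t* = 1%:M -> U ^t* *m U = 1%:M ->
  rtr ((U ^t* *m diag_mx (\row_i (lam i)%:C%C) *m U) ^+ k) = \sum_i lam i ^+ k.
Proof.
move=> h1 h2; rewrite spectral_exp // /rtr mxtrace_mulC mulmxA h1 mul1mx.
by rewrite mxtrace_diag Re_sum; apply: eq_bigr => i _; rewrite mxE.
Qed.

(** The index set consists of pairs of eigenvalues and the weight of (i, j) is |<u_i, v_j>|^2. The
    weights do not depend on a and b, so inside these traces A and B behave like commuting
    variables. *)
Lemma herm_pair d (A B : 'M[R[i]]_d) : A \is hermsymmx -> B \is hermsymmx ->
  exists (K : finType) (lam mu p : K -> R),
  [/\ forall i, 0 <= p i,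
      forall a b, rtr (A ^+ a * B ^+ b) = \sum_i lam i ^+ a * mu i ^+ b * p i,
      (forall i, `|lam i| <= opnorm A) /\ (forall i, `|mu i| <= opnorm B),
      psd A -> forall i, 0 <= lam i &
      psd B -> forall i, 0 <= mu i].
Proof.
move=> hA hB.
have [U [lam [h1 h2 E le _]]] := herm_spectral_norm hA.
have [V [mu [k1 k2 F ke _]]] := herm_spectral_norm hB.
exists ('I_d * 'I_d)%type, (fun k => lam k.1), (fun k => mu k.2),
  (fun k => csq ((U *m V ^t*) k.1 k.2)); split.
- by move=> k; exact: csq_ge0.
- move=> a b; rewrite E F !spectral_exp //.
  by rewrite (rtr_spectral erefl erefl) pair_big.
- by split=> k; [exact: le|exact: ke].
- by rewrite E => h k; exact: (psd_spectral h1 h).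
- by rewrite F => h k; exact: (psd_spectral k1 h).
Qed.

Lemma rtr_psd_mul d (A B : 'M[R[i]]_d) : psd A -> psd B -> 0 <= rtr (A * B).
Proof.
move=> pA pB; have [K [lam [mu [p [p0 E _ lA lB]]]]] := herm_pair pA.1 pB.1.
have := E 1%N 1%N; rewrite !expr1 => ->.
apply: sumr_ge0 => i _.
by rewrite !expr1 !mulr_ge0 ?lA ?lB.
Qed.

Lemma rtr_psd_ge0 d (A : 'M[R[i]]_d) : psd A -> 0 <= rtr A.
Proof.
by move=> pA; rewrite -[A]mulr1 -(expr0 A); exact: rtr_psd_mul (psdX 0 pA).
Qed.

Lemma rtr_mul_le d (A B : 'M[R[i]]_d) : A \is hermsymmx -> psd B ->
  rtr (A * B) <= opnorm A * rtr B.
Proof.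
move=> hA pB; have [K [lam [mu [p [p0 E [lA _] _ lB]]]]] := herm_pair hA pB.1.
have := E 1%N 1%N; rewrite !expr1 => ->.
have := E 0%N 1%N; rewrite expr0 mul1r expr1 => ->.
rewrite mulr_sumr ler_sum // => i _.
rewrite !expr1 expr0 mul1r -mulrA ler_wpM2r ?mulr_ge0 ?lB //.
exact: le_trans (ler_norm _) (lA i).
Qed.

(** Powers are monotone on nonnegative numbers, so x^a - y^a and x^b - y^b have a nonnegative
    product. *)
Lemma exp_rearrange (x y : R) a b : 0 <= x -> 0 <= y ->
  x ^+ a * y ^+ b + x ^+ b * y ^+ a <= x ^+ (a + b) + y ^+ (a + b).
Proof.
move=> x0 y0; rewrite !exprD.
suff : 0 <= (x ^+ a - y ^+ a) * (x ^+ b - y ^+ b) by lra.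
have [xy|yx] := leP x y.
  by rewrite mulr_le0 // subr_le0 lerXn2r.
by rewrite mulr_ge0 // subr_ge0 lerXn2r // ltW.
Qed.

(** A trapezoid bound: (x^(N+1) - y^(N+1)) / (x - y) is a sum of N + 1 monomials x^(N-i) y^i, and
    each monomial plus its mirror image is at most x^N + y^N. For even N the case of arbitrary signs
    reduces to absolute values. *)
Lemma exp_mean_value (x y : R) N :
  (0 <= x /\ 0 <= y) \/ ~~ odd N ->
  (x - y) * (x ^+ N.+1 - y ^+ N.+1) <= N.+1%:R / 2 * ((x - y) ^+ 2 * (x ^+ N + y ^+ N)).
Proof.
move=> h; rewrite subrXX mulrA -expr2 mulrCA ler_wpM2l ?sqr_ge0 //.
have E : \sum_(i < N.+1) x ^+ (N.+1.-1 - i) * y ^+ i =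
   \sum_(i < N.+1) x ^+ i * y ^+ (N - i).
  rewrite (reindex_inj rev_ord_inj); apply: eq_bigr => i _ /=.
  by rewrite subSS subKn // -ltnS.
suff : (\sum_(i < N.+1) x ^+ (N.+1.-1 - i) * y ^+ i) +
   (\sum_(i < N.+1) x ^+ i * y ^+ (N - i)) <= N.+1%:R * (x ^+ N + y ^+ N).
  by rewrite -E; lra.
rewrite -big_split /= -[N.+1 in leRHS]card_ord mulr_natl -sumr_const ler_sum // => i _.
have iN : (i <= N)%N by rewrite -ltnS.
case: h => [[x0 y0]|oN].
  by have := exp_rearrange (N - i) i x0 y0; rewrite subnK.
have ev (z : R) : z ^+ N = `|z| ^+ N.
  by rewrite -[N]odd_double_half (negbTE oN) add0n -mul2n !exprM real_normK ?num_real.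
rewrite (ev x) (ev y).
have := exp_rearrange (N - i) i (normr_ge0 x) (normr_ge0 y); rewrite subnK //.
apply: le_trans; rewrite -!normrX -!normrM; apply: lerD; exact: ler_norm.
Qed.

(** The scalar inequality is multiplied by the weights and summed. The even case serves the signed
    sums, the psd case the sums of squares. *)
Lemma rtr_mean_value d (A B : 'M[R[i]]_d) N : A \is hermsymmx -> B \is hermsymmx ->
  (psd A /\ psd B) \/ ~~ odd N ->
  rtr ((A - B) * (A ^+ N.+1 - B ^+ N.+1)) <=
  N.+1%:R / 2 * rtr ((A - B) ^+ 2 * (A ^+ N + B ^+ N)).
Proof.
move=> hA hB h; have [K [lam [mu [p [p0 E _ lA lB]]]]] := herm_pair hA hB.
have tD := @rtrD d; have tN := @rtrN d; have tC := @rtrC d.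
rewrite (tracial_mean_value_lhs tD tN tC) (tracial_mean_value_rhs tD tN tC).
rewrite !E !mulr_sumr -!(sumrB, big_split) mulr_sumr /=.
apply: ler_sum => i _.
have hi : (0 <= lam i /\ 0 <= mu i) \/ ~~ odd N.
  by case: h => [[h1 h2]|]; [left; split; [exact: lA|exact: lB]|right].
have := ler_wpM2r (p0 i) (exp_mean_value hi).
congr (_ <= _); rewrite ?exprS ?expr0; ring.
Qed.

(** Weighted arithmetic-geometric mean, by induction: add a b^(M+1) + a^(M+1) b <= a^(M+2) + b^(M+2)
    to b times the previous case. *)
Lemma young_exp (a b : R) M : 0 <= a -> 0 <= b ->
  M.+1%:R * (a * b ^+ M) <= a ^+ M.+1 + M%:R * b ^+ M.+1.
Proof.
move=> a0 b0; elim: M => [|M IH]; first by rewrite expr0 expr1 mul0r addr0 mul1r mulr1.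
have := ler_wpM2l b0 IH; have := exp_rearrange 1 M.+1 a0 b0.
rewrite !expr1 add1n -[M.+2%:R]natr1 -[M.+1%:R]natr1 !exprS; nra.
Qed.

(** [young_exp] at c times an eigenvalue of H and the square of an eigenvalue of X. The parameter c
    is tuned in [khintchine]. *)
Lemma rtr_young d (H X : 'M[R[i]]_d) c M : psd H -> X \is hermsymmx -> 0 <= c ->
  M.+1%:R * (c * rtr (H * X ^+ (2 * M))) <=
  c ^+ M.+1 * rtr (H ^+ M.+1) + M%:R * rtr (X ^+ (2 * M.+1)).
Proof.
move=> pH hX c0; have [K [lam [mu [p [p0 E _ lH _]]]]] := herm_pair pH.1 hX.
have := E 1%N (2 * M)%N; rewrite expr1 => ->.
have := E M.+1 0%N; rewrite expr0 mulr1 => ->.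
have := E 0%N (2 * M.+1)%N; rewrite expr0 mul1r => ->.
rewrite !mulr_sumr -big_split /= ler_sum // => i _.
have := ler_wpM2r (p0 i) (young_exp M (mulr_ge0 c0 (lH pH i)) (sqr_ge0 (mu i))).
by rewrite -!exprM exprMn expr1 !expr0; congr (_ <= _); ring.
Qed.

Lemma rtr_sqr_le d (A B : 'M[R[i]]_d) u : A \is hermsymmx -> psd B -> opnorm A <= u ->
  rtr ((A ^+ 2) ^+ 2 * B) <= u ^+ 2 * rtr (A ^+ 2 * B).
Proof.
move=> hA pB Au; have [K [lam [mu [p [p0 E [lA _] _ lB]]]]] := herm_pair hA pB.1.
rewrite -exprM; have := E (2 * 2)%N 1%N; rewrite expr1 => ->.
have := E 2%N 1%N; rewrite expr1 => ->.
rewrite mulr_sumr ler_sum // => i _.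
have -> : lam i ^+ (2 * 2) * mu i ^+ 1 * p i = lam i ^+ 2 * (lam i ^+ 2 * mu i ^+ 1 * p i) by ring.
rewrite ler_wpM2r //; first by apply: mulr_ge0 (p0 i); apply: mulr_ge0; [exact: sqr_ge0|rewrite expr1 lB].
rewrite -[lam i ^+ 2]real_normK ?num_real // lerXn2r ?nnegrE //.
  exact: le_trans (opnorm_ge0 A) Au.
exact: le_trans (lA i) Au.
Qed.

(** By the parallelogram identity the two sides differ by rtr ((A + B)^2 C), which is
    nonnegative. *)
Lemma rtr_sqrB_le d (A B C : 'M[R[i]]_d) : A \is hermsymmx -> B \is hermsymmx -> psd C ->
  rtr ((A - B) ^+ 2 * C) <= 2 * rtr (A ^+ 2 * C) + 2 * rtr (B ^+ 2 * C).
Proof.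
move=> hA hB pC; rewrite -(tracial_parallelogram (@rtrD d) (@rtrN d)) lerDl.
apply: rtr_psd_mul pC; apply: (@psd_even _ _ 1); exact: hermD.
Qed.

Lemma opnorm_exp_le d (A : 'M[R[i]]_d) k : (0 < d)%N -> A \is hermsymmx ->
  opnorm A ^+ (2 * k) <= rtr (A ^+ (2 * k)).
Proof.
move=> d0 hA; have [U [lam [h1 h2 E _ /(_ d0)[i <-]]]] := herm_spectral_norm hA.
rewrite [in rtr _]E rtr_exp // (bigD1 i) //= exprM real_normK ?num_real // -exprM.
by rewrite lerDl sumr_ge0 // => j _; rewrite exprM exprn_ge0 ?sqr_ge0.
Qed.

Lemma rtr_exp_le d (A : 'M[R[i]]_d) k : A \is hermsymmx ->
  rtr (A ^+ k) <= d%:R * opnorm A ^+ k.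
Proof.
move=> hA; have [U [lam [h1 h2 E le _]]] := herm_spectral_norm hA.
rewrite [in rtr _]E rtr_exp //.
rewrite -[X in X%:R * _]card_ord mulr_natl -sumr_const ler_sum // => i _.
by rewrite (le_trans (ler_norm _)) // normrX lerXn2r ?nnegrE ?opnorm_ge0.
Qed.

Lemma opnorm_le_rtr d (A : 'M[R[i]]_d) : psd A -> opnorm A <= rtr A.
Proof.
move=> pA; case: d A pA => [|d] A pA.
  rewrite (_ : A = 0); last by apply/matrixP => -[].
  by rewrite opnorm0 /rtr mxtrace0.
have [U [lam [h1 h2 E _ /(_ isT)[i <-]]]] := herm_spectral_norm pA.1.
have l0 : forall i, 0 <= lam i by apply: (psd_spectral h1); rewrite -E.
rewrite -[A]expr1 E rtr_exp // (bigD1 i) //= ger0_norm // expr1 lerDl.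
by apply: sumr_ge0 => j _; rewrite expr1.
Qed.

Lemma opnorm_witness d (A : 'M[R[i]]_d) : (0 < d)%N -> A \is hermsymmx ->
  exists v, l2norm v = 1 /\ `|rdot v (A *m v)| = opnorm A.
Proof.
move=> d0 hA; have [U [lam [h1 h2 E _ /(_ d0)[i <-]]]] := herm_spectral_norm hA.
exists (U ^t* *m delta_mx i 0); rewrite l2norm_unitary ?trmxCK //; split.
  apply/eqP; rewrite -(@eqrXn2 _ 2) ?l2norm_ge0 // l2norm_sqr rdot_norm (bigD1 i) //= big1 => [|j ji].
    by rewrite mxE !eqxx /csq /= !expr1n expr0n /= !addr0.
  by rewrite mxE (negbTE ji) /csq /= expr0n /= addr0.
congr `|_|; rewrite [in LHS]E -!mulmxA -rdotMl (mulmxA U) h1 mul1mx rdot_diag (bigD1 i) //= big1 ?addr0 => [|j ji].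
  by rewrite mxE !eqxx /csq /= expr1n expr0n /= addr0 mulr1.
by rewrite mxE (negbTE ji) /csq /= expr0n /= addr0 mulr0.
Qed.

(** |A^* x|^2 = <x, A A^* x> <= |x| |A| |A^* x|; then divide by |A^* x|. *)
Lemma opnorm_adj_le d (A : 'M[R[i]]_d) : opnorm (A ^t*) <= opnorm A.
Proof.
apply: opnorm_le => [|x]; first exact: opnorm_ge0.
have [->|n0] := eqVneq (l2norm (A ^t* *m x)) 0.
  by rewrite mulr_ge0 ?opnorm_ge0 ?l2norm_ge0.
have p0 : 0 < l2norm (A ^t* *m x) by rewrite lt_neqAle eq_sym n0 l2norm_ge0.
rewrite -(ler_pM2l p0) -expr2 l2norm_sqr rdotMl trmxCK mulmxA -mulmxA.
rewrite (le_trans (rdot_le _ _)) // mulrC mulrA ler_wpM2r ?l2norm_ge0 //.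
by rewrite mulrC opnorm_mul.
Qed.

(** The C*-identity. It reduces the norm of an arbitrary matrix to that of a Hermitian one, on which
    the measurability of the norm rests. *)
Lemma opnorm_sqr d (A : 'M[R[i]]_d) : opnorm (A ^t* *m A) = opnorm A ^+ 2.
Proof.
apply/eqP; rewrite eq_le; apply/andP; split.
  apply: opnorm_le => [|x]; first by rewrite exprn_ge0 ?opnorm_ge0.
  rewrite -mulmxA (le_trans (opnorm_mul _ _)) // expr2 -mulrA.
  apply: ler_pM; rewrite ?opnorm_ge0 ?l2norm_ge0 //; first exact: opnorm_adj_le.
  exact: opnorm_mul.
rewrite -[leRHS]sqr_sqrtr ?opnorm_ge0 // lerXn2r ?nnegrE ?opnorm_ge0 ?sqrtr_ge0 //.
apply: opnorm_le => [|x]; first exact: sqrtr_ge0.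
rewrite -(@ler_pXn2r _ 2) ?nnegrE ?mulr_ge0 ?sqrtr_ge0 ?l2norm_ge0 //.
rewrite [leRHS]exprMn [Num.sqrt (opnorm _) ^+ 2]sqr_sqrtr ?opnorm_ge0 // [leLHS]l2norm_sqr rdotMl mulmxA.
exact: le_trans (ler_norm _) (rdot_opnorm _ _).
Qed.

Lemma csq_le_opnorm d (A : 'M[R[i]]_d) i j : csq (A i j) <= opnorm A ^+ 2.
Proof.
have e1 : l2norm (delta_mx j 0 : 'cV[R[i]]_d) ^+ 2 = 1.
  rewrite l2norm_sqr rdot_norm (bigD1 j) //= big1 => [|k kj].
    by rewrite mxE !eqxx /csq /= !expr1n expr0n /= !addr0.
  by rewrite mxE (negbTE kj) /csq /= expr0n /= addr0.
rewrite -[leRHS]mulr1 -e1 -exprMn.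
apply: (@le_trans _ _ (l2norm (A *m delta_mx j 0) ^+ 2)); last first.
  by rewrite lerXn2r ?nnegrE ?mulr_ge0 ?opnorm_ge0 ?l2norm_ge0 ?opnorm_mul.
rewrite l2norm_sqr rdot_norm (bigD1 i) //= -colE mxE lerDl sumr_ge0 // => k _.
exact: csq_ge0.
Qed.

(** |A|^2 = |A^* A| is at most the trace of A^* A, the sum of the squared moduli of the entries. It
    turns integrable entries into an integrable norm. *)
Lemma opnorm_entries d (A : 'M[R[i]]_d) :
  opnorm A <= \sum_i \sum_j (`|Re (A i j)| + `|Im (A i j)|).
Proof.
have s0 : 0 <= \sum_i \sum_j (`|Re (A i j)| + `|Im (A i j)|).
  by apply: sumr_ge0 => i _; apply: sumr_ge0 => j _; rewrite addr_ge0.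
rewrite -(@ler_pXn2r _ 2) ?nnegrE ?opnorm_ge0 // -opnorm_sqr.
have pN : psd (A ^t* *m A).
  split=> [|x]; first by apply/hermP; rewrite adjmxM trmxCK.
  by rewrite -mulmxA -rdotMl rdot_ge0.
rewrite (le_trans (opnorm_le_rtr pN)) //.
rewrite /rtr /mxtrace Re_sum exchange_big /=.
have aux (I : finType) (f : I -> R) : (forall i, 0 <= f i) ->
    \sum_i f i ^+ 2 <= (\sum_i f i) ^+ 2.
  move=> f0; rewrite expr2 mulr_suml ler_sum // => i _; rewrite expr2 ler_wpM2l //.
  by rewrite (bigD1 i) //= lerDl sumr_ge0.
apply: le_trans (aux _ _ _); last by move=> j; apply: sumr_ge0 => i _; rewrite addr_ge0.
apply: ler_sum => j _.
apply: le_trans (aux _ _ _); last by move=> i; rewrite addr_ge0.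
rewrite mxE Re_sum ler_sum // => i _; rewrite !mxE -csqE /= /csq.
rewrite -[Re _ ^+ 2]real_normK ?num_real // -[Im _ ^+ 2]real_normK ?num_real //.
have := normr_ge0 (Re (A i j)); have := normr_ge0 (Im (A i j)); nra.
Qed.
End LinearAlgebra.

(** * Khintchine's inequality *)

Section Khintchine.
Context {R : realType} {n : nat}.
Implicit Types (e : {ffun 'I_n -> bool}) (k : 'I_n).

Definition sgn (b : bool) : R := (-1) ^+ b.

Lemma sgnN b : sgn (~~ b) = - sgn b.
Proof. by case: b; rewrite /sgn ?expr0 expr1 ?opprK. Qed.

Lemma sgn_sqr b : sgn b * sgn b = 1.
Proof. by rewrite -signr_addb addbb. Qed.

Definition sign_sum d (A : 'I_n -> 'M[R[i]]_d) e : 'M[R[i]]_d :=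
  \sum_k (sgn (e k))%:C%C *: A k.

Definition flip k e : {ffun 'I_n -> bool} :=
  [ffun j => if j == k then ~~ e j else e j].

Lemma flipK k : involutive (flip k).
Proof.
by move=> e; apply/ffunP => j; rewrite !ffunE; case: eqP => // _; rewrite negbK.
Qed.

Lemma sum_flip k (F : {ffun 'I_n -> bool} -> R) : \sum_e F (flip k e) = \sum_e F e.
Proof. by rewrite [RHS](reindex_inj (inv_inj (flipK k))). Qed.

Lemma sum_sign_const (c : R) : \sum_(e : {ffun 'I_n -> bool}) c = 2 ^+ n * c.
Proof.
rewrite sumr_const -[c *+ _]mulr_natl; congr (_ * _).
rewrite (_ : #|_| = #|{: {ffun 'I_n -> bool}}|); last exact: eq_card.
by rewrite card_ffun card_bool card_ord natrX.
Qed.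

Lemma sign_sum_flip d (A : 'I_n -> 'M[R[i]]_d) k e :
  sign_sum A e - sign_sum A (flip k e) = (2 * sgn (e k))%:C%C *: A k.
Proof.
rewrite /sign_sum -sumrB (bigD1 k) //= big1 ?addr0 => [|j jk].
  rewrite ffunE eqxx sgnN -scalerBl; congr (_ *: _).
  by rewrite -(raddfB (real_complex R)); congr (_%:C%C); ring.
by rewrite ffunE (negbTE jk) subrr.
Qed.

Lemma herm_sign_sum d (A : 'I_n -> 'M[R[i]]_d) e :
  (forall k, A k \is hermsymmx) -> sign_sum A e \is hermsymmx.
Proof. by move=> h; apply: herm_sum => k; exact: hermZ (h k). Qed.

Lemma rtrZ_sqr d a (A B : 'M[R[i]]_d) :
  rtr ((a%:C%C *: A) ^+ 2 * B) = a ^+ 2 * rtr (A ^+ 2 * B).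
Proof.
by rewrite !expr2 -!mulmxE -!scalemxAl -!scalemxAr -!scalemxAl !rtrZ mulrA.
Qed.

Lemma rtrZ_mulB d a (A B C : 'M[R[i]]_d) :
  rtr ((a%:C%C *: A) * (B - C)) = a * (rtr (A * B) - rtr (A * C)).
Proof. by rewrite -mulmxE -scalemxAl rtrZ mulmxBr rtrB. Qed.

Lemma rtr_sumM d (I : Type) (r : seq I) (Q : pred I) (F : I -> 'M[R[i]]_d) B :
  rtr ((\sum_(i <- r | Q i) F i) * B) = \sum_(i <- r | Q i) rtr (F i * B).
Proof. by rewrite -mulmxE mulmx_suml rtr_sum. Qed.

Lemma rtr_mulD d (A B C : 'M[R[i]]_d) : rtr (A * (B + C)) = rtr (A * B) + rtr (A * C).
Proof. by rewrite mulrDr rtrD. Qed.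

Lemma rtr_sign_sumM d (A : 'I_n -> 'M[R[i]]_d) e C :
  rtr (sign_sum A e * C) = \sum_k sgn (e k) * rtr (A k * C).
Proof.
rewrite rtr_sumM; apply: eq_bigr => k _.
by rewrite -mulmxE -scalemxAl rtrZ.
Qed.

(** Discrete integration by parts: pairing e with its flip turns the sum with the sign sgn (e k)
    into half a sum of differences, and the trace mean value inequality bounds each difference. *)
Lemma sum_flip_le d (B : 'M[R[i]]_d) (X : {ffun 'I_n -> bool} -> 'M[R[i]]_d) k N :
  (forall e, X e \is hermsymmx) -> ~~ odd N ->
  (forall e, X e - X (flip k e) = (2 * sgn (e k))%:C%C *: B) ->
  \sum_(e : {ffun 'I_n -> bool}) sgn (e k) * rtr (B * X e ^+ N.+1) <=
  N.+1%:R * \sum_e rtr (B ^+ 2 * X e ^+ N).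
Proof.
move=> hX oN hf.
have [a aE] : exists a, a = fun e => rtr (B * X e ^+ N.+1) by exists (fun e => rtr (B * X e ^+ N.+1)).
have [b bE] : exists b, b = fun e => rtr (B ^+ 2 * X e ^+ N) by exists (fun e => rtr (B ^+ 2 * X e ^+ N)).
have step e : 2 * sgn (e k) * (a e - a (flip k e)) <=
    N.+1%:R / 2 * (4 * (b e + b (flip k e))).
  have := rtr_mean_value (hX e) (hX (flip k e)) (or_intror oN).
  rewrite hf rtrZ_mulB rtrZ_sqr rtr_mulD aE bE.
  by rewrite exprMn [sgn _ ^+ 2]expr2 sgn_sqr mulr1 (expr2 2) -natrM.
suff : \sum_(e : {ffun 'I_n -> bool}) sgn (e k) * a e <= N.+1%:R * \sum_e b e.
  by rewrite aE bE.
move=> {aE bE}.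
have E : \sum_(e : {ffun 'I_n -> bool}) sgn (e k) * a (flip k e) =
    - \sum_(e : {ffun 'I_n -> bool}) sgn (e k) * a e.
  apply: etrans (esym (sum_flip k _)) _; rewrite -[RHS]mulN1r mulr_sumr.
  apply: eq_bigr => e _.
  rewrite flipK ffunE eqxx sgnN mulN1r; exact: mulNr.
have Eb := sum_flip k b.
have : \sum_(e : {ffun 'I_n -> bool}) 2 * sgn (e k) * (a e - a (flip k e)) <=
    \sum_e N.+1%:R / 2 * (4 * (b e + b (flip k e))) by exact: ler_sum.
rewrite -!mulr_sumr big_split /= Eb.
under eq_bigr do rewrite -mulrA mulrBr.
rewrite -mulr_sumr sumrB E; lra.
Qed.

(** One factor of the power is expanded as a signed sum; the remaining exponent is 2M + 1, so
    [sum_flip_le] applies with the even N = 2M. *)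
Lemma khintchine_step d (A : 'I_n -> 'M[R[i]]_d) M :
  (forall k, A k \is hermsymmx) ->
  \sum_e rtr (sign_sum A e ^+ (2 * M.+1)) <=
  (2 * M).+1%:R * \sum_e rtr ((\sum_k A k ^+ 2) * sign_sum A e ^+ (2 * M)).
Proof.
move=> hA.
have -> : \sum_e rtr (sign_sum A e ^+ (2 * M.+1)) =
    \sum_k \sum_(e : {ffun 'I_n -> bool}) sgn (e k) * rtr (A k * sign_sum A e ^+ (2 * M).+1).
  rewrite exchange_big; apply: eq_bigr => e _ /=.
  by rewrite mulnS; exact: etrans (congr1 _ (exprS _ _)) (rtr_sign_sumM _ _ _).
have -> : \sum_e rtr ((\sum_k A k ^+ 2) * sign_sum A e ^+ (2 * M)) =
    \sum_k \sum_e rtr (A k ^+ 2 * sign_sum A e ^+ (2 * M)).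
  by rewrite exchange_big; apply: eq_bigr => e _ /=; rewrite rtr_sumM.
rewrite mulr_sumr ler_sum // => k _; apply: sum_flip_le.
- by move=> e; exact: herm_sign_sum.
- by rewrite oddM.
- by move=> e; exact: sign_sum_flip.
Qed.

(** At exponent M + 1, Young's inequality with c = 2M + 1 bounds M + 1 times the moment by (2M +
    1)^(M+1) 2^n tr H^(M+1), H the sum of squares, plus M times the same moment. The last term is
    absorbed on the left. *)
Lemma khintchine d (A : 'I_n -> 'M[R[i]]_d) M :
  (forall k, A k \is hermsymmx) ->
  \sum_e rtr (sign_sum A e ^+ (2 * M)) <=
  (2 * M)%:R ^+ M * (2 ^+ n * rtr ((\sum_k A k ^+ 2) ^+ M)).
Proof.
move=> hA; case: M => [|M].
  under eq_bigr do rewrite muln0 expr0.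
  by rewrite !expr0 mul1r sum_sign_const.
have pH : psd (\sum_k A k ^+ 2).
  by apply: psd_sum => k; apply: (@psd_even _ _ _ 1); exact: hA.
have y e := rtr_young M pH (herm_sign_sum e hA) (ler0n R (2 * M).+1).
have S := khintchine_step M hA.
have Y : M.+1%:R * ((2 * M).+1%:R * \sum_e rtr ((\sum_k A k ^+ 2) * sign_sum A e ^+ (2 * M))) <=
   (2 * M).+1%:R ^+ M.+1 * (2 ^+ n * rtr ((\sum_k A k ^+ 2) ^+ M.+1)) +
   M%:R * \sum_e rtr (sign_sum A e ^+ (2 * M.+1)).
  have -> : 2 ^+ n * rtr ((\sum_k A k ^+ 2) ^+ M.+1) =
     \sum_(e : {ffun 'I_n -> bool}) rtr ((\sum_k A k ^+ 2) ^+ M.+1).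
    by rewrite sum_sign_const.
  by rewrite !mulr_sumr -big_split /= ler_sum.
have h0 : 0 <= 2 ^+ n * rtr ((\sum_k A k ^+ 2) ^+ M.+1).
  by rewrite mulr_ge0 ?exprn_ge0 //; apply: rtr_psd_ge0; apply: psdX.
apply: (@le_trans _ _ ((2 * M).+1%:R ^+ M.+1 * (2 ^+ n * rtr ((\sum_k A k ^+ 2) ^+ M.+1)))).
  have := ler_wpM2l (ler0n R M.+1) S; move: Y; rewrite -natr1.
  move: (\sum_e _) (\sum_e _) (rtr _) => x y' z; lra.
rewrite ler_wpM2r // lerXn2r ?nnegrE ?ler0n // ler_nat.
by rewrite mulnS.
Qed.
End Khintchine.

(** * Independent families *)

Section FamilyType.
Variables (R : realType) (n d : nat).

Definition matrix_family := 'I_n -> 'M[R[i]]_d.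
HB.instance Definition _ := gen_eqMixin matrix_family.
HB.instance Definition _ := gen_choiceMixin matrix_family.
HB.instance Definition _ := isPointed.Build matrix_family (fun=> 0).

(** Boxes that constrain all coordinates at once are stable under intersection, so they form a
    pi-system on which two measures can be compared. *)
Definition rectangle : set (set matrix_family) :=
  [set C | exists E : 'I_n -> set 'M[R[i]]_d,
    (forall k, mx_borel (E k)) /\ C = [set x | forall k, E k (x k)]].

Definition mxfamily : Type := g_sigma_algebraType rectangle.
HB.instance Definition _ := Measurable.copy mxfamily (g_sigma_algebraType rectangle).
End FamilyType.

Section Families.
Context {R : realType} {n d : nat}.
Implicit Types (k : 'I_n).
Local Notation mxfamily := (mxfamily R n d).
Local Notation rectangle := (@rectangle R n d).

Lemma mx_borelT : mx_borel ([set: 'M[R[i]]_d]).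
Proof.
have [h0 hD _] : sigma_algebra setT (@mx_borel R d) by exact: smallest_sigma_algebra.
by rewrite -(setD0 setT); exact: hD.
Qed.

Lemma mx_borelI (A B : set 'M[R[i]]_d) : mx_borel A -> mx_borel B -> mx_borel (A `&` B).
Proof.
move=> mA mB.
have [h0 hD hU] : sigma_algebra setT (@mx_borel R d) by exact: smallest_sigma_algebra.
rewrite -(setCK (A `&` B)) setCI -setTD -bigcup2E; apply: (hD).
apply: hU => -[|[|k]]; rewrite /bigcup2 /=; [rewrite -setTD|rewrite -setTD|exact: h0].
  exact: (hD A).
exact: (hD B).
Qed.

Lemma rectangleI : setI_closed rectangle.
Proof.
move=> _ _ [E [hE ->]] [F [hF ->]]; exists (fun k => E k `&` F k); split.
  by move=> k; exact: mx_borelI.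
apply/seteqP; split=> x /=; first by move=> [h1 h2] k; split.
by move=> h; split=> k; case: (h k).
Qed.

Lemma measurable_fun_family dT (T : measurableType dT) (f : T -> mxfamily) :
  (forall k E, mx_borel E -> measurable [set w | E (f w k)]) -> measurable_fun setT f.
Proof.
move=> h; apply: (@measurability _ _ T mxfamily setT f rectangle) => //.
move=> _ [_ [E [hE ->]] <-]; rewrite setTI.
rewrite (_ : _ @^-1` _ = \bigcap_(k in [set: 'I_n]) [set w | E k (f w k)]).
  by apply: fin_bigcap_measurable => // k _; exact: h.
by apply/seteqP; split=> w /=; [move=> hw k _|move=> hw k]; exact: hw.
Qed.

Lemma measurable_coord k (E : set 'M[R[i]]_d) :
  mx_borel E -> measurable [set x : mxfamily | E (x k)].
Proof.
move=> hE; apply: sub_sigma_algebra.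
exists (fun j => if j == k then E else setT); split.
  by move=> j; case: ifP => _ //; exact: mx_borelT.
apply/seteqP; split=> x /=; first by move=> hx j; case: eqP => // ->.
by move=> /(_ k); rewrite eqxx.
Qed.

Lemma measurable_Re_coord k i j :
  measurable_fun setT (fun x : mxfamily => complex.Re (x k i j)).
Proof.
move=> _ B mB; rewrite setTI.
apply: (@measurable_coord k [set A | B (complex.Re (A i j))]).
by apply: sub_sigma_algebra; exists i, j, B; split => //; left.
Qed.

Lemma measurable_Im_coord k i j :
  measurable_fun setT (fun x : mxfamily => complex.Im (x k i j)).
Proof.
move=> _ B mB; rewrite setTI.
apply: (@measurable_coord k [set A | B (complex.Im (A i j))]).
by apply: sub_sigma_algebra; exists i, j, B; split => //; right.
Qed.

(** When x and y are independent copies of the outcomes, integrating over y alone amounts to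
    conditioning on the coordinates in J. *)
Definition mix (J : {set 'I_n}) (x y : mxfamily) : mxfamily :=
  fun k => if k \in J then x k else y k.

Lemma measurable_mix J : measurable_fun setT (fun z : mxfamily * mxfamily => mix J z.1 z.2).
Proof.
apply: measurable_fun_family => k E hE; rewrite /mix.
have mE := measurable_coord k hE.
case: (k \in J).
  by rewrite -[X in measurable X]setTI; exact: (@measurable_fst _ _ mxfamily mxfamily measurableT _ mE).
by rewrite -[X in measurable X]setTI; exact: (@measurable_snd _ _ mxfamily mxfamily measurableT _ mE).
Qed.

End Families.

(** * Decoupling by an independent copy *)

Section Decoupling.
Context {dT : measure_display} {T : measurableType dT} {R : realType}.
Variable P : probability T R.
Context {n d : nat}.
Variable W : 'I_n -> T -> 'M[R[i]]_d.
Hypothesis mW : forall k, random_mx (W k).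
Hypothesis iW : mutual_indep P (fun k => mx_sigma (W k)).

Definition outcome (w : T) : mxfamily R n d := fun k => W k w.

Lemma mx_sigma_preimage k E : mx_borel E -> mx_sigma (W k) [set w | E (W k w)].
Proof. by move=> hE; exists E => //; rewrite setTI. Qed.

Lemma measurable_outcome : measurable_fun setT outcome.
Proof.
by apply: measurable_fun_family => k E hE; exact: mW (mx_sigma_preimage k hE).
Qed.

Lemma mutual_indep_rect (J : {set 'I_n}) (E : 'I_n -> set 'M[R[i]]_d) :
  (forall k, mx_borel (E k)) ->
  P [set w | forall k, k \in J -> E k (W k w)] =
    (\prod_(k in J) P [set w | E k (W k w)])%E.
Proof.
move=> hE; rewrite -(iW (E := fun k => [set w | E k (W k w)])) => [|k _].
  by congr (P _); apply/seteqP; split=> w /= h k; exact: h.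
exact: mx_sigma_preimage.
Qed.

Lemma measurable_rect (J : {set 'I_n}) (E : 'I_n -> set 'M[R[i]]_d) :
  (forall k, mx_borel (E k)) ->
  measurable [set w | forall k, k \in J -> E k (W k w)].
Proof.
move=> hE; rewrite (_ : [set _ | _] = \bigcap_(k in [set` J]) [set w | E k (W k w)]).
  by apply: fin_bigcap_measurable => // k _; exact: mW (mx_sigma_preimage k (hE _)).
by apply/seteqP; split=> w /= h k; exact: h.
Qed.

Lemma mutual_indep_rect_split (J : {set 'I_n}) (E : 'I_n -> set 'M[R[i]]_d) :
  (forall k, mx_borel (E k)) ->
  P [set w | forall k, k \in [set: 'I_n]%SET -> E k (W k w)] =
    (P [set w | forall k, k \in J -> E k (W k w)] *
     P [set w | forall k, k \in ~: J -> E k (W k w)])%E.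
Proof.
move=> hE; rewrite !mutual_indep_rect // (bigID (mem J)) /=.
by congr (_ * _)%E; apply: eq_bigl => k; rewrite !inE.
Qed.

(* Both sides are finite measures that agree on the pi-system of rectangles. *)
Lemma integral_mix (J : {set 'I_n}) (h : mxfamily R n d -> \bar R) :
  measurable_fun setT h -> (forall x, (0 <= h x)%E) ->
  (\int[P]_w h (outcome w) = \int[P]_w \int[P]_w' h (mix J (outcome w) (outcome w')))%E.
Proof.
move=> mh h0.
pose phi (z : T * T) := mix J (outcome z.1) (outcome z.2).
have mo := measurable_outcome.
have mphi : measurable_fun setT phi.
  apply: (@measurableT_comp _ _ _ _ _ _ _ _ (fun z : T * T => (outcome z.1, outcome z.2))
    (@measurable_mix R n d J)).
  apply: measurable_fun_pair.
    exact: (measurableT_comp mo measurable_fst).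
  exact: (measurableT_comp mo measurable_snd).
pose HB1 := isMeasurableFun.Build _ _ _ _ _ mo.
pose HB2 := isMeasurableFun.Build _ _ _ _ _ mphi.
have E (A : set (mxfamily R n d)) : measurable A ->
    pushforward P outcome A = pushforward (P \x P)%E phi A.
  apply: (@measure_unique _ R (mxfamily R n d) (@rectangle R n d) (fun=> setT)) => //.
  - exact: rectangleI.
  - by move=> _; exists (fun=> setT); split => [k|]; [exact: mx_borelT|apply/seteqP].
  - by rewrite bigcup_const.
  - move=> _ [E [hE ->]].
    transitivity (P [set w | forall k, k \in [set: 'I_n]%SET -> E k (W k w)]).
      by congr (P _); apply/seteqP; split => w /= h' k; [move=> _; exact: h'|apply: h'; rewrite inE].
    transitivity ((P \x P)%E ([set w | forall k, k \in J -> E k (W k w)] `*`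
                              [set w | forall k, k \in ~: J -> E k (W k w)])).
      rewrite product_measure1E; [|exact: measurable_rect|exact: measurable_rect].
      exact: mutual_indep_rect_split.
    congr ((P \x P)%E _); apply/seteqP; split => -[w w'] /=.
      move=> [h1 h2] k; rewrite /phi /mix /=; case: ifPn => kJ; [exact: h1|].
      by apply: h2; rewrite inE.
    move=> h'; split=> k kJ; have := h' k; rewrite /phi /mix /= ?kJ //.
    by rewrite inE in kJ; rewrite (negbTE kJ).
  - by move=> _; rewrite /= /pushforward preimage_setT probability_setT ltry.
rewrite -[RHS](fubini_tonelli1 (fun z => h (phi z))); last 2 first.
- exact: measurableT_comp mh mphi.
- by move=> z; exact: h0.
transitivity (\int[pushforward P outcome]_x h x)%E.
  by rewrite ge0_integral_pushforward // => y _; exact: h0.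
transitivity (\int[pushforward (P \x P)%E phi]_x h x)%E.
  by apply: eq_measure_integral => A mA _; exact: E.
by rewrite ge0_integral_pushforward // => y _; exact: h0.
Qed.

(* Two functions of disjoint blocks of coordinates are independent. *)
Lemma integral_mixM (J : {set 'I_n}) (f g : mxfamily R n d -> \bar R) :
  measurable_fun setT f -> measurable_fun setT g ->
  (forall x, (0 <= f x)%E) -> (forall x, (0 <= g x)%E) ->
  (forall x y, f (mix J x y) = f x) -> (forall x y, g (mix J x y) = g y) ->
  (\int[P]_w (f (outcome w) * g (outcome w)) =
   \int[P]_w f (outcome w) * \int[P]_w g (outcome w))%E.
Proof.
move=> mf mg f0 g0 hf hg.
have mo := measurable_outcome.
rewrite (@integral_mix J (fun x => f x * g x)%E); last 2 first.
- exact: emeasurable_funM.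
- by move=> x; rewrite mule_ge0.
under eq_integral => w _.
  under eq_integral do rewrite hf hg.
  rewrite ge0_integralZl //; [over|exact: measurableT_comp mg mo].
rewrite ge0_integralZr //; first exact: measurableT_comp mf mo.
by apply: integral_ge0 => w _; exact: g0.
Qed.
End Decoupling.

(** * Measurability of matrix functions and of the operator norm *)

Section MeasurableMatrices.
Context {dS : measure_display} {S : measurableType dS} {R : realType}.

Definition measurable_mx m n (A : S -> 'M[R[i]]_(m, n)) : Prop :=
  forall i j, measurable_fun setT (fun x => complex.Re (A x i j)) /\
              measurable_fun setT (fun x => complex.Im (A x i j)).

Lemma measurable_mx_cst m n (A : 'M[R[i]]_(m, n)) : measurable_mx (fun=> A).
Proof. by move=> i j; split; exact: measurable_cst. Qed.

Lemma measurable_mxD m n (A B : S -> 'M[R[i]]_(m, n)) :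
  measurable_mx A -> measurable_mx B -> measurable_mx (fun x => A x + B x).
Proof.
move=> mA mB i j; have [a1 a2] := mA i j; have [b1 b2] := mB i j; split.
  rewrite (_ : (fun _ => _) = (fun x => complex.Re (A x i j) + complex.Re (B x i j))).
    exact: measurable_funD.
  by apply/funext => x; rewrite mxE raddfD.
rewrite (_ : (fun _ => _) = (fun x => complex.Im (A x i j) + complex.Im (B x i j))).
  exact: measurable_funD.
by apply/funext => x; rewrite mxE raddfD.
Qed.

Lemma measurable_mxN m n (A : S -> 'M[R[i]]_(m, n)) :
  measurable_mx A -> measurable_mx (fun x => - A x).
Proof.
move=> mA i j; have [a1 a2] := mA i j; split.
  rewrite (_ : (fun _ => _) = (fun x => - complex.Re (A x i j))).
    exact: measurableT_comp.
  by apply/funext => x; rewrite mxE raddfN.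
rewrite (_ : (fun _ => _) = (fun x => - complex.Im (A x i j))).
  exact: measurableT_comp.
by apply/funext => x; rewrite mxE raddfN.
Qed.

Lemma measurable_mx_sum m n (I : Type) (r : seq I) (Q : pred I) (A : I -> S -> 'M[R[i]]_(m, n)) :
  (forall i, measurable_mx (A i)) -> measurable_mx (fun x => \sum_(i <- r | Q i) A i x).
Proof.
move=> mA; elim: r => [|a r IH].
  by under eq_fun do rewrite big_nil; exact: measurable_mx_cst.
under eq_fun do rewrite big_cons.
by case: (Q a) => //; exact: measurable_mxD.
Qed.

Lemma measurable_mxM m n p (A : S -> 'M[R[i]]_(m, n)) (B : S -> 'M[R[i]]_(n, p)) :
  measurable_mx A -> measurable_mx B -> measurable_mx (fun x => A x *m B x).
Proof.
move=> mA mB i j; split.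
  rewrite (_ : (fun _ => _) = (fun x => \sum_k (complex.Re (A x i k) * complex.Re (B x k j)
      - complex.Im (A x i k) * complex.Im (B x k j)))).
    apply: measurable_sum => k; have [a1 a2] := mA i k; have [b1 b2] := mB k j.
    by apply: measurable_funB; exact: measurable_funM.
  apply/funext => x; rewrite mxE Re_sum; apply: eq_bigr => k _.
  by case: (A x i k) (B x k j) => a b [].
rewrite (_ : (fun _ => _) = (fun x => \sum_k (complex.Re (A x i k) * complex.Im (B x k j)
      + complex.Im (A x i k) * complex.Re (B x k j)))).
  apply: measurable_sum => k; have [a1 a2] := mA i k; have [b1 b2] := mB k j.
  by apply: measurable_funD; exact: measurable_funM.
apply/funext => x; rewrite mxE Im_sum; apply: eq_bigr => k _.
by case: (A x i k) (B x k j) => a b [].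
Qed.

Lemma measurable_mxX d (A : S -> 'M[R[i]]_d) k :
  measurable_mx A -> measurable_mx (fun x => A x ^+ k).
Proof.
move=> mA; elim: k => [|k IH]; first by under eq_fun do rewrite expr0; exact: measurable_mx_cst.
by under eq_fun do rewrite exprS -mulmxE; exact: measurable_mxM.
Qed.

Lemma measurable_mx_adj m n (A : S -> 'M[R[i]]_(m, n)) :
  measurable_mx A -> measurable_mx (fun x => (A x) ^t*).
Proof.
move=> mA i j; have [a1 a2] := mA j i; split.
  rewrite (_ : (fun _ => _) = (fun x => complex.Re (A x j i))) //.
  by apply/funext => x; rewrite !mxE; case: (A x j i).
rewrite (_ : (fun _ => _) = (fun x => - complex.Im (A x j i))).
  exact: measurableT_comp.
by apply/funext => x; rewrite !mxE; case: (A x j i).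
Qed.

Lemma measurable_mx_if m n (b : S -> bool) (A B : S -> 'M[R[i]]_(m, n)) :
  measurable_fun setT b -> measurable_mx A -> measurable_mx B ->
  measurable_mx (fun x => if b x then A x else B x).
Proof.
move=> mb mA mB i j; have [a1 a2] := mA i j; have [b1 b2] := mB i j; split.
  rewrite (_ : (fun _ => _) = (fun x => if b x then complex.Re (A x i j) else complex.Re (B x i j))).
    exact: measurable_fun_ifT.
  by apply/funext => x; case: (b x).
rewrite (_ : (fun _ => _) = (fun x => if b x then complex.Im (A x i j) else complex.Im (B x i j))).
  exact: measurable_fun_ifT.
by apply/funext => x; case: (b x).
Qed.

Lemma measurable_rtr d (A : S -> 'M[R[i]]_d) :
  measurable_mx A -> measurable_fun setT (fun x => rtr (A x)).
Proof.
move=> mA; rewrite (_ : (fun _ => _) = (fun x => \sum_i complex.Re (A x i i))).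
  by apply: measurable_sum => i; have [] := mA i i.
by apply/funext => x; rewrite /rtr /mxtrace Re_sum.
Qed.

(** The trace of (A^* A)^(2m) lies between |A|^(4m) and d |A|^(4m), and the factor d is negligible
    for large m. The norm is thus described by countably many conditions polynomial in the real and
    imaginary parts of the entries, whence its measurability. *)
Lemma opnorm_le_rtr_exp d (A : 'M[R[i]]_d) t : (0 < d)%N -> 0 <= t ->
  (opnorm A <= t) <->
  (forall m, rtr ((A ^t* *m A) ^+ (2 * m)) <= d%:R * (t ^+ 2) ^+ (2 * m)).
Proof.
move=> d0 t0.
have hN : A ^t* *m A \is hermsymmx by apply/hermP; rewrite adjmxM trmxCK.
split=> [h m|h].
  apply: le_trans (rtr_exp_le _ hN) _; rewrite ler_wpM2l // opnorm_sqr.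
  by rewrite !lerXn2r ?nnegrE ?exprn_ge0 ?opnorm_ge0.
rewrite leNgt; apply/negP => lt.
have o0 : 0 < opnorm A by exact: le_lt_trans t0 lt.
have {}h m : (opnorm A ^+ 4) ^+ m <= d%:R * (t ^+ 4) ^+ m.
  have := le_trans (opnorm_exp_le m d0 hN) (h m).
  by rewrite opnorm_sqr -!exprM !mulnA.
have bern (x : R) m : 0 <= x -> 1 + m%:R * x <= (1 + x) ^+ m.
  move=> x0; elim: m => [|m IH]; first by rewrite mul0r addr0 expr0.
  rewrite exprS; have : 0 <= 1 + x by rewrite addr_ge0.
  move/ler_wpM2l => /(_ _ _ IH); apply: le_trans; rewrite -natr1.
  have : 0 <= m%:R * x * x by rewrite !mulr_ge0.
  nra.
have [tz|tn] := eqVneq t 0.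
  have := h 1%N; rewrite tz !expr1 expr0n /= mulr0 leNgt.
  by rewrite exprn_gt0.
have tp : 0 < t by rewrite lt_neqAle eq_sym tn.
(* Bernoulli's inequality gives (1 + x)^m >= 1 + m x, which exceeds d for the m chosen below. *)
pose x := (opnorm A / t) ^+ 4 - 1.
have x0 : 0 < x by rewrite subr_gt0 exprn_egt1 // ltr_pdivlMr // mul1r.
pose m := (Num.truncn (d%:R / x)).+1.
have : d%:R < m%:R * x by rewrite -ltr_pdivrMr // truncnS_gt.
rewrite ltNge => /negP; apply.
have t4 : 0 < (t ^+ 4) ^+ m by rewrite !exprn_gt0.
rewrite -(ler_pM2r t4) (le_trans _ (h m)) //.
have -> : opnorm A ^+ 4 = (1 + x) * t ^+ 4.
  rewrite /x [1 + _]addrC subrK expr_div_n divfK // expf_neq0 //.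
rewrite [leRHS]exprMn ler_wpM2r ?(ltW t4) // (le_trans _ (bern x m (ltW x0))) //.
by rewrite lerDr.
Qed.

Lemma measurable_opnorm d (A : S -> 'M[R[i]]_d) : (0 < d)%N ->
  measurable_mx A -> measurable_fun setT (fun x => opnorm (A x)).
Proof.
move=> d0 mA.
apply: (measurability _ (RGenOInfty.measurableE R)).
move=> _ [_ [t ->] <-]; rewrite setTI.
have [t0|t0] := ltP t 0.
  rewrite (_ : _ @^-1` _ = setT) //; apply/seteqP; split => x //= _.
  by rewrite in_itv /= andbT (lt_le_trans t0) ?opnorm_ge0.
rewrite (_ : _ @^-1` _ = ~` \bigcap_m [set x | rtr (((A x) ^t* *m A x) ^+ (2 * m)) <= d%:R * (t ^+ 2) ^+ (2 * m)]).
  apply: measurableC; apply: bigcapT_measurable => m.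
  pose f x := rtr (((A x) ^t* *m A x) ^+ (2 * m)).
  rewrite (_ : mkset _ = f @^-1` `]-oo, d%:R * (t ^+ 2) ^+ (2 * m)]); last first.
    by apply/seteqP; split => x /=; rewrite in_itv.
  rewrite -[X in measurable X]setTI; suff mf : measurable_fun setT f by exact: mf.
  apply: measurable_rtr; apply: measurable_mxX; apply: measurable_mxM => //.
  exact: measurable_mx_adj.
apply/seteqP; split => x /=; rewrite in_itv /= andbT.
  by move=> lt h; have /(opnorm_le_rtr_exp _ d0 t0) := fun m => h m I; rewrite leNgt lt.
by move=> h; rewrite ltNge; apply/negP => /(opnorm_le_rtr_exp _ d0 t0) h'; apply: h => m _; exact: h'.
Qed.
End MeasurableMatrices.

(** * Moments of the truncated sum of squares *)

Lemma tracial_mulBB (V : pzRingType) (R : realType) (t : V -> R) :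
  (forall x y, t (x + y) = t x + t y) -> (forall x, t (- x) = - t x) ->
  forall A B C D : V, t ((A - B) * (C - D)) = t (A * C) + t (B * D) - t (B * C) - t (A * D).
Proof. by move=> tD tN A B C D; rewrite mulrBr !mulrBl !(tD, tN); ring. Qed.

Section BoundedVariables.
Context {dT : measure_display} {T : measurableType dT} {R : realType}.
Variable P : probability T R.

(** Boundedness passes to products and implies integrability, so linearity of the expectation has
    uniform side conditions. *)
Definition bounded_rv (f : T -> R) : Prop :=
  measurable_fun setT f /\ exists c, forall w, `|f w| <= c.

Lemma bounded_rv_integrable f : bounded_rv f -> P.-integrable setT (EFin \o f).
Proof.
move=> [mf [c hc]]; apply: measurable_bounded_integrable => //.
  by rewrite ltey_eq fin_num_measure.
exists c; split; first exact: num_real.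
by move=> x cx w _ /=; exact: le_trans (hc w) (ltW cx).
Qed.

Lemma bounded_rv_cst c : bounded_rv (fun=> c).
Proof. by split; [exact: measurable_cst|exists `|c|]. Qed.

Lemma bounded_rvD f g : bounded_rv f -> bounded_rv g -> bounded_rv (fun w => f w + g w).
Proof.
move=> [mf [a ha]] [mg [b hb]]; split; first exact: measurable_funD.
by exists (a + b) => w; rewrite (le_trans (ler_normD _ _)) // lerD.
Qed.

Lemma bounded_rvM f g : bounded_rv f -> bounded_rv g -> bounded_rv (fun w => f w * g w).
Proof.
move=> [mf [a ha]] [mg [b hb]]; split; first exact: measurable_funM.
by exists (a * b) => w; rewrite normrM ler_pM.
Qed.

Lemma bounded_rvZ a f : bounded_rv f -> bounded_rv (fun w => a * f w).
Proof. by move=> bf; apply: bounded_rvM => //; exact: bounded_rv_cst. Qed.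

Lemma bounded_rvB f g : bounded_rv f -> bounded_rv g -> bounded_rv (fun w => f w - g w).
Proof.
move=> bf bg; apply: bounded_rvD => //.
by under eq_fun do rewrite -mulN1r; exact: bounded_rvZ.
Qed.

Lemma bounded_rv_sum (I : Type) (r : seq I) (Q : pred I) (F : I -> T -> R) :
  (forall i, bounded_rv (F i)) -> bounded_rv (fun w => \sum_(i <- r | Q i) F i w).
Proof.
move=> h; elim: r => [|a r IH].
  by under eq_fun do rewrite big_nil; exact: bounded_rv_cst.
under eq_fun do rewrite big_cons.
by case: (Q a) => //; exact: bounded_rvD.
Qed.

Local Notation Ex f := (\int[P]_w f w)%R.

Lemma ExD f g : bounded_rv f -> bounded_rv g -> \int[P]_w (f w + g w) = Ex f + Ex g.
Proof. by move=> bf bg; rewrite RintegralD //; exact: bounded_rv_integrable. Qed.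

Lemma ExB f g : bounded_rv f -> bounded_rv g -> \int[P]_w (f w - g w) = Ex f - Ex g.
Proof. by move=> bf bg; rewrite RintegralB //; exact: bounded_rv_integrable. Qed.

Lemma ExZ a f : bounded_rv f -> \int[P]_w (a * f w) = a * Ex f.
Proof. by move=> bf; rewrite RintegralZl //; exact: bounded_rv_integrable. Qed.

Lemma Ex_cst a : \int[P]_w a = a.
Proof. rewrite Rintegral_cst // (_ : fine _ = 1) ?mulr1 // -[RHS]/(fine 1%E); congr fine.
exact: probability_setT. Qed.

Lemma Ex_sum (I : Type) (r : seq I) (Q : pred I) (F : I -> T -> R) :
  (forall i, bounded_rv (F i)) ->
  \int[P]_w (\sum_(i <- r | Q i) F i w) = \sum_(i <- r | Q i) Ex (F i).
Proof.
move=> h; elim: r => [|a r IH].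
  by under eq_Rintegral do rewrite big_nil; rewrite Ex_cst big_nil.
under eq_Rintegral do rewrite big_cons.
rewrite big_cons; case: (Q a) => //.
by rewrite ExD ?IH //; exact: bounded_rv_sum.
Qed.

Lemma Ex_le f g : bounded_rv f -> bounded_rv g -> (forall w, f w <= g w) -> Ex f <= Ex g.
Proof.
by move=> bf bg h; apply: le_Rintegral => //; exact: bounded_rv_integrable.
Qed.

Lemma Ex_fin f : bounded_rv f -> (\int[P]_w (f w)%:E)%E = (Ex f)%:E.
Proof.
move=> bf; rewrite /Rintegral fineK //.
exact: integrable_fin_num (bounded_rv_integrable bf).
Qed.

Definition bounded_rmx d (A : T -> 'M[R[i]]_d) : Prop :=
  measurable_mx A /\ exists c, forall w, opnorm (A w) <= c.

Lemma opnormM d (A B : 'M[R[i]]_d) : opnorm (A *m B) <= opnorm A * opnorm B.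
Proof.
apply: opnorm_le => [|x]; first by rewrite mulr_ge0 ?opnorm_ge0.
rewrite -mulmxA -mulrA (le_trans (opnorm_mul _ _)) //.
by rewrite ler_wpM2l ?opnorm_ge0 ?opnorm_mul.
Qed.

Lemma bounded_rmxD d (A B : T -> 'M[R[i]]_d) :
  bounded_rmx A -> bounded_rmx B -> bounded_rmx (fun w => A w + B w).
Proof.
move=> [mA [a ha]] [mB [b hb]]; split; first exact: measurable_mxD.
by exists (a + b) => w; rewrite (le_trans (opnormD _ _)) // lerD.
Qed.

Lemma bounded_rmxM d (A B : T -> 'M[R[i]]_d) :
  bounded_rmx A -> bounded_rmx B -> bounded_rmx (fun w => A w * B w).
Proof.
move=> [mA [a ha]] [mB [b hb]]; split; first exact: measurable_mxM.
by exists (a * b) => w; rewrite (le_trans (opnormM _ _)) // ler_pM ?opnorm_ge0.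
Qed.

Lemma bounded_rmx_cst d (A : 'M[R[i]]_d) : bounded_rmx (fun=> A).
Proof. by split; [exact: measurable_mx_cst|exists (opnorm A)]. Qed.

Lemma bounded_rmxX d (A : T -> 'M[R[i]]_d) k :
  bounded_rmx A -> bounded_rmx (fun w => A w ^+ k).
Proof.
move=> bA; elim: k => [|k IH]; first by under eq_fun do rewrite expr0; exact: bounded_rmx_cst.
by under eq_fun do rewrite exprS; exact: bounded_rmxM.
Qed.

Lemma bounded_rmx_sum d (I : Type) (r : seq I) (Q : pred I) (A : I -> T -> 'M[R[i]]_d) :
  (forall i, bounded_rmx (A i)) -> bounded_rmx (fun w => \sum_(i <- r | Q i) A i w).
Proof.
move=> h; elim: r => [|a r IH].
  by under eq_fun do rewrite big_nil; exact: bounded_rmx_cst.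
under eq_fun do rewrite big_cons.
by case: (Q a); [exact: bounded_rmxD (h a) IH|exact: IH].
Qed.

Lemma normr_Re_Im_le_opnorm d (A : 'M[R[i]]_d) i j :
  `|complex.Re (A i j)| <= opnorm A /\ `|complex.Im (A i j)| <= opnorm A.
Proof.
have := csq_le_opnorm A i j; rewrite /csq => h.
split; rewrite -(@ler_pXn2r _ 2) ?nnegrE ?opnorm_ge0 // real_normK ?num_real //;
  apply: le_trans h; [rewrite lerDl|rewrite lerDr]; exact: sqr_ge0.
Qed.

Lemma bounded_rmx_Re d (A : T -> 'M[R[i]]_d) i j :
  bounded_rmx A -> bounded_rv (fun w => complex.Re (A w i j)).
Proof.
move=> [mA [a ha]]; split; first by have [] := mA i j.
by exists a => w; exact: le_trans (normr_Re_Im_le_opnorm _ _ _).1 (ha w).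
Qed.

Lemma bounded_rmx_Im d (A : T -> 'M[R[i]]_d) i j :
  bounded_rmx A -> bounded_rv (fun w => complex.Im (A w i j)).
Proof.
move=> [mA [a ha]]; split; first by have [] := mA i j.
by exists a => w; exact: le_trans (normr_Re_Im_le_opnorm _ _ _).2 (ha w).
Qed.

Lemma rtrE d (A : 'M[R[i]]_d) : rtr A = \sum_i complex.Re (A i i).
Proof. by rewrite /rtr /mxtrace Re_sum. Qed.

Lemma bounded_rv_rtr d (A : T -> 'M[R[i]]_d) :
  bounded_rmx A -> bounded_rv (fun w => rtr (A w)).
Proof.
move=> bA; under eq_fun do rewrite rtrE.
by apply: bounded_rv_sum => i; exact: bounded_rmx_Re.
Qed.

Lemma rtr_mulE d (A B : 'M[R[i]]_d) : rtr (A * B) =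
  \sum_i \sum_j (complex.Re (A i j) * complex.Re (B j i) - complex.Im (A i j) * complex.Im (B j i)).
Proof.
rewrite rtrE; apply: eq_bigr => i _; rewrite -mulmxE mxE Re_sum.
by apply: eq_bigr => j _; case: (A i j) (B j i) => a b [].
Qed.

(** Stated for integrable entries because the centered matrices in the Jensen step may be
    unbounded. *)
Lemma integral_rtr_mul d (A : T -> 'M[R[i]]_d) B : integrable_mx P A ->
  P.-integrable setT (fun w => (rtr (A w * B))%:E) /\
  \int[P]_w rtr (A w * B) = rtr (mean_mx P A * B).
Proof.
move=> iA.
have iR i j c : P.-integrable setT (EFin \o (fun w => complex.Re (A w i j) * c)).
  rewrite (_ : _ \o _ = (fun w => (c%:E * (complex.Re (A w i j))%:E)%E)).
    by apply: integrableZl => //; have [] := iA i j.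
  by apply/funext => w /=; rewrite -EFinM mulrC.
have iI i j c : P.-integrable setT (EFin \o (fun w => complex.Im (A w i j) * c)).
  rewrite (_ : _ \o _ = (fun w => (c%:E * (complex.Im (A w i j))%:E)%E)).
    by apply: integrableZl => //; have [] := iA i j.
  by apply/funext => w /=; rewrite -EFinM mulrC.
pose f i j w := complex.Re (A w i j) * complex.Re (B j i) - complex.Im (A w i j) * complex.Im (B j i).
have if_ i j : P.-integrable setT (EFin \o f i j).
  have := integrableB measurableT (iR i j (complex.Re (B j i))) (iI i j (complex.Im (B j i))).
  by congr (_.-integrable _ _); apply/funext => w /=; rewrite -EFinB.
have isum (I : Type) (r : seq I) (g : I -> T -> R) :
    (forall i, P.-integrable setT (EFin \o g i)) ->
    P.-integrable setT (EFin \o (fun w => \sum_(i <- r) g i w)) /\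
    \int[P]_w (\sum_(i <- r) g i w) = \sum_(i <- r) \int[P]_w g i w.
  move=> ig; elim: r => [|a r [IH1 IH2]].
    split; last by under eq_Rintegral do rewrite big_nil; rewrite Ex_cst big_nil.
    by rewrite (_ : _ \o _ = fun=> 0%:E) ?integrable0 //; apply/funext => w /=; rewrite big_nil.
  split.
    have := integrableD measurableT (ig a) IH1.
    by congr (_.-integrable _ _); apply/funext => w /=; rewrite big_cons EFinD.
  by under eq_Rintegral do rewrite big_cons; rewrite RintegralD // big_cons IH2.
have h1 i := isum _ (index_enum _) (f i) (if_ i).
have [i2 e2] := isum _ (index_enum _) (fun i w => \sum_j f i j w) (fun i => (h1 i).1).
split.
  by rewrite (_ : (fun _ => _) = EFin \o (fun w => \sum_i \sum_j f i j w)) //;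
    apply/funext => w; rewrite rtr_mulE.
under eq_Rintegral do rewrite rtr_mulE.
rewrite e2 rtr_mulE; apply: eq_bigr => i _; rewrite (h1 i).2; apply: eq_bigr => j _.
rewrite RintegralB //; have [r1 r2] := iA i j.
by rewrite !RintegralZr // mxE /= !unlock.
Qed.

Lemma bounded_integrable_mx d (A : T -> 'M[R[i]]_d) : bounded_rmx A -> integrable_mx P A.
Proof.
move=> bA i j; split; apply: bounded_rv_integrable.
  exact: bounded_rmx_Re.
exact: bounded_rmx_Im.
Qed.

Lemma Ex_rtr_mul d (A : T -> 'M[R[i]]_d) B :
  bounded_rmx A -> \int[P]_w rtr (A w * B) = rtr (mean_mx P A * B).
Proof. by move=> /bounded_integrable_mx/integral_rtr_mul-/(_ B)[]. Qed.

Lemma Ex_rtr_mulr d (A : T -> 'M[R[i]]_d) B :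
  bounded_rmx A -> \int[P]_w rtr (B * A w) = rtr (B * mean_mx P A).
Proof.
by move=> bA; rewrite rtrC -Ex_rtr_mul //; under eq_Rintegral do rewrite rtrC.
Qed.

Lemma psd_sqr d (A : 'M[R[i]]_d) : A \is hermsymmx -> psd (A ^+ 2).
Proof. exact: (@psd_even R d A 1). Qed.

(** The left side is the trace of (Y - Y') ((Y + Z)^(N+1) - (Y' + Z)^(N+1)). The mean value
    inequality produces (Y - Y')^2, replaced under the trace by 2 Y^2 + 2 Y'^2, and then Y^2 = A^4
    by u^2 Y. *)
Lemma exchange_pointwise d (A A' Z : 'M[R[i]]_d) u N :
  A \is hermsymmx -> A' \is hermsymmx -> psd Z -> opnorm A <= u -> opnorm A' <= u ->
  forall Y Y' : 'M[R[i]]_d, Y = A ^+ 2 -> Y' = A' ^+ 2 ->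
  rtr (Y * (Y + Z) ^+ N.+1) + rtr (Y' * (Y' + Z) ^+ N.+1)
    - rtr (Y' * (Y + Z) ^+ N.+1) - rtr (Y * (Y' + Z) ^+ N.+1) <=
  N.+1%:R * u ^+ 2 * (rtr (Y * (Y + Z) ^+ N) + rtr (Y' * (Y + Z) ^+ N)
    + (rtr (Y * (Y' + Z) ^+ N) + rtr (Y' * (Y' + Z) ^+ N))).
Proof.
have lin (k a b c e : R) : a <= k * c -> b <= k * e -> 2 * a + 2 * b <= 2 * k * (c + e).
  by move=> h1 h2; lra.
have alg (n k a b c e : R) :
    n / 2 * (2 * k * (a + b) + 2 * k * (c + e)) = n * k * (a + b + (c + e)) by field.
move=> hA hA' pZ Au Au' Y Y' YE YE'.
have pY : psd Y by rewrite YE; exact: psd_sqr.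
have pY' : psd Y' by rewrite YE'; exact: psd_sqr.
have pA := psdD pY pZ; have pB := psdD pY' pZ.
have mv := rtr_mean_value pA.1 pB.1 (or_introl (conj pA pB)) (N := N).
have DE : Y + Z - (Y' + Z) = Y - Y' :> 'M[R[i]]_d by rewrite opprD addrACA subrr addr0.
rewrite DE (rtr_mulD ((Y - Y') ^+ 2)) in mv.
have e1 : rtr ((Y - Y') * ((Y + Z) ^+ N.+1 - (Y' + Z) ^+ N.+1)) =
   rtr (Y * (Y + Z) ^+ N.+1) + rtr (Y' * (Y' + Z) ^+ N.+1)
    - rtr (Y' * (Y + Z) ^+ N.+1) - rtr (Y * (Y' + Z) ^+ N.+1).
  exact: (tracial_mulBB (@rtrD R d) (@rtrN R d)).
rewrite e1 in mv; apply: le_trans mv _.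
have key C : psd C -> rtr ((Y - Y') ^+ 2 * C) <= 2 * u ^+ 2 * (rtr (Y * C) + rtr (Y' * C)).
  move=> pC; apply: le_trans (rtr_sqrB_le pY.1 pY'.1 pC) _.
  have h1 : rtr (Y ^+ 2 * C) <= u ^+ 2 * rtr (Y * C) by rewrite YE; exact: rtr_sqr_le.
  have h2 : rtr (Y' ^+ 2 * C) <= u ^+ 2 * rtr (Y' * C) by rewrite YE'; exact: rtr_sqr_le.
  exact: lin h1 h2.
have k1 := key _ (psdX N pA); have k2 := key _ (psdX N pB).
have n0 : 0 <= N.+1%:R / 2 :> R by [].
apply: le_trans (ler_wpM2l n0 (lerD k1 k2)) _.
by rewrite alg.
Qed.

(* Integrating a pointwise inequality over two independent copies of [(Y, B0, B1)]. *)
Lemma decoupled_expectation d (Y B0 B1 : T -> 'M[R[i]]_d) (m0 : 'M[R[i]]_d) k :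
  bounded_rmx Y -> bounded_rmx B0 -> bounded_rmx B1 -> m0 = mean_mx P Y ->
  (forall w w', rtr (Y w * B1 w) + rtr (Y w' * B1 w')
    - rtr (Y w' * B1 w) - rtr (Y w * B1 w') <=
    k * (rtr (Y w * B0 w) + rtr (Y w' * B0 w) + (rtr (Y w * B0 w') + rtr (Y w' * B0 w')))) ->
  \int[P]_w rtr (Y w * B1 w) <= \int[P]_w rtr (m0 * B1 w) +
    k * (\int[P]_w rtr (Y w * B0 w) + \int[P]_w rtr (m0 * B0 w)).
Proof.
have fin (a b c x y : R) : a + a - b - b <= c * (x + y + (y + x)) -> a <= b + c * (x + y).
  by move=> h; lra.
move=> bY bB0 bB1 mE pw.
have bf B : bounded_rmx B -> bounded_rv (fun w => rtr (Y w * B w)).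
  by move=> bB; exact: bounded_rv_rtr (bounded_rmxM bY bB).
have bh B : bounded_rmx B -> bounded_rv (fun w => rtr (m0 * B w)).
  by move=> bB; exact: bounded_rv_rtr (bounded_rmxM (bounded_rmx_cst m0) bB).
have bg B : bounded_rv (fun w => rtr (Y w * B)).
  exact: bounded_rv_rtr (bounded_rmxM bY (bounded_rmx_cst B)).
have bl w B : bounded_rmx B -> bounded_rv (fun w' => rtr (Y w * B w')).
  by move=> bB; exact: bounded_rv_rtr (bounded_rmxM (bounded_rmx_cst (Y w)) bB).
have bc c := bounded_rv_cst c.
have gh B : bounded_rmx B -> \int[P]_w rtr (Y w * mean_mx P B) = \int[P]_w rtr (m0 * B w).
  by move=> bB; rewrite (Ex_rtr_mul _ bY) (Ex_rtr_mulr _ bB) mE.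
pose c1 := \int[P]_w' rtr (Y w' * B1 w'); pose c0 := \int[P]_w' rtr (Y w' * B0 w').
have inner w : rtr (Y w * B1 w) + c1 - rtr (m0 * B1 w) - rtr (Y w * mean_mx P B1) <=
    k * (rtr (Y w * B0 w) + rtr (m0 * B0 w) + (rtr (Y w * mean_mx P B0) + c0)).
  have bl1 := bounded_rvD (bc (rtr (Y w * B1 w))) (bf _ bB1).
  have bl2 := bounded_rvB bl1 (bg (B1 w)).
  have br1 := bounded_rvD (bc (rtr (Y w * B0 w))) (bg (B0 w)).
  have br2 := bounded_rvD (bl w _ bB0) (bf _ bB0).
  have := Ex_le (bounded_rvB bl2 (bl w _ bB1)) (bounded_rvZ k (bounded_rvD br1 br2)) (pw w).
  rewrite (ExB bl2 (bl w _ bB1)) (ExB bl1 (bg _)) (ExD (bc _) (bf _ bB1)) Ex_cst.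
  rewrite (ExZ _ (bounded_rvD br1 br2)) (ExD br1 br2) (ExD (bc _) (bg _)).
  rewrite (ExD (bl w _ bB0) (bf _ bB0)) Ex_cst !(Ex_rtr_mul _ bY).
  by rewrite (Ex_rtr_mulr _ bB0) (Ex_rtr_mulr _ bB1) -mE.
apply: fin.
have bl1 := bounded_rvD (bf _ bB1) (bc c1).
have bl2 := bounded_rvB bl1 (bh _ bB1).
have br1 := bounded_rvD (bf _ bB0) (bh _ bB0).
have br2 := bounded_rvD (bg (mean_mx P B0)) (bc c0).
have := Ex_le (bounded_rvB bl2 (bg (mean_mx P B1))) (bounded_rvZ k (bounded_rvD br1 br2)) inner.
rewrite (ExB bl2 (bg _)) (ExB bl1 (bh _ bB1)) (ExD (bf _ bB1) (bc _)) Ex_cst.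
rewrite (ExZ _ (bounded_rvD br1 br2)) (ExD br1 br2) (ExD (bf _ bB0) (bh _ bB0)).
by rewrite (ExD (bg _) (bc _)) Ex_cst (gh _ bB0) (gh _ bB1).
Qed.

(** Replacing Y by its mean in front of a power of Y + Z costs only terms with that power lowered by
    one and a factor u^2. *)
Lemma exchange_expectation d (A Y : T -> 'M[R[i]]_d) (Z m0 : 'M[R[i]]_d) u N :
  measurable_mx A -> (forall w, A w \is hermsymmx) -> (forall w, opnorm (A w) <= u) ->
  psd Z -> (forall w, Y w = A w ^+ 2) -> m0 = mean_mx P Y ->
  \int[P]_w rtr (Y w * (Y w + Z) ^+ N.+1) <=
  \int[P]_w rtr (m0 * (Y w + Z) ^+ N.+1) + N.+1%:R * u ^+ 2 *
    (\int[P]_w rtr (Y w * (Y w + Z) ^+ N) + \int[P]_w rtr (m0 * (Y w + Z) ^+ N)).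
Proof.
move=> mA hA Au pZ YE mE.
have bA : bounded_rmx A by split; [exact: mA|exists u].
have bY : bounded_rmx Y.
  by rewrite (_ : Y = fun w => A w ^+ 2); [exact: bounded_rmxX|exact/funext].
have bX j := bounded_rmxX j (bounded_rmxD bY (bounded_rmx_cst Z)).
apply: (decoupled_expectation bY (bX N) (bX N.+1) mE) => w w'.
exact: (exchange_pointwise N (hA w) (hA w') pZ (Au w) (Au w') (YE w) (YE w')).
Qed.
End BoundedVariables.

(** In the application a j = E tr S^j, b j = E tr V S^j, t = tr V, s = |V| and v = u^2. With c = s +
    (m + 1) v the recursion gives a (j+2) <= c a (j+1) + c^2 a j for j >= 1, and growth at rate 2 c
    is preserved since 1/2 + 1/4 < 1. *)
Lemma recursion_bound (R : realType) (a b : nat -> R) (t s v : R) m :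
  0 <= s -> 0 <= v -> (forall j, 0 <= a j) -> a 1%N <= t -> b 0%N = t ->
  (forall j, b j <= s * a j) ->
  (forall N, a N.+2 <= b N.+1 + N.+1%:R * v * (a N.+1 + b N)) ->
  a m.+1 <= t * (2 * (s + m.+1%:R * v)) ^+ m.
Proof.
move=> s0 v0 a0 a1 b0 hb rec.
have t0 : 0 <= t by exact: le_trans (a0 1%N) a1.
set c := s + m.+1%:R * v.
have mv0 : 0 <= m.+1%:R * v by rewrite mulr_ge0.
have c0 : 0 <= c by rewrite addr_ge0.
suff : forall j, ((j <= m)%N -> a j.+1 <= t * (2 * c) ^+ j) /\
    ((j.+1 <= m)%N -> a j.+2 <= t * (2 * c) ^+ j.+1).
  by move=> /(_ m)[h _]; exact: h.
elim=> [|j [IH1 IH2]].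
  split=> [_|m1]; first by rewrite expr0 mulr1.
  (* Here b 0 is replaced by its value t. The bound [b 0 <= s * a 0] would bring in a 0, which is
     the dimension in the application. *)
  have := rec 0%N; have := hb 1%N; rewrite b0 expr1 mul1r.
  have : v <= m.+1%:R * v by rewrite ler_peMl // ler1n.
  have : 1 * v <= m.+1%:R * v * 1 by rewrite mulr1 ler_wpM2r // ler1n.
  have : s * a 1%N <= s * t by rewrite ler_wpM2l.
  have : v * a 1%N <= v * t by rewrite ler_wpM2l.
  have : 2 * (v * t) <= m.+1%:R * v * t.
    by rewrite mulrA ler_wpM2r // ler_wpM2r // ler_nat.
  have : 0 <= s * t by rewrite mulr_ge0.
  have : 0 <= m.+1%:R * v * t by rewrite mulr_ge0.
  rewrite /c; move: (m.+1%:R * v) => mv; nra.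
split; first exact: IH2.
move=> jm; have h1 := IH1 (ltnW (ltnW jm)); have h2 := IH2 (ltnW jm).
have := rec j.+1; have := hb j.+2; have := hb j.+1.
have kv : j.+2%:R * v <= m.+1%:R * v by rewrite ler_wpM2r // ler_nat leqW.
have kv0 : 0 <= j.+2%:R * v by rewrite mulr_ge0.
move: (j.+2%:R * v) kv kv0 => k kv kv0 hb1 hb2 hr.
have e1 : k * b j.+1 <= c * (c * a j.+1).
  apply: le_trans (ler_wpM2l kv0 hb1) _; apply: ler_pM => //.
  - by rewrite mulr_ge0.
  - by rewrite /c; move: kv; move: (m.+1%:R * v) s0 => mv; lra.
  - by rewrite ler_wpM2r // /c lerDl.
have e2 : (s + k) * a j.+2 <= c * a j.+2.
  by rewrite ler_wpM2r // /c lerD2l.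
have e3 : c * a j.+2 <= c * (t * (2 * c) ^+ j.+1) by rewrite ler_wpM2l.
have e4 : c * (c * a j.+1) <= c * (c * (t * (2 * c) ^+ j)) by rewrite !ler_wpM2l.
have e5 : 0 <= c * (c * (t * (2 * c) ^+ j)).
  by rewrite !mulr_ge0 // exprn_ge0 // mulr_ge0.
move: e3 e4 e5; rewrite !exprS; move: (_ ^+ j) => x e3 e4 e5.
have -> : t * (2 * c * (2 * c * x)) = 4 * (c * (c * (t * x))) by ring.
have e3' : c * a j.+2 <= 2 * (c * (c * (t * x))) by apply: le_trans e3 _; rewrite le_eqVlt; apply/orP; left; apply/eqP; ring.
apply: le_trans hr _.
have -> : b j.+2 + k * (a j.+2 + b j.+1) = b j.+2 + k * a j.+2 + k * b j.+1 by ring.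
have : b j.+2 + k * a j.+2 <= (s + k) * a j.+2 by rewrite mulrDl lerD2r.
lra.
Qed.

Section IndependentFamily.
Context {dT : measure_display} {T : measurableType dT} {R : realType}.
Variable P : probability T R.
Context {n d : nat}.
Variable W : 'I_n -> T -> 'M[R[i]]_d.
Hypothesis mW : forall k, random_mx (W k).
Hypothesis iW : mutual_indep P (fun k => mx_sigma (W k)).

Local Notation out := (outcome W).

Lemma mix_outcomeK J w : mix J (out w) (out w) = out w.
Proof. by apply/funext => k; rewrite /mix; case: ifP. Qed.

Lemma measurable_mix_outcome J :
  measurable_fun setT (fun z : T * T => mix J (out z.1) (out z.2)).
Proof.
have mo := measurable_outcome mW.
apply: (@measurableT_comp _ _ _ _ _ _ _ _ (fun z : T * T => (out z.1, out z.2))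
    (@measurable_mix R n d J)).
apply: measurable_fun_pair.
  exact: (measurableT_comp mo measurable_fst).
exact: (measurableT_comp mo measurable_snd).
Qed.

(** [integral_mix] for bounded functions of any sign, reduced to the nonnegative case by adding the
    constant c. *)
Lemma Ex_mix (J : {set 'I_n}) (h : mxfamily R n d -> R) c :
  measurable_fun setT h -> (forall w w', `|h (mix J (out w) (out w'))| <= c) ->
  (forall w, bounded_rv (fun w' => h (mix J (out w) (out w')))) /\
  bounded_rv (fun w => \int[P]_w' h (mix J (out w) (out w'))) /\
  bounded_rv (fun w => h (out w)) /\
  \int[P]_w h (out w) = \int[P]_w \int[P]_w' h (mix J (out w) (out w')).
Proof.
move=> mh hc.
pose H (z : T * T) := h (mix J (out z.1) (out z.2)).
have mH : measurable_fun setT H by exact: (measurableT_comp mh (measurable_mix_outcome J)).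
have mHc : measurable_fun setT (fun z => H z + c) by exact: measurable_funD.
have b1 w : bounded_rv (fun w' => h (mix J (out w) (out w'))).
  split; last by exists c => w'; exact: hc.
  exact: (measurableT_comp mH (measurable_pair1 w)).
have b0 : bounded_rv (fun w => h (out w)).
  split; first exact: (measurableT_comp mh (measurable_outcome mW)).
  by exists c => w; rewrite -(mix_outcomeK J); exact: hc.
have Hc0 z : 0 <= H z + c.
  by have := hc z.1 z.2; rewrite -/(H z) ler_norml => /andP[]; lra.
have b1c w := bounded_rvD (b1 w) (bounded_rv_cst c).
have E w : (\int[P]_w' (H (w, w') + c)%:E)%E = (\int[P]_w' h (mix J (out w) (out w')) + c)%:E.
  by rewrite (Ex_fin P (b1c w)) (ExD P (b1 w) (bounded_rv_cst c)) Ex_cst.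
have b2 : bounded_rv (fun w => \int[P]_w' h (mix J (out w) (out w'))).
  have m2 : measurable_fun setT (fun w => \int[P]_w' h (mix J (out w) (out w'))).
    rewrite (_ : (fun _ => _) = (fun w => fine (\int[P]_w' (H (w, w') + c)%:E)%E - c)); last first.
      by apply/funext => w; rewrite E /= addrK.
    apply: measurable_funB => //; apply: measurableT_comp => //.
    apply: (measurable_fun_fubini_tonelli_F (m2 := P) (fun z => (H z + c)%:E)).
      exact/measurable_EFinP.
    by move=> z; rewrite lee_fin.
  split => //; exists c => w.
  have := Ex_le P (b1 w) (bounded_rv_cst c) (fun w' => le_trans (ler_norm _) (hc w w')).
  have nc w' : - c <= h (mix J (out w) (out w')) by have := hc w w'; rewrite ler_norml => /andP[].
  have := Ex_le P (bounded_rv_cst (- c)) (b1 w) nc.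
  by rewrite !Ex_cst ler_norml => -> ->.
split=> //; split=> //; split=> //.
(* The bound on h is known only at mixed outcomes, so h + c is cut at 0 to be nonnegative
   everywhere. *)
pose g x := (Num.max (h x + c) 0)%:E.
have mg : measurable_fun setT g.
  apply/measurable_EFinP; apply: measurable_maxr => //; exact: measurable_funD.
have g0 x : (0 <= g x)%E by rewrite lee_fin le_max lexx orbT.
have gE w w' : g (mix J (out w) (out w')) = (H (w, w') + c)%:E.
  by rewrite /g max_l //; exact: (Hc0 (w, w')).
have := integral_mix mW iW J mg g0.
under eq_integral => w _ do rewrite -(mix_outcomeK J) gE.
under [RHS]eq_integral => w _.
  under eq_integral => w' _ do rewrite gE.
  rewrite E; over.
under eq_integral => w _ do rewrite /H /= mix_outcomeK.
rewrite (Ex_fin P (bounded_rvD b0 (bounded_rv_cst c))) (Ex_fin P (bounded_rvD b2 (bounded_rv_cst c))).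
by rewrite (ExD P b0 (bounded_rv_cst c)) (ExD P b2 (bounded_rv_cst c)) Ex_cst => -[] /addIr.
Qed.

Lemma measurable_mx_coord k : measurable_mx (fun x : mxfamily R n d => x k).
Proof. by move=> i j; split; [exact: measurable_Re_coord|exact: measurable_Im_coord]. Qed.

Section TruncatedMoments.
Variables (phi : 'M[R[i]]_d -> 'M[R[i]]_d) (u : R).
Hypothesis mphi : forall k, measurable_mx (fun x : mxfamily R n d => phi (x k)).
Hypothesis hphi : forall A, A \is hermsymmx -> phi A \is hermsymmx.
Hypothesis phiu : forall A, opnorm (phi A) <= u.
Hypothesis hW : forall k w, W k w \is hermsymmx.

Definition sqr_sum (x : mxfamily R n d) : 'M[R[i]]_d := \sum_k phi (x k) ^+ 2.

Lemma bounded_phi k : bounded_rmx (fun w => phi (W k w)).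
Proof.
split; last by exists u => w; exact: phiu.
move=> i j; have [h1 h2] := mphi k i j.
have mo := measurable_outcome mW.
by split; [exact: (measurableT_comp h1 mo)|exact: (measurableT_comp h2 mo)].
Qed.

Lemma measurable_sqr_sum : measurable_mx sqr_sum.
Proof. by apply: measurable_mx_sum => k; exact: measurable_mxX. Qed.

Lemma bounded_sqr_sum : bounded_rmx (fun w => sqr_sum (out w)).
Proof. by apply: bounded_rmx_sum => k; exact: bounded_rmxX (bounded_phi k). Qed.

Lemma psd_sqr_sum w : psd (sqr_sum (out w)).
Proof. by apply: psd_sum => k; apply: psd_sqr; exact: hphi (hW k w). Qed.

(** For fixed w only the k-th square depends on w'; the others form the constant matrix Z of
    [exchange_expectation]. *)
Lemma sqr_sum_mix k w w' : sqr_sum (mix (~: [set k])%SET (out w) (out w')) =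
  phi (W k w') ^+ 2 + \sum_(j | j != k) phi (W j w) ^+ 2.
Proof.
rewrite /sqr_sum (bigD1 k) //=; congr (_ + _).
  by rewrite /mix !inE eqxx.
by apply: eq_bigr => j jk; rewrite /mix !inE jk.
Qed.

Lemma opnorm_sqr_sum_mix J w w' :
  opnorm (sqr_sum (mix J (out w) (out w'))) <= \sum_(k < n) u ^+ 2.
Proof.
apply: le_trans (opnorm_sum _ _ _) _; apply: ler_sum => k _.
rewrite expr2 -mulmxE (le_trans (opnormM _ _)) // expr2.
by apply: ler_pM; rewrite ?opnorm_ge0 ?phiu.
Qed.

Lemma opnorm_exp d' (A : 'M[R[i]]_d') c k : 0 <= c -> opnorm A <= c ->
  opnorm (A ^+ k) <= opnorm (1 : 'M[R[i]]_d') * c ^+ k.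
Proof.
move=> c0 h; elim: k => [|k IH]; first by rewrite !expr0 mulr1.
rewrite exprS -mulmxE (le_trans (opnormM _ _)) // exprS mulrCA.
by apply: ler_pM; rewrite ?opnorm_ge0.
Qed.

Lemma normr_rtr_le d' (A : 'M[R[i]]_d') : `|rtr A| <= d'%:R * opnorm A.
Proof.
rewrite rtrE (le_trans (ler_norm_sum _ _ _)) // -[X in X%:R * _]card_ord mulr_natl -sumr_const.
by apply: ler_sum => i _; exact: (normr_Re_Im_le_opnorm A i i).1.
Qed.

(** [exchange_expectation] conditionally on all summands but the k-th, then integrated over
    those. *)
Lemma moment_exchange k (m0 : 'M[R[i]]_d) N :
  m0 = mean_mx P (fun w => phi (W k w) ^+ 2) ->
  \int[P]_w rtr (phi (W k w) ^+ 2 * sqr_sum (out w) ^+ N.+1) <=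
  \int[P]_w rtr (m0 * sqr_sum (out w) ^+ N.+1) + N.+1%:R * u ^+ 2 *
   (\int[P]_w rtr (phi (W k w) ^+ 2 * sqr_sum (out w) ^+ N)
    + \int[P]_w rtr (m0 * sqr_sum (out w) ^+ N)).
Proof.
move=> mE.
have u0 : 0 <= u by exact: le_trans (opnorm_ge0 _) (phiu 0).
pose J := (~: [set k])%SET.
pose f j (x : mxfamily R n d) := rtr (phi (x k) ^+ 2 * sqr_sum x ^+ j).
pose h j (x : mxfamily R n d) := rtr (m0 * sqr_sum x ^+ j).
have mf j : measurable_fun setT (f j).
  by apply: measurable_rtr; apply: measurable_mxM; apply: measurable_mxX;
    [exact: mphi|exact: measurable_sqr_sum].
have mh j : measurable_fun setT (h j).
  apply: measurable_rtr; apply: measurable_mxM; first exact: measurable_mx_cst.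
  exact: measurable_mxX measurable_sqr_sum.
pose c j := opnorm (1 : 'M[R[i]]_d) * (\sum_(k < n) u ^+ 2) ^+ j.
have s0 : 0 <= \sum_(k < n) u ^+ 2 by apply: sumr_ge0 => i _; exact: sqr_ge0.
have hf j w w' : `|f j (mix J (out w) (out w'))| <= d%:R * (u ^+ 2 * c j).
  apply: le_trans (normr_rtr_le _) _; rewrite ler_wpM2l // -mulmxE.
  apply: le_trans (opnormM _ _) _; apply: ler_pM; rewrite ?opnorm_ge0 //.
    rewrite expr2 -mulmxE (le_trans (opnormM _ _)) // expr2.
    by apply: ler_pM; rewrite ?opnorm_ge0 ?phiu.
  exact: opnorm_exp s0 (opnorm_sqr_sum_mix _ _ _).
have hh j w w' : `|h j (mix J (out w) (out w'))| <= d%:R * (opnorm m0 * c j).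
  apply: le_trans (normr_rtr_le _) _; rewrite ler_wpM2l // -mulmxE.
  apply: le_trans (opnormM _ _) _; apply: ler_pM; rewrite ?opnorm_ge0 //.
  exact: opnorm_exp s0 (opnorm_sqr_sum_mix _ _ _).
have [_ [bf [_ Ef]]] := Ex_mix (mf N) (hf N).
have [_ [bf1 [_ Ef1]]] := Ex_mix (mf N.+1) (hf N.+1).
have [_ [bh [_ Eh]]] := Ex_mix (mh N) (hh N).
have [_ [bh1 [_ Eh1]]] := Ex_mix (mh N.+1) (hh N.+1).
have inner w : \int[P]_w' f N.+1 (mix J (out w) (out w')) <=
   \int[P]_w' h N.+1 (mix J (out w) (out w')) + N.+1%:R * u ^+ 2 *
   (\int[P]_w' f N (mix J (out w) (out w')) + \int[P]_w' h N (mix J (out w) (out w'))).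
  have fE j w' : f j (mix J (out w) (out w')) = rtr (phi (W k w') ^+ 2 *
     (phi (W k w') ^+ 2 + \sum_(j | j != k) phi (W j w) ^+ 2) ^+ j).
    by rewrite /f /J sqr_sum_mix /mix !inE eqxx.
  have hE j w' : h j (mix J (out w) (out w')) = rtr (m0 *
     (phi (W k w') ^+ 2 + \sum_(j | j != k) phi (W j w) ^+ 2) ^+ j).
    by rewrite /h /J sqr_sum_mix.
  under eq_Rintegral do rewrite fE.
  under [X in _ <= X + _]eq_Rintegral do rewrite hE.
  under [X in _ <= _ + _ * (X + _)]eq_Rintegral do rewrite fE.
  under [X in _ <= _ + _ * (_ + X)]eq_Rintegral do rewrite hE.
  have h1 : measurable_mx (fun w' => phi (W k w')) by have [] := bounded_phi k.
  have h2 w' : phi (W k w') \is hermsymmx by exact: hphi (hW k w').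
  have h3 w' : opnorm (phi (W k w')) <= u by exact: phiu.
  have h4 : psd (\sum_(j | j != k) phi (W j w) ^+ 2).
    by apply: psd_sum => j; apply: psd_sqr; exact: hphi (hW j w).
  exact: (exchange_expectation N h1 h2 h3 h4 (fun=> erefl) mE).
have br := bounded_rvD bf bh.
have := Ex_le P bf1 (bounded_rvD bh1 (bounded_rvZ (N.+1%:R * u ^+ 2) br)) inner.
by rewrite (ExD P bh1 (bounded_rvZ _ br)) (ExZ P _ br) (ExD P bf bh) -Ef -Eh -Ef1 -Eh1.
Qed.

Lemma Ex_sqr_sum_mul B (V : 'M[R[i]]_d) : bounded_rmx B ->
  \int[P]_w rtr (sqr_sum (out w) * B w) =
  \sum_k \int[P]_w rtr (phi (W k w) ^+ 2 * B w).
Proof.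
move=> bB; under eq_Rintegral do rewrite rtr_sumM.
rewrite (@Ex_sum _ _ _ P _ _ _ (fun k w => rtr (phi (W k w) ^+ 2 * B w))) // => k.
exact: bounded_rv_rtr (bounded_rmxM (bounded_rmxX 2 (bounded_phi k)) bB).
Qed.

(** Sum of [moment_exchange] over k. The sum of the means is below V in the Loewner order, and the
    trace against a psd power respects this order. *)
Lemma moment_recursion (V : 'M[R[i]]_d) N :
  psd (V - \sum_k mean_mx P (fun w => phi (W k w) ^+ 2)) ->
  \int[P]_w rtr (sqr_sum (out w) ^+ N.+2) <=
  \int[P]_w rtr (V * sqr_sum (out w) ^+ N.+1) + N.+1%:R * u ^+ 2 *
   (\int[P]_w rtr (sqr_sum (out w) ^+ N.+1) + \int[P]_w rtr (V * sqr_sum (out w) ^+ N)).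
Proof.
have fin (a b b' k x y y' : R) : 0 <= k -> a <= b + k * (x + y) -> b <= b' -> y <= y' ->
    a <= b' + k * (x + y').
  move=> k0 h1 h2 h3; apply: le_trans h1 _; apply: lerD => //.
  by rewrite ler_wpM2l // lerD2l.
have fin2 (x1 x0 s1 s0 g1 g0 c : R) : x1 = s1 -> x0 = s0 ->
    s1 <= g1 + c * (s0 + g0) -> x1 <= g1 + c * (x0 + g0) by move=> -> ->.
have sumfin (F0 F1 G0 G1 : 'I_n -> R) c : (forall k, F1 k <= G1 k + c * (F0 k + G0 k)) ->
    \sum_k F1 k <= \sum_k G1 k + c * (\sum_k F0 k + \sum_k G0 k).
  by move=> h; rewrite -big_split /= mulr_sumr -big_split /=; exact: ler_sum.
pose m k := mean_mx P (fun w => phi (W k w) ^+ 2).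
move=> pV; have bX j := bounded_rmxX j bounded_sqr_sum.
have E j : \int[P]_w rtr (sqr_sum (out w) ^+ j.+1) =
    \sum_k \int[P]_w rtr (phi (W k w) ^+ 2 * sqr_sum (out w) ^+ j).
  by rewrite -Ex_sqr_sum_mul //; under eq_Rintegral do rewrite exprS.
have bm k j : bounded_rv (fun w => rtr (m k * sqr_sum (out w) ^+ j)).
  exact: bounded_rv_rtr (bounded_rmxM (bounded_rmx_cst (m k)) (bX j)).
have bV j : bounded_rv (fun w => rtr (V * sqr_sum (out w) ^+ j)).
  exact: bounded_rv_rtr (bounded_rmxM (bounded_rmx_cst V) (bX j)).
have mV j : \sum_k \int[P]_w rtr (m k * sqr_sum (out w) ^+ j) <=
    \int[P]_w rtr (V * sqr_sum (out w) ^+ j).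
  rewrite -(@Ex_sum _ _ _ P _ _ _ (fun k w => rtr (m k * sqr_sum (out w) ^+ j))) //.
  apply: Ex_le => [||w]; [exact: bounded_rv_sum|exact: bV|].
  rewrite -rtr_sumM -subr_ge0 -rtrB -mulrBl.
  by apply: rtr_psd_mul => //; apply: psdX; exact: psd_sqr_sum.
apply: fin (mV N.+1) (mV N); first by rewrite mulr_ge0 ?sqr_ge0.
exact: fin2 (E N.+1) (E N) (sumfin _ _ _ _ _ (fun k => moment_exchange N (erefl (m k)))).
Qed.

Lemma psd_moments (V : 'M[R[i]]_d) m :
  V \is hermsymmx ->
  psd (V - \sum_k mean_mx P (fun w => phi (W k w) ^+ 2)) ->
  \int[P]_w rtr (sqr_sum (out w) ^+ m.+1) <=
    rtr V * (2 * (opnorm V + m.+1%:R * u ^+ 2)) ^+ m.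
Proof.
move=> hV pV.
have bX j := bounded_rmxX j bounded_sqr_sum.
pose a j := \int[P]_w rtr (sqr_sum (out w) ^+ j).
pose b j := \int[P]_w rtr (V * sqr_sum (out w) ^+ j).
have rec N : a N.+2 <= b N.+1 + N.+1%:R * u ^+ 2 * (a N.+1 + b N).
  exact: moment_recursion N pV.
have bVm j : b j <= opnorm V * a j.
  rewrite /b /a -ExZ; last exact: bounded_rv_rtr (bX j).
  apply: Ex_le => [||w].
  - exact: bounded_rv_rtr (bounded_rmxM (bounded_rmx_cst V) (bX j)).
  - exact: bounded_rvZ (bounded_rv_rtr (bX j)).
  - by apply: rtr_mul_le => //; apply: psdX; exact: psd_sqr_sum.
have V0 : b 0%N = rtr V.
  by rewrite /b; under eq_Rintegral do rewrite expr0 mulr1; rewrite Ex_cst.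
have a1 : a 1%N <= rtr V.
  rewrite /a; under eq_Rintegral do rewrite expr1 -[sqr_sum _]mulr1.
  rewrite (Ex_sqr_sum_mul V (bounded_rmx_cst 1)) -subr_ge0.
  under [X in _ - X]eq_bigr => k _.
    rewrite Ex_rtr_mul ?mulr1; last exact: bounded_rmxX (bounded_phi k).
    over.
  by rewrite -rtr_sum -rtrB; exact: rtr_psd_ge0.
have a0 j : 0 <= a j.
  by apply: Rintegral_ge0 => w _; apply: rtr_psd_ge0; apply: psdX; exact: psd_sqr_sum.
have oV := opnorm_ge0 V.
exact: (recursion_bound m oV (sqr_ge0 u) a0 a1 V0 bVm rec).
Qed.
End TruncatedMoments.
End IndependentFamily.

(** * Hoffmann-Jorgensen's inequality *)

Definition ind {R : realType} (b : bool) : R := (b : nat)%:R.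

Lemma ind_ge0 (R : realType) b : 0 <= ind b :> R.
Proof. by case: b. Qed.

Section Levy.
Variables (R : realType) (V : zmodType) (N : V -> R) (n : nat).
Hypotheses (ND : forall x y, N (x + y) <= N x + N y) (NN : forall x, N (- x) = N x)
  (N2 : forall x, 2 * N x <= N (x + x)).
Implicit Types (e : {ffun 'I_n -> bool}) (x : 'I_n -> V) (Q : pred 'I_n) (t : R).

(** Signs act by negation, so that the reflection arguments live in an abelian group with a
    norm-like N. *)
Definition psum Q e x : V := \sum_(k | Q k) (if e k then - x k else x k).

Definition twist Q e : {ffun 'I_n -> bool} := [ffun k => if Q k then ~~ e k else e k].

Lemma twistK Q : involutive (twist Q).
Proof. by move=> e; apply/ffunP => k; rewrite !ffunE; case: (Q k); rewrite ?negbK. Qed.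

Lemma sum_twist Q (F : {ffun 'I_n -> bool} -> R) : \sum_e F (twist Q e) = \sum_e F e.
Proof. by rewrite [RHS](reindex_inj (inv_inj (twistK Q))). Qed.

Lemma psum_twist Q e x : psum Q (twist Q e) x = - psum Q e x.
Proof.
rewrite /psum -sumrN; apply: eq_bigr => k Qk; rewrite ffunE Qk.
by case: (e k); rewrite ?opprK.
Qed.

Lemma psum_twist_out Q Q' e x : (forall k, Q k -> ~~ Q' k) -> psum Q (twist Q' e) x = psum Q e x.
Proof. by move=> h; apply: eq_bigr => k Qk; rewrite ffunE (negbTE (h k Qk)). Qed.

Lemma psum_split Q e x : psum predT e x = psum Q e x + psum (predC Q) e x.
Proof. by rewrite /psum (bigID Q). Qed.

(** 2 a = (a + b) + (a - b), so the two norms on the right cannot both be at most t. *)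
Lemma norm_reflect t a b : t < N a -> (t < N (a + b)) || (t < N (a - b)).
Proof.
move=> ta; apply/orP; case: (ltP t (N (a + b))) => [|h1]; first by left.
right; have := N2 a; rewrite (_ : a + a = (a + b) + (a - b)); last by rewrite addrACA subrr addr0.
by move=> h; have := le_trans h (ND _ _); lra.
Qed.

Definition upto (j : 'I_n) : pred 'I_n := fun k => (k <= j)%N.

(** First passage of the partial sums above t. By [first_exceed_ext] it depends only on the signs
    and summands up to j, as a stopping time should. *)
Definition first_exceed t x e (j : 'I_n) : bool :=
  (t < N (psum (upto j) e x)) && [forall i : 'I_n, (i < j)%N ==> (N (psum (upto i) e x) <= t)].

Lemma psum_ext Q e e' x y : (forall k, Q k -> e k = e' k /\ x k = y k) ->
  psum Q e x = psum Q e' y.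
Proof. by move=> h; apply: eq_bigr => k Qk; have [-> ->] := h k Qk. Qed.

Lemma first_exceed_ext t e e' x y j :
  (forall k, upto j k -> e k = e' k /\ x k = y k) ->
  first_exceed t x e j = first_exceed t y e' j.
Proof.
move=> h; have hp (i : 'I_n) : (i <= j)%N -> psum (upto i) e x = psum (upto i) e' y.
  by move=> ij; apply: psum_ext => k ki; apply: h; rewrite /upto (leq_trans ki).
rewrite /first_exceed hp //; congr (_ && _); apply: eq_forallb => i.
by case ij: (i < j)%N => //=; rewrite hp // ltnW.
Qed.

Lemma first_exceed_uniq t x e : \sum_j ind (first_exceed t x e j) <= 1 :> R.
Proof.
case: (pickP (first_exceed t x e)) => [j hj|h0]; last first.
  by rewrite big1 // => j _; rewrite h0.
rewrite (bigD1 j) //= hj big1 ?addr0 // => i ij.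
case hi: (first_exceed t x e i) => //; exfalso.
have [/andP[i1 /forallP i2] /andP[j1 /forallP j2]] := (hi, hj).
have /orP[lt|lt] : (i < j)%N || (j < i)%N by rewrite -neq_ltn.
  by have := j2 i; rewrite lt /= leNgt i1.
by have := i2 j; rewrite lt /= leNgt j1.
Qed.

(* Signs after time [j] are reflected, which does not change [first_exceed]. *)
Lemma levy_max t x :
  \sum_e \sum_j ind (first_exceed t x e j) <= 2 * \sum_e ind (t < N (psum predT e x)) :> R.
Proof.
pose F j e : R := ind (first_exceed t x e j && (t < N (psum predT e x))).
have step j e : ind (first_exceed t x e j) <= F j e + F j (twist (predC (upto j)) e).
  have E : first_exceed t x (twist (predC (upto j)) e) j = first_exceed t x e j.
    rewrite /first_exceed psum_twist_out => [|k]; last by rewrite /= negbK.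
    congr (_ && _); apply: eq_forallb => i; case lt: (i < j)%N => //=.
    by rewrite psum_twist_out // => k ki /=; rewrite negbK /upto (leq_trans ki) // ltnW.
  rewrite /F E; case fe: (first_exceed _ _ _ _); rewrite //= ?addr0 //.
  have /andP[h _] := fe.
  have := norm_reflect (psum (predC (upto j)) e x) h.
  rewrite -psum_split (psum_split (upto j) (twist _ e)) psum_twist.
  rewrite psum_twist_out => [|k]; last by rewrite /= negbK.
  by move=> /orP[]->; rewrite ?lerDl ?lerDr.
rewrite exchange_big /=.
apply: (@le_trans _ _ (\sum_j \sum_e (F j e + F j (twist (predC (upto j)) e)))).
  by apply: ler_sum => j _; apply: ler_sum => e _; exact: step.
rewrite (eq_bigr (fun j => 2 * \sum_e F j e)); last first.
  by move=> j _; rewrite big_split /= (sum_twist _ (F j)) mulr_natl mulr2n.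
rewrite -mulr_sumr exchange_big /= ler_wpM2l // ler_sum // => e _.
rewrite /F; case: (t < _); last by rewrite big1 // => j _; rewrite andbF.
by under eq_bigr do rewrite andbT; exact: first_exceed_uniq.
Qed.

(** Flipping the signs outside Q keeps the sum over Q and reflects the rest, so one of the two
    patterns has a large full sum; the flip is a bijection of the patterns. *)
Lemma levy_tail t x (Q : pred 'I_n) :
  \sum_e ind (t < N (psum Q e x)) <= 2 * \sum_e ind (t < N (psum predT e x)) :> R.
Proof.
pose F e : R := ind (t < N (psum predT e x)).
apply: (@le_trans _ _ (\sum_e (F e + F (twist (predC Q) e)))); last first.
  by rewrite big_split /= (sum_twist _ F) -/F mulr2n mulrDl mul1r.
apply: ler_sum => e _; case h: (t < N (psum Q e x)); last by rewrite addr_ge0 ?ind_ge0.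
have := norm_reflect (psum (predC Q) e x) h.
rewrite -psum_split /F (psum_split Q (twist _ e)) psum_twist.
rewrite psum_twist_out => [|k]; last by rewrite /= negbK.
by move=> /orP[]->; rewrite ?lerDl ?lerDr.
Qed.

(** If no summand exceeds t, the first passage above t reaches at most 2 t: at most t just before,
    plus one summand. A full sum above 3 t then leaves more than t to the summands after the
    passage. *)
Lemma exceed_split t x e : 0 <= t ->
  ind (3 * t < N (psum predT e x)) <=
  \sum_j (ind (first_exceed t x e j) * ind (t < N (psum (predC (upto j)) e x)))
  + ind [exists k, t < N (x k)] :> R.
Proof.
move=> t0; case h: (3 * t < _); last first.
  by rewrite addr_ge0 // sumr_ge0 // => j _; rewrite mulr_ge0.
case: (boolP [exists k, t < N (x k)]) => [_|/existsPn hx].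
  by rewrite lerDr sumr_ge0 // => j _; rewrite mulr_ge0.
rewrite addr0.
have [j0 hj0] : exists j : 'I_n, t < N (psum (upto j) e x).
  have [n0|npos] := posnP n.
    move: h; rewrite /psum big1 => [h|k _]; last first.
      have h0 := leq_ltn_trans (leq0n k) (ltn_ord k).
      by exfalso; move: h0; rewrite n0.
    (* For n = 0 the sum is 0, and [N2] at 0 forces N 0 <= 0. *)
    by have := N2 0; rewrite addr0; move: h t0; lra.
  have hm : (n.-1 < n)%N by rewrite prednK.
  exists (Ordinal hm); apply: (@le_lt_trans _ _ (3 * t)); first by move: t0; lra.
  rewrite (_ : psum (upto (Ordinal hm)) e x = psum predT e x) //.
  by apply: eq_bigl => k; rewrite /upto /= -ltnS prednK ?ltn_ord.
pose j := [arg min_(i < j0 | t < N (psum (upto i) e x)) (i : nat)].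
have [hj hmin] : t < N (psum (upto j) e x) /\ forall i : 'I_n, t < N (psum (upto i) e x) -> (j <= i)%N.
  by rewrite /j; case: arg_minnP => // i hi him; split.
have fj : first_exceed t x e j.
  rewrite /first_exceed hj; apply/forallP => i; apply/implyP => ij.
  by rewrite leNgt; apply/negP => /hmin; rewrite leqNgt ij.
have Sj : N (psum (upto j) e x) <= 2 * t.
  have xj : N (if e j then - x j else x j) <= t.
    by have := hx j; rewrite -leNgt; case: (e j); rewrite ?NN.
  case E: (nat_of_ord j) => [|i].
    rewrite /psum (bigD1 j) /=; last by rewrite /upto.
    rewrite big_pred0 ?addr0; last first.
      move=> k; rewrite /upto E leqn0; apply/negP => /andP[/eqP k0 /eqP]; apply.
      by apply/val_inj; rewrite /= k0 E.
    by apply: le_trans xj _; move: t0; lra.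
  have ij : (i < n)%N by apply: leq_trans (ltn_ord j); rewrite E.
  pose i' := Ordinal ij.
  have := forallP (proj2 (andP fj)) i'; rewrite /= E ltnSn /= => hi.
  rewrite /psum (bigD1 j) /=; last by rewrite /upto.
  rewrite (eq_bigl (upto i')) => [|k]; last first.
    rewrite /upto /= E; have [->|kj] := eqVneq k j; first by rewrite E ltnn andbF.
    rewrite andbT leq_eqVlt ltnS.
    have -> // : (nat_of_ord k == i.+1) = false.
    by apply/negbTE; apply: contra kj => /eqP kk; apply/eqP/val_inj; rewrite /= kk E.
  by apply: le_trans (ND _ _) _; move: xj hi; rewrite /psum; lra.
rewrite (bigD1 j) //= fj mul1r.
have -> : t < N (psum (predC (upto j)) e x).
  have := ND (psum (upto j) e x) (psum (predC (upto j)) e x).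
  by rewrite -psum_split; move: h Sj; lra.
by rewrite lerDl sumr_ge0 // => i _; rewrite mulr_ge0.
Qed.
End Levy.

Section SignMixing.
Variables (R : realType) (n : nat).
Implicit Types (e : {ffun 'I_n -> bool}) (Q : pred 'I_n).

Definition sign_mix Q e e' : {ffun 'I_n -> bool} := [ffun k => if Q k then e k else e' k].

(** Under the uniform measure, signs in Q are independent of signs outside Q. Exchanging the
    coordinates outside Q of two patterns e and e' is an involution that turns u e * v e into u e *
    v e'; the factor 2^n counts the patterns e'. *)
Lemma sum_sign_mixM Q (u v : {ffun 'I_n -> bool} -> R) :
  (forall e e', u (sign_mix Q e e') = u e) -> (forall e e', v (sign_mix Q e e') = v e') ->
  2 ^+ n * (\sum_e u e * v e) = (\sum_e u e) * (\sum_e v e).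
Proof.
move=> hu hv.
pose phi (z : {ffun 'I_n -> bool} * {ffun 'I_n -> bool}) :=
  (sign_mix Q z.1 z.2, sign_mix Q z.2 z.1).
have phiK : involutive phi.
  by move=> [e e']; congr pair; apply/ffunP => k; rewrite !ffunE /=; case: (Q k).
rewrite mulr_suml; under [RHS]eq_bigr do rewrite mulr_sumr.
rewrite pair_big /=.
transitivity (\sum_(e : {ffun 'I_n -> bool}) \sum_(e' : {ffun 'I_n -> bool}) u e * v e).
  rewrite mulr_sumr; apply: eq_bigr => e _.
  by rewrite sum_sign_const.
rewrite pair_big /= (reindex_inj (inv_inj phiK)) /=.
apply: eq_bigr => -[e e'] _ /=.
by rewrite hu hv.
Qed.
End SignMixing.

Lemma opnorm2 (R : realType) d (A : 'M[R[i]]_d) : 2 * opnorm A <= opnorm (A + A).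
Proof.
have := opnormZ 2 A; rewrite normr_nat => <-.
by rewrite (_ : (2 : R)%:C%C *: A = A + A) // rmorph_nat scaler_nat mulr2n.
Qed.

Lemma measurable_ind (R : realType) dS (S : measurableType dS) (f g : S -> R) :
  measurable_fun setT f -> measurable_fun setT g ->
  measurable_fun setT (fun x => ind (f x < g x) : R).
Proof.
move=> mf mg; rewrite (_ : (fun _ => _) = (fun x => if f x < g x then 1 else 0)).
  by apply: measurable_fun_ifT => //; exact: measurable_fun_ltr.
by apply/funext => x; case: (f x < g x).
Qed.

Lemma sign_sum_psum (R : realType) n d (A : 'I_n -> 'M[R[i]]_d) e :
  sign_sum A e = psum predT e A.
Proof.
apply: eq_bigr => k _; rewrite /sgn; case: (e k).
  by rewrite expr1 rmorphN rmorph1 scaleN1r.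
by rewrite expr0 rmorph1 scale1r.
Qed.

Lemma Ex_sum_le dT (T : measurableType dT) (R : realType) (P : probability T R)
  (I J : finType) (F : I -> T -> R) (G : J -> T -> R) c :
  (forall i, bounded_rv (F i)) -> (forall j, bounded_rv (G j)) ->
  (forall w, \sum_i F i w <= c * \sum_j G j w) ->
  \sum_i \int[P]_w F i w <= c * \sum_j \int[P]_w G j w.
Proof.
move=> bF bG h; have bS := bounded_rv_sum (index_enum _) predT bG.
rewrite -(Ex_sum P _ _ bF) -(Ex_sum P _ _ bG) -(ExZ P _ bS).
apply: Ex_le h; [exact: bounded_rv_sum|exact: bounded_rvZ].
Qed.

Section HoffmannJorgensen.
Context {dT : measure_display} {T : measurableType dT} {R : realType}.
Variable P : probability T R.
Context {n d : nat}.
Variable W : 'I_n -> T -> 'M[R[i]]_d.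
Hypothesis mW : forall k, random_mx (W k).
Hypothesis iW : mutual_indep P (fun k => mx_sigma (W k)).

Local Notation out := (outcome W).
Implicit Types (t : R) (e : {ffun 'I_n -> bool}).

Lemma Ex_mixM (J : {set 'I_n}) (f g : mxfamily R n d -> R) a b :
  measurable_fun setT f -> measurable_fun setT g ->
  (forall x, `|f x| <= a) -> (forall x, `|g x| <= b) ->
  (forall x y, f (mix J x y) = f x) -> (forall x y, g (mix J x y) = g y) ->
  \int[P]_w (f (out w) * g (out w)) = \int[P]_w f (out w) * \int[P]_w g (out w).
Proof.
move=> mf mg fa gb hf hg; have mo := measurable_outcome mW.
have bf : bounded_rv (fun w => f (out w)).
  by split; [exact: (measurableT_comp mf mo)|exists a].
have bg : bounded_rv (fun w => g (out w)).
  by split; [exact: (measurableT_comp mg mo)|exists b].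
have fgc w w' : `|f (mix J (out w) (out w')) * g (mix J (out w) (out w'))| <= a * b.
  by rewrite normrM ler_pM.
have [_ [_ [_ ->]]] := Ex_mix mW iW (measurable_funM mf mg) fgc.
under eq_Rintegral => w _.
  under eq_Rintegral do rewrite /= hf hg.
  rewrite (ExZ P _ bg) mulrC; over.
by rewrite (ExZ P _ bf) mulrC.
Qed.

Variables (psi : 'M[R[i]]_d -> 'M[R[i]]_d).
Hypothesis d0 : (0 < d)%N.
Hypothesis mpsi : forall k, measurable_mx (fun x : mxfamily R n d => psi (x k)).

Local Notation Psi x := (fun k : 'I_n => psi (x k)).
Local Notation N := (@opnorm R d).

Lemma measurable_psum Q e :
  measurable_fun setT (fun x : mxfamily R n d => N (psum Q e (Psi x))).
Proof.
apply: measurable_opnorm => //; apply: measurable_mx_sum => k.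
by case: (e k); [exact: measurable_mxN|exact: mpsi].
Qed.

Lemma indE_and (a b : bool) : ind (a && b) = ind a * ind b :> R.
Proof. by case: a; case: b; rewrite /ind /= ?mul0r ?mul1r. Qed.

Lemma ind_forall (I : finType) (b : I -> bool) : ind [forall i, b i] = \prod_i ind (b i) :> R.
Proof.
case: (boolP [forall i, b i]) => [/forallP h|/forallPn[i hi]].
  by rewrite big1 // => i _; rewrite h.
by rewrite (bigD1 i) //= (negbTE hi) {2}/ind mul0r.
Qed.

Lemma ind_neg b : ind (~~ b) = 1 - ind b :> R.
Proof. by case: b; rewrite /ind /= ?subrr ?subr0. Qed.

Lemma ind_bounded b : `|ind b : R| <= 1.
Proof. by case: b; rewrite /ind /= ?normr1 ?normr0. Qed.

Lemma measurable_first_exceed t e j :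
  measurable_fun setT (fun x : mxfamily R n d => ind (first_exceed N t (Psi x) e j) : R).
Proof.
rewrite /first_exceed; under eq_fun do rewrite indE_and ind_forall.
apply: measurable_funM; first exact: measurable_ind (measurable_psum _ _).
apply: measurable_prod => i _; case: (i < j)%N => /=; last exact: measurable_cst.
under eq_fun do rewrite leNgt ind_neg.
by apply: measurable_funB => //; exact: measurable_ind (measurable_psum _ _).
Qed.

Lemma measurable_exists_exceed t :
  measurable_fun setT (fun x : mxfamily R n d => ind [exists k, t < N (Psi x k)] : R).
Proof.
under eq_fun do rewrite -[X in ind X]negbK negb_exists ind_neg ind_forall.
apply: measurable_funB => //; apply: measurable_prod => k _.
under eq_fun do rewrite ind_neg.
apply: measurable_funB => //; apply: measurable_ind => //.
by apply: measurable_opnorm => //; exact: mpsi.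
Qed.

Lemma bounded_out (f : mxfamily R n d -> R) : measurable_fun setT f ->
  (forall x, `|f x| <= 1) -> bounded_rv (fun w => f (out w)).
Proof.
by move=> mf f1; split; [exact: (measurableT_comp mf (measurable_outcome mW))|exists 1].
Qed.

(** A sum over the patterns: the tail for uniform random signs is this divided by 2^n. *)
Definition sign_tail t : R := \sum_e \int[P]_w ind (t < N (psum predT e (Psi (out w)))).

Definition max_tail t : R := \int[P]_w ind [exists k, t < N (Psi (out w) k)].

(** For the averaged tail Q this reads Q(3 t) <= 4 Q(t)^2 + P(max > t). The first passage and the
    remaining sum are independent in the summands ([FG]) and in the signs ([UV]), and Levy's
    inequalities bound each factor by 2 Q(t). *)
Lemma hoffmann_jorgensen t : 0 <= t ->
  sign_tail (3 * t) <= (2 ^+ n)^-1 * (2 * sign_tail t) ^+ 2 + 2 ^+ n * max_tail t.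
Proof.
(* With [U], [V] the marginal sums and [s] a common bound of both. *)
have fin (U V : 'I_n -> R) X (c s s' m : R) : 0 < c -> 0 <= s -> (forall j, 0 <= U j) ->
    (forall j, c * X j = U j * V j) -> \sum_j U j <= s -> (forall j, V j <= s) ->
    s' <= \sum_j X j + m -> s' <= c^-1 * s ^+ 2 + m.
  move=> c0 s0 U0 E h1 h2 h; apply: (le_trans h); rewrite lerD2r.
  rewrite ler_pdivlMl // mulr_sumr expr2.
  apply: (@le_trans _ _ (\sum_j U j * s)); last by rewrite -mulr_suml ler_wpM2r.
  by apply: ler_sum => j _; rewrite E ler_wpM2l.
move=> t0.
pose q e w : R := ind (t < N (psum predT e (Psi (out w)))).
pose F e j (x : mxfamily R n d) : R := ind (first_exceed N t (Psi x) e j).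
pose G e j (x : mxfamily R n d) : R := ind (t < N (psum (predC (upto j)) e (Psi x))).
have mF e j : measurable_fun setT (F e j) by exact: measurable_first_exceed.
have mG e j : measurable_fun setT (G e j) by exact: measurable_ind (measurable_psum _ _).
have bq e : bounded_rv (q e).
  apply: (bounded_out (f := fun x => ind (t < N (psum predT e (Psi x))))) => [|x].
    exact: measurable_ind (measurable_psum _ _).
  exact: ind_bounded.
have bF e j : bounded_rv (fun w => F e j (out w)) by apply: bounded_out => // x; exact: ind_bounded.
have bG e j : bounded_rv (fun w => G e j (out w)) by apply: bounded_out => // x; exact: ind_bounded.
have bM : bounded_rv (fun w => ind [exists k, t < N (Psi (out w) k)] : R).
  apply: (bounded_out (f := fun x => ind [exists k, t < N (Psi x k)])) => [|x].
    exact: measurable_exists_exceed.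
  exact: ind_bounded.
pose U e j := \int[P]_w F e j (out w); pose V e j := \int[P]_w G e j (out w).
have U0 e j : 0 <= U e j by apply: Rintegral_ge0 => w _; exact: ind_ge0.
have V0 e j : 0 <= V e j by apply: Rintegral_ge0 => w _; exact: ind_ge0.
pose J (j : 'I_n) : {set 'I_n} := [set k | upto j k]%SET.
have FG e j : \int[P]_w (F e j (out w) * G e j (out w)) = U e j * V e j.
  apply: (@Ex_mixM (J j) (F e j) (G e j) 1 1 (mF e j) (mG e j)).
  - by move=> x; exact: ind_bounded.
  - by move=> x; exact: ind_bounded.
  - move=> x y; have E : first_exceed N t (Psi (mix (J j) x y)) e j = first_exceed N t (Psi x) e j.
      by apply: first_exceed_ext => k kj; split=> //; rewrite /mix inE kj.
    by rewrite /F E.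
  - move=> x y; have E : psum (predC (upto j)) e (Psi (mix (J j) x y)) = psum (predC (upto j)) e (Psi y).
      by apply: psum_ext => k kj; split=> //; rewrite /mix inE (negbTE kj).
    by rewrite /G E.
have UV j : 2 ^+ n * (\sum_e U e j * V e j) = (\sum_e U e j) * (\sum_e V e j).
  apply: (sum_sign_mixM (Q := upto j) (u := fun e => U e j) (v := fun e => V e j)) => e e'.
    have E w : F (sign_mix (upto j) e e') j (out w) = F e j (out w).
      have E : first_exceed N t (Psi (out w)) (sign_mix (upto j) e e') j = first_exceed N t (Psi (out w)) e j.
        by apply: first_exceed_ext => k kj; split=> //; rewrite ffunE kj.
      by rewrite /F E.
    by apply: eq_Rintegral => w _; exact: E.
  have E w : G (sign_mix (upto j) e e') j (out w) = G e' j (out w).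
    have E : psum (predC (upto j)) (sign_mix (upto j) e e') (Psi (out w)) = psum (predC (upto j)) e' (Psi (out w)).
      by apply: psum_ext => k kj; split=> //; rewrite ffunE (negbTE kj).
    by rewrite /G E.
  by apply: eq_Rintegral => w _; exact: E.
have hq : \sum_e \int[P]_w q e w = sign_tail t by [].
have ND := @opnormD R d; have NN := @opnormN R d; have N2 := @opnorm2 R d.
have SU : \sum_j \sum_e U e j <= 2 * sign_tail t.
  rewrite exchange_big /= -hq.
  under eq_bigr do rewrite -(Ex_sum P _ _ (bF _)).
  apply: Ex_sum_le; first by move=> e; exact: bounded_rv_sum _ _ (bF e).
    exact: bq.
  by move=> w; exact: (levy_max ND N2).
have SV j : \sum_e V e j <= 2 * sign_tail t.
  rewrite -hq; apply: Ex_sum_le (fun e => bG e j) bq _.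
  by move=> w; exact: (levy_tail ND N2).
have split3 : sign_tail (3 * t) <= \sum_e \sum_j U e j * V e j + 2 ^+ n * max_tail t.
  have b3 e : bounded_rv (fun w => ind (3 * t < N (psum predT e (Psi (out w)))) : R).
    apply: (bounded_out (f := fun x => ind (3 * t < N (psum predT e (Psi x))))) => [|x].
      exact: measurable_ind (measurable_psum _ _).
    exact: ind_bounded.
  have bFG e j := bounded_rvM (bF e j) (bG e j).
  have bS e : bounded_rv (fun w => \sum_j F e j (out w) * G e j (out w)).
    by apply: bounded_rv_sum => j; exact: bFG.
  have step e : \int[P]_w ind (3 * t < N (psum predT e (Psi (out w)))) <=
      \sum_j U e j * V e j + max_tail t.
    have := Ex_le P (b3 e) (bounded_rvD (bS e) bM) (fun w => exceed_split ND NN N2 (Psi (out w)) e t0).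
    rewrite (ExD P (bS e) bM) (Ex_sum P _ _ (bFG e)).
    by under eq_bigr do rewrite FG.
  have := ler_sum (index_enum _) (fun e (_ : true) => step e).
  by rewrite big_split /= sum_sign_const.
apply: (fin (fun j => \sum_e U e j) (fun j => \sum_e V e j) (fun j => \sum_e U e j * V e j)).
- by rewrite exprn_gt0.
- by rewrite mulr_ge0 // sumr_ge0 // => e _; apply: Rintegral_ge0 => w _; exact: ind_ge0.
- by move=> j; exact: sumr_ge0.
- exact: UV.
- exact: SU.
- exact: SV.
- by rewrite [X in _ <= X + _]exchange_big; exact: split3.
Qed.
End HoffmannJorgensen.

Lemma powRX (R : realType) (x p : R) k : 0 <= x -> (x ^+ k) `^ p = (x `^ p) ^+ k.
Proof.
move=> x0; elim: k => [|k IH]; first by rewrite !expr0 powR1.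
by rewrite !exprS powRM ?exprn_ge0 // IH.
Qed.

(** * Summation over geometric layers *)

Section Layers.
Variable R : realType.
Implicit Types (a p t f : R) (u m z : nat -> R).

(** A geometric sum of ratio at least 3 is at most 1 / (1 - 1/3) = 3/2 times its last term, and the
    last term that counts is at most Y. *)
Lemma geometric_layers a (Y : R) z (b : nat -> bool) J : 3 <= a -> (forall j, 0 <= z j) ->
  (forall j, z j.+1 = a * z j) -> 0 <= Y -> (forall j, b j -> z j <= Y) ->
  \sum_(j < J) z j * ind (b j) <= 3 / 2 * Y.
Proof.
move=> a3 z0 zS Y0 hb.
have zsum K : \sum_(j < K.+1) z j <= 3 / 2 * z K.
  elim: K => [|K IH]; first by rewrite big_ord1; have := z0 0%N; lra.
  rewrite big_ord_recr /= zS.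
  have : 3 * z K <= a * z K by rewrite ler_wpM2r.
  by move: IH; move: (a * z K) => y; lra.
elim: J => [|J IH]; first by rewrite big_ord0; lra.
case bJ: (b J); last by rewrite big_ord_recr /= bJ mulr0 addr0.
apply: (@le_trans _ _ (\sum_(j < J.+1) z j)).
  apply: ler_sum => j _; rewrite -[leRHS]mulr1 ler_wpM2l //.
  by case: (b j); rewrite /ind /=.
by apply: (le_trans (zsum J)); have := hb J bJ; lra.
Qed.

(* Weighted by a = 3^p, the tails u at 3^j t satisfy a self-bounding recursion. *)
Lemma hj_recursion a u m J : 3 <= a -> (forall j, 0 <= u j) -> (forall j, u j <= (2 * a)^-1) ->
  (forall j, u j.+1 <= u j ^+ 2 + 4 * m j) ->
  \sum_(j < J) a ^+ j * u j.+1 <= 2 * (2 * a)^-1 ^+ 2 + 8 * \sum_(j < J) a ^+ j * m j.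
Proof.
set dl := (2 * a)^-1 => a3 u0 ud rec.
have a0 : 0 < a by apply: lt_le_trans a3; rewrite ltr0n.
have dl0 : 0 < dl by rewrite invr_gt0 mulr_gt0.
have adl : a * dl = 1 / 2 by rewrite /dl; field; rewrite gt_eqF.
have X0 K : 0 <= \sum_(j < K) a ^+ j * u j.+1.
  by apply: sumr_ge0 => j _; rewrite mulr_ge0 // exprn_ge0 // ltW.
have h1 : \sum_(j < J) a ^+ j * u j.+1 <= dl * \sum_(j < J) a ^+ j * u j + 4 * \sum_(j < J) a ^+ j * m j.
  rewrite !mulr_sumr -big_split /=; apply: ler_sum => j _.
  have -> : dl * (a ^+ j * u j) + 4 * (a ^+ j * m j) = a ^+ j * (dl * u j + 4 * m j) by ring.
  rewrite ler_wpM2l ?exprn_ge0 ?(ltW a0) // (le_trans (rec j)) // lerD2r expr2.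
  by rewrite ler_wpM2r.
(* Shifting the index costs a factor a, and a * dl = 1/2: half of the sum to be bounded reappears on
   the right and is absorbed. *)
have h2 : dl * \sum_(j < J) a ^+ j * u j <= dl ^+ 2 + 1 / 2 * \sum_(j < J) a ^+ j * u j.+1.
  case: J {h1} => [|J]; first by rewrite !big_ord0 !mulr0 addr0 sqr_ge0.
  rewrite big_ord_recl expr0 mul1r mulrDr.
  apply: lerD; first by rewrite expr2 ler_wpM2l // ltW.
  have -> : \sum_(i < J) a ^+ lift ord0 i * u (lift ord0 i) = a * \sum_(i < J) a ^+ i * u i.+1.
    by rewrite mulr_sumr; apply: eq_bigr => i _; rewrite /= /bump /= add1n exprS mulrA.
  rewrite mulrA [dl * a]mulrC adl ler_wpM2l // big_ord_recr /= lerDl.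
  by rewrite mulr_ge0 // exprn_ge0 // ltW.
by move: h1 h2; lra.
Qed.

(** The last level below f alone dominates f^p; the whole sum is kept because its expectation is a
    weighted sum of tails. *)
Lemma powR_layers p t f J : 0 <= p -> 0 < t -> 0 <= f -> f <= 3 ^+ J.+1 * t ->
  f `^ p <= (3 * t) `^ p + \sum_(j < J) (3 ^+ j.+2 * t) `^ p * ind (3 ^+ j.+1 * t < f).
Proof.
move=> p0 t0 f0; have t30 k : 0 <= 3 ^+ k * t by rewrite mulr_ge0 ?exprn_ge0 // ltW.
elim: J => [|J IH] hf; first by rewrite big_ord0 addr0 ge0_ler_powR // ?nnegrE // ?mulr_ge0 // ltW.
rewrite big_ord_recr /=; case: (ltP (3 ^+ J.+1 * t) f) => [lt|le].
  rewrite addrA /ind mulr1 (le_trans (ge0_ler_powR p0 _ _ hf)) ?nnegrE // lerDr.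
  by rewrite addr_ge0 ?powR_ge0 // sumr_ge0 // => j _; rewrite mulr_ge0 ?powR_ge0 ?ind_ge0.
by rewrite /ind mulr0 addr0; exact: IH.
Qed.
End Layers.

(** Monotone convergence. The index J with F w <= h J w depends on w, and the integral of F may be
    infinite a priori. *)
Lemma integral_le_approx dT (T : measurableType dT) (R : realType) (P : probability T R)
  (F : T -> R) (h : nat -> T -> R) (B : R) :
  measurable_fun setT F -> (forall w, 0 <= F w) ->
  (forall J, measurable_fun setT (h J)) -> (forall J w, 0 <= h J w) ->
  (forall w J K, (J <= K)%N -> h J w <= h K w) ->
  (forall w, exists J, F w <= h J w) ->
  (forall J, \int[P]_w (h J w)%:E <= B%:E)%E ->
  (\int[P]_w (F w)%:E <= B%:E)%E.
Proof.
move=> mF F0 mh h0 ndh hF hB.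
have cv w : cvgn (fun J => (h J w)%:E).
  by apply: ereal_nondecreasing_is_cvgn => J K JK; rewrite lee_fin ndh.
apply: (@le_trans _ _ (\int[P]_w (limn (fun J => (h J w)%:E)))%E).
  apply: ge0_le_integral => //.
  - by move=> w _; rewrite lee_fin.
  - exact/measurable_EFinP.
  - apply: (emeasurable_fun_cvg (fun J w => (h J w)%:E)).
      by move=> J; exact/measurable_EFinP.
    by move=> w _; exact: cv.
  - move=> w _; have [J hJ] := hF w.
    apply: lime_ge => //; near=> K; rewrite lee_fin (le_trans hJ) // ndh //.
    by near: K; exact: nbhs_infty_ge.
rewrite monotone_convergence //.
- apply: lime_le; last by apply: nearW => J; exact: hB.
  apply: ereal_nondecreasing_is_cvgn => J K JK; apply: ge0_le_integral => //.
  + by move=> w _; rewrite lee_fin.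
  + exact/measurable_EFinP.
  + exact/measurable_EFinP.
  + by move=> w _; rewrite lee_fin ndh.
- by move=> J; exact/measurable_EFinP.
- by move=> J w _; rewrite lee_fin.
- by move=> w _ J K JK; rewrite lee_fin ndh.
Unshelve. all: by end_near. Qed.

(** * From tails to moments *)

Section HJMoment.
Context {dT : measure_display} {T : measurableType dT} {R : realType}.
Variable P : probability T R.
Context {n d : nat}.
Variable W : 'I_n -> T -> 'M[R[i]]_d.
Hypothesis mW : forall k, random_mx (W k).
Hypothesis iW : mutual_indep P (fun k => mx_sigma (W k)).
Variables (psi : 'M[R[i]]_d -> 'M[R[i]]_d).
Hypothesis d0 : (0 < d)%N.
Hypothesis mpsi : forall k, measurable_mx (fun x : mxfamily R n d => psi (x k)).

Local Notation out := (outcome W).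
Local Notation N := (@opnorm R d).

Definition signed_norm (e : {ffun 'I_n -> bool}) (w : T) : R :=
  N (psum predT e (fun k => psi (W k w))).

Definition max_psi (w : T) : R := \big[Num.max/0]_(k < n) N (psi (W k w)).

Lemma measurable_signed_norm e : measurable_fun setT (signed_norm e).
Proof. exact: (measurableT_comp (measurable_psum d0 mpsi predT e) (measurable_outcome mW)). Qed.

Lemma measurable_bigmax (I : Type) (r : seq I) (F : I -> T -> R) :
  (forall i, measurable_fun setT (F i)) ->
  measurable_fun setT (fun w => \big[Num.max/0]_(i <- r) F i w).
Proof.
move=> mF; elim: r => [|a r IH]; first by under eq_fun do rewrite big_nil; exact: measurable_cst.
by under eq_fun do rewrite big_cons; apply: measurable_maxr.
Qed.

Lemma measurable_norm_psi k : measurable_fun setT (fun w => N (psi (W k w))).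
Proof.
have h : measurable_fun setT (fun x : mxfamily R n d => N (psi (x k))).
  by apply: measurable_opnorm => //; exact: mpsi.
exact: (measurableT_comp h (measurable_outcome mW)).
Qed.

Lemma measurable_max_psi : measurable_fun setT max_psi.
Proof. by apply: measurable_bigmax => k; exact: measurable_norm_psi. Qed.

Lemma max_psi_ge0 w : 0 <= max_psi w.
Proof. by rewrite /max_psi; elim/big_ind: _ => // [x y|k _]; rewrite ?le_max ?opnorm_ge0 // => ->. Qed.

Lemma bigmax_le_cond (F : 'I_n -> R) t : 0 <= t ->
  (\big[Num.max/0]_(k < n) F k <= t) = [forall k, F k <= t].
Proof.
move=> t0; apply/idP/forallP => [h k|h].
  apply: le_trans h; rewrite (bigD1 k) //= le_max lexx //.
by elim/big_ind: _ => // x y hx hy; rewrite ge_max hx hy.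
Qed.

Lemma exists_exceed_max w t : 0 <= t -> [exists k, t < N (psi (W k w))] = (t < max_psi w).
Proof.
move=> t0; rewrite ltNge bigmax_le_cond // -[LHS]negbK negb_exists; congr (~~ _).
by apply: eq_forallb => k; rewrite leNgt.
Qed.

(** Let u j be 4 times the averaged tail at 3^j t. Hoffmann-Jorgensen's inequality becomes u (j+1)
    <= u j ^ 2 + 4 m j, and the hypothesis at t says u 0 <= (2 * 3^p)^-1, the smallness that
    [hj_recursion] asks for. *)
Lemma hj_moment p t mm : 1 <= p -> 0 < t -> 0 <= mm ->
  (2 ^+ n)^-1 * sign_tail P W psi t <= (8 * 3 `^ p)^-1 ->
  (\int[P]_w (max_psi w `^ p)%:E <= mm%:E)%E ->
  (\sum_e \int[P]_w (signed_norm e w `^ p)%:E <=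
     (2 ^+ n * (2 * (3 * t) `^ p + 3 * 9 `^ p * mm))%:E)%E.
Proof.
move=> p1 t0 mm0 htail hmax.
have p0 : 0 < p by exact: lt_le_trans p1.
pose a : R := 3 `^ p.
have a3 : 3 <= a by apply: le1r_powR => //; rewrite ler1n.
have a0 : 0 < a by apply: lt_le_trans a3.
have c0 : 0 < 2 ^+ n :> R by rewrite exprn_gt0.
pose ST s := sign_tail P W psi s.
pose u j := 4 * ((2 ^+ n)^-1 * ST (3 ^+ j * t)).
pose m j := max_tail P W psi (3 ^+ j * t).
have tj j : 0 <= 3 ^+ j * t by rewrite mulr_ge0 ?exprn_ge0 // ltW.
have ST0 s : 0 <= ST s.
  by apply: sumr_ge0 => e _; apply: Rintegral_ge0 => w _; exact: ind_ge0.
have u0 j : 0 <= u j by rewrite /u !mulr_ge0 // invr_ge0 ltW.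
have bq e s : bounded_rv (fun w => ind (s < signed_norm e w) : R).
  split; last by exists 1 => w; exact: ind_bounded.
  by apply: measurable_ind; [exact: measurable_cst|exact: measurable_signed_norm].
have STle s s' : s <= s' -> ST s' <= ST s.
  move=> ss; apply: ler_sum => e _; apply: (Ex_le P (bq e s') (bq e s)) => w.
  case: (ltP s' _) => [h|_]; last by rewrite ind_ge0.
  by rewrite (le_lt_trans ss h).
have ud j : u j <= (2 * a)^-1.
  apply: (@le_trans _ _ (4 * ((2 ^+ n)^-1 * ST t))).
    rewrite /u ler_wpM2l // ler_wpM2l ?invr_ge0 ?(ltW c0) // STle //.
    by rewrite ler_peMl ?(ltW t0) // exprn_ege1 // ler1n.
  have -> : (2 * a)^-1 = 4 * (8 * a)^-1 by field; rewrite gt_eqF.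
  by rewrite ler_wpM2l.
have rec j : u j.+1 <= u j ^+ 2 + 4 * m j.
  have := hoffmann_jorgensen mW iW d0 mpsi (tj j).
  rewrite mulrA -exprS -/(ST _) -/(ST _) -/(m j) => h.
  rewrite /u; move: h; move: (ST _) (ST _) (m j) => y x z h.
  have : 4 * ((2 ^+ n)^-1 * x) <= 4 * ((2 ^+ n)^-1 * ((2 ^+ n)^-1 * (2 * y) ^+ 2 + 2 ^+ n * z)).
    by rewrite ler_wpM2l // ler_wpM2l // invr_ge0 ltW.
  move/le_trans; apply; rewrite le_eqVlt; apply/orP; left; apply/eqP.
  by field; rewrite gt_eqF.
have X J := hj_recursion J a3 u0 ud rec.
have pw3 k : (3 ^+ k * t) `^ p = a ^+ k * t `^ p.
  rewrite powRM ?exprn_ge0 ?(ltW t0) //; congr (_ * _).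
  exact: powRX.
have bm s : bounded_rv (fun w => ind (s < max_psi w) : R).
  split; last by exists 1 => w; exact: ind_bounded.
  by apply: measurable_ind; [exact: measurable_cst|exact: measurable_max_psi].
have mE j : m j = \int[P]_w ind (3 ^+ j * t < max_psi w).
  by apply: eq_Rintegral => w _; rewrite -exists_exceed_max.
have mp : measurable_fun setT (fun w => max_psi w `^ p).
  exact: (measurableT_comp (measurable_powR p) measurable_max_psi).
have Mle J : \sum_(j < J) (3 ^+ j * t) `^ p * m j <= 3 / 2 * mm.
  pose f j w := (3 ^+ j * t) `^ p * ind (3 ^+ j * t < max_psi w) : R.
  have bf j : bounded_rv (f j) by exact: bounded_rvZ.
  have bS : bounded_rv (fun w => \sum_(j < J) f j w) by apply: bounded_rv_sum => j; exact: bf.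
  have -> : \sum_(j < J) (3 ^+ j * t) `^ p * m j = \int[P]_w \sum_(j < J) f j w.
    rewrite (Ex_sum P _ _ (fun j : 'I_J => bf j)); apply: eq_bigr => j _.
    by rewrite /f (ExZ P _ (bm _)) mE.
  rewrite -lee_fin -(Ex_fin P bS).
  apply: (@le_trans _ _ (\int[P]_w ((3 / 2)%:E * (max_psi w `^ p)%:E))%E).
    apply: ge0_le_integral => //.
    - by move=> w _; rewrite lee_fin sumr_ge0 // => j _; rewrite mulr_ge0 ?powR_ge0 ?ind_ge0.
    - by apply/measurable_EFinP; have [] := bS.
    - by apply/measurable_EFinP; exact: measurable_funM.
    - move=> w _; rewrite -EFinM lee_fin.
      apply: (geometric_layers (a := a) _ _ (z := fun j => (3 ^+ j * t) `^ p)
        (b := fun j => 3 ^+ j * t < max_psi w)) => //.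
      + by move=> j; exact: powR_ge0.
      + by move=> j; rewrite !pw3 exprS mulrA.
      + exact: powR_ge0.
      + by move=> j h; apply: ge0_ler_powR; rewrite ?nnegrE ?(ltW p0) ?max_psi_ge0 // ltW.
  rewrite ge0_integralZl //; last 2 first.
  - exact/measurable_EFinP.
  - by move=> w _; rewrite lee_fin powR_ge0.
  by rewrite [leRHS](EFinM (3 / 2) mm); apply: lee_wpmul2l hmax; rewrite lee_fin.
pose F w := \sum_e signed_norm e w `^ p.
pose h J w := \sum_e ((3 * t) `^ p + \sum_(j < J) (3 ^+ j.+2 * t) `^ p * ind (3 ^+ j.+1 * t < signed_norm e w)) : R.
have mS e : measurable_fun setT (fun w => signed_norm e w `^ p).
  exact: (measurableT_comp (measurable_powR p) (measurable_signed_norm e)).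
have bh J e : bounded_rv (fun w => (3 * t) `^ p + \sum_(j < J) (3 ^+ j.+2 * t) `^ p * ind (3 ^+ j.+1 * t < signed_norm e w)).
  apply: bounded_rvD; first exact: bounded_rv_cst.
  by apply: bounded_rv_sum => j; exact: bounded_rvZ.
have bhJ J : bounded_rv (h J) by apply: bounded_rv_sum => e; exact: bh.
have Eh J : \int[P]_w h J w = 2 ^+ n * ((3 * t) `^ p + a ^+ 2 * t `^ p / 4 * \sum_(j < J) a ^+ j * u j.+1).
  rewrite (Ex_sum P _ _ (bh J)).
  have Ee e : \int[P]_w ((3 * t) `^ p + \sum_(j < J) (3 ^+ j.+2 * t) `^ p * ind (3 ^+ j.+1 * t < signed_norm e w)) =
     (3 * t) `^ p + \sum_(j < J) (3 ^+ j.+2 * t) `^ p * \int[P]_w ind (3 ^+ j.+1 * t < signed_norm e w).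
    have bS (j : 'I_J) : bounded_rv (fun w => (3 ^+ j.+2 * t) `^ p * ind (3 ^+ j.+1 * t < signed_norm e w)).
      exact: bounded_rvZ (bq e _).
    rewrite (ExD P (bounded_rv_cst _) (bounded_rv_sum _ _ bS)) Ex_cst; congr (_ + _).
    rewrite (Ex_sum P _ _ bS); apply: eq_bigr => j _; exact: ExZ (bq e _).
  under eq_bigr do rewrite Ee.
  rewrite big_split /= sum_sign_const mulrDr; congr (_ + _).
  rewrite exchange_big /= !mulr_sumr; apply: eq_bigr => j _.
  rewrite -mulr_sumr pw3 /u /ST /sign_tail -/(signed_norm _ _).
  rewrite [\sum_e \int[P]_w ind (3 ^+ j.+1 * t < signed_norm e w)](_ : _ = sign_tail P W psi (3 ^+ j.+1 * t)) //.
  move: (sign_tail _ _ _ _) => x; rewrite !exprS expr0; field; rewrite gt_eqF //.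
have m0 e w : 0 <= signed_norm e w by exact: opnorm_ge0.
have -> : (\sum_e \int[P]_w (signed_norm e w `^ p)%:E = \int[P]_w (F w)%:E)%E.
  rewrite /F; under [RHS]eq_integral do rewrite -sumEFin.
  rewrite ge0_integral_sum // => [e|e w _]; first exact/measurable_EFinP.
  by rewrite lee_fin powR_ge0.
apply: (integral_le_approx (h := h)).
- by apply: measurable_sum => e; exact: mS.
- by move=> w; apply: sumr_ge0 => e _; exact: powR_ge0.
- by move=> J; have [] := bhJ J.
- move=> J w; apply: sumr_ge0 => e _; rewrite addr_ge0 ?powR_ge0 // sumr_ge0 // => j _.
  by rewrite mulr_ge0 ?powR_ge0 ?ind_ge0.
- move=> w J K JK; apply: ler_sum => e _; rewrite lerD2l.
  rewrite -(subnKC JK) big_split_ord /= lerDl sumr_ge0 // => j _.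
  by rewrite mulr_ge0 ?powR_ge0 ?ind_ge0.
- move=> w.
  have [J hJ] : exists J, forall e, signed_norm e w <= 3 ^+ J.+1 * t.
    (* One J has to serve all sign patterns, so all norms are bounded by their sum. *)
    pose y := \sum_e signed_norm e w.
    exists (Num.truncn (y / t)).+1 => e.
    apply: (@le_trans _ _ y).
      by rewrite /y (bigD1 e) //= lerDl sumr_ge0.
    rewrite -ler_pdivrMr //; apply: le_trans (ltW (truncnS_gt _)) _.
    rewrite -natrX ler_nat; apply: (@leq_trans (2 ^ (Num.truncn (y / t)).+2)); last first.
      by rewrite leq_exp2r.
    by rewrite ltnW // (leq_trans (ltn_expl _ (ltnSn 1))) // leq_exp2l.
  exists J; apply: ler_sum => e _; exact: powR_layers (ltW p0) t0 (m0 e w) (hJ e).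
- move=> J; rewrite (Ex_fin P (bhJ J)) lee_fin Eh ler_wpM2l ?(ltW c0) //.
  have tp0 : 0 < t `^ p by exact: powR_gt0.
  have := Mle J; under eq_bigr do rewrite pw3 mulrAC.
  rewrite -mulr_suml => hM.
  have t3 : (3 * t) `^ p = a * t `^ p by rewrite powRM ?(ltW t0).
  have n9 : 9 `^ p = a ^+ 2 :> R.
    by rewrite expr2 -powRM // -natrM.
  rewrite t3 n9.
  have k0 : 0 <= a ^+ 2 * t `^ p / 4 by rewrite !mulr_ge0 ?exprn_ge0 ?(ltW a0) ?(ltW tp0).
  have := ler_wpM2l k0 (X J).
  have -> : a ^+ 2 * t `^ p / 4 * (2 * (2 * a)^-1 ^+ 2 + 8 * \sum_(j < J) a ^+ j * m j) =
     t `^ p / 8 + 2 * a ^+ 2 * ((\sum_(j < J) a ^+ j * m j) * t `^ p).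
    move: (\sum_(j < J) _) => x; field; rewrite gt_eqF //.
  have : 2 * a ^+ 2 * ((\sum_(j < J) a ^+ j * m j) * t `^ p) <= 2 * a ^+ 2 * (3 / 2 * mm).
    by rewrite ler_wpM2l // mulr_ge0 // exprn_ge0 // ltW.
  have : t `^ p <= a * t `^ p by rewrite ler_peMl ?(ltW tp0) // (le_trans _ a3) // ler1n.
  move: (\sum_(j < J) _) (\sum_(j < J) _) => x y h1 h2 h3; lra.
Qed.
End HJMoment.

(** * Symmetrization *)

Section Symmetrization.
Context {dT : measure_display} {T : measurableType dT} {R : realType}.
Variable P : probability T R.

Lemma rdot_rtr d (A : 'M[R[i]]_d) (v : 'cV[R[i]]_d) : rdot v (A *m v) = rtr (A * (v *m v ^t*)).
Proof.
rewrite /rdot /rtr -mulmxE mulmxA mxtrace_mulC mulmxA.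
by rewrite /mxtrace big_ord1.
Qed.

(** Convexity of y^p, read off from Young's inequality for y and t^(p-1) with exponents p and p / (p
    - 1). The case p = 1, without a finite conjugate exponent, is treated apart. *)
Lemma powR_tangent (y t p : R) : 0 <= y -> 0 < t -> 1 <= p ->
  t `^ p + p * t `^ (p - 1) * (y - t) <= y `^ p.
Proof.
move=> y0 t0; rewrite le_eqVlt => /predU1P[<-|p1].
  by rewrite subrr powRr0 (powRr1 y0) (powRr1 (ltW t0)); lra.
have p0 : 0 < p by apply: lt_trans p1.
have p10 : 0 < p - 1 by rewrite subr_gt0.
have q0 : 0 < p / (p - 1) by rewrite divr_gt0.
have pq : p^-1 + (p / (p - 1))^-1 = 1 by field; rewrite !gt_eqF.
have := conjugate_powR y0 (powR_ge0 t (p - 1)) p0 q0 pq.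
rewrite -powRrM (_ : (p - 1) * (p / (p - 1)) = p); last by field; rewrite gt_eqF.
move/(ler_wpM2l (ltW p0)).
have -> : p * (y `^ p / p + t `^ p / (p / (p - 1))) = y `^ p + (p - 1) * t `^ p.
  by field; rewrite !gt_eqF.
have := mulr_powRB1 (ltW t0) p0; move: (t `^ p) (t `^ (p - 1)) (y `^ p) => a b c <-; lra.
Qed.

(** The integral of h may be infinite, so the comparison goes through the positive part of f. *)
Lemma le_integral_nonneg (f h : T -> R) : P.-integrable setT (EFin \o f) ->
  measurable_fun setT h -> (forall w, 0 <= h w) -> (forall w, f w <= h w) ->
  (\int[P]_w (f w)%:E <= \int[P]_w (h w)%:E)%E.
Proof.
move=> fi mh h0 fh; rewrite integralE.
apply: (@le_trans _ _ (\int[P]_w (fun w => (f w)%:E)^\+ w)%E).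
  by rewrite -[leRHS]sube0 leeB // integral_ge0.
apply: ge0_le_integral => //.
- by apply: measurable_funepos; exact: (measurable_int _ fi).
- exact/measurable_EFinP.
- by move=> w _; rewrite funeposE ge_max !lee_fin fh h0.
Qed.

(* Tangent of y^p at |a|, along a unit vector v with |v* a v| = |a|. *)
Lemma jensen_opnorm d (a : 'M[R[i]]_d) (Z : T -> 'M[R[i]]_d) p : (0 < d)%N -> 1 <= p ->
  a \is hermsymmx -> integrable_mx P Z -> mean_mx P Z = 0 -> measurable_mx Z ->
  ((opnorm a `^ p)%:E <= \int[P]_w (opnorm (a + Z w) `^ p)%:E)%E.
Proof.
move=> d0 p1 ha iZ mZ0 mZ.
have p0 : 0 < p by exact: lt_le_trans p1.
have [t0|tn] := eqVneq (opnorm a) 0.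
  rewrite t0 powR0 ?gt_eqF //; apply: integral_ge0 => w _; by rewrite lee_fin powR_ge0.
have tp : 0 < opnorm a by rewrite lt_neqAle eq_sym tn opnorm_ge0.
have [v [v1 vE]] := opnorm_witness d0 ha.
pose s := Num.sg (rdot v (a *m v)).
have [il El] := integral_rtr_mul (v *m v ^t*) iZ.
rewrite mZ0 mul0r /rtr raddf0 /= in El.
pose c := p * opnorm a `^ (p - 1) * s.
have s1 : `|s| <= 1 by rewrite /s normr_sg; case: (_ != 0).
pose g w := opnorm a `^ p + c * rtr (Z w * (v *m v ^t*)).
have gle w : g w <= opnorm (a + Z w) `^ p.
  apply: le_trans (powR_tangent (opnorm_ge0 (a + Z w)) tp p1).
  rewrite /g lerD2l /c -mulrA ler_wpM2l ?mulr_ge0 ?powR_ge0 ?(ltW p0) //.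
  rewrite -rdot_rtr lerBrDr -[X in _ + X <= _]vE normrEsg -/s -mulrDr.
  rewrite -[X in s * X](_ : rdot v ((a + Z w) *m v) = _); last by rewrite mulmxDl rdotDr addrC.
  rewrite (le_trans (ler_norm _)) // normrM.
  have := rdot_opnorm (a + Z w) v; rewrite v1 expr1n mulr1 => h.
  by rewrite -[leRHS]mul1r ler_pM.
have ig : P.-integrable setT (EFin \o g).
  rewrite (_ : _ \o _ = (fun w => ((cst (opnorm a `^ p)%:E) w + c%:E * (rtr (Z w * (v *m v ^t*)))%:E)%E)).
    apply: integrableD => //; last exact: integrableZl.
    exact: (bounded_rv_integrable P (bounded_rv_cst (opnorm a `^ p))).
  by apply/funext => w /=; rewrite -EFinM -EFinD.
have Eg : (\int[P]_w (g w)%:E = (opnorm a `^ p)%:E)%E.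
  rewrite -(fineK (integrable_fin_num measurableT ig)) //; congr EFin.
  rewrite -[LHS]/(\int[P]_w (opnorm a `^ p + c * rtr (Z w * (v *m v ^t*)))).
  rewrite RintegralD //; last 2 first.
  - exact: (bounded_rv_integrable P (bounded_rv_cst _)).
  - rewrite (_ : _ \o _ = (fun w => c%:E * (rtr (Z w * (v *m v ^t*)))%:E)%E); first exact: integrableZl.
    by apply/funext => w /=; rewrite -EFinM.
  by rewrite Ex_cst RintegralZl // El mulr0 addr0.
have mN : measurable_fun setT (fun w => opnorm (a + Z w)).
  by apply: measurable_opnorm => //; apply: measurable_mxD => //; exact: measurable_mx_cst.
have h0 w : 0 <= opnorm (a + Z w) `^ p by exact: powR_ge0.
have mh : measurable_fun setT (fun w => opnorm (a + Z w) `^ p).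
  exact: measurableT_comp (measurable_powR p) mN.
move: (le_integral_nonneg ig mh h0 gle); by rewrite Eg.
Qed.

Lemma centered0 d : centered P (fun=> 0 : 'M[R[i]]_d).
Proof.
split; first by move=> i j; rewrite !mxE; split; exact: integrable0.
by apply/matrixP => i j; rewrite !mxE !unlock; have := @Ex_cst _ _ _ P 0; rewrite /Rintegral => ->.
Qed.

Lemma centeredD d (A B : T -> 'M[R[i]]_d) : centered P A -> centered P B ->
  centered P (fun w => A w + B w).
Proof.
move=> [iA mA] [iB mB]; split.
  move=> i j; have [ra ca] := iA i j; have [rb cb] := iB i j; split.
    have := integrableD measurableT ra rb.
    by congr (_.-integrable _ _); apply/funext => w /=; rewrite mxE raddfD.
  have := integrableD measurableT ca cb.
  by congr (_.-integrable _ _); apply/funext => w /=; rewrite mxE raddfD.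
apply/matrixP => i j; have [ra ca] := iA i j; have [rb cb] := iB i j.
have /matrixP/(_ i j) := mA; have /matrixP/(_ i j) := mB.
rewrite !mxE !unlock => -[rb0 cb0] [ra0 ca0]; congr Complex.
  transitivity (\int[P]_w (complex.Re (A w i j) + complex.Re (B w i j))).
    by apply: eq_Rintegral => w _; rewrite mxE raddfD.
  by rewrite RintegralD // /Rintegral ra0 rb0 addr0.
transitivity (\int[P]_w (complex.Im (A w i j) + complex.Im (B w i j))).
  by apply: eq_Rintegral => w _; rewrite mxE raddfD.
by rewrite RintegralD // /Rintegral ca0 cb0 addr0.
Qed.

Lemma centeredN d (A : T -> 'M[R[i]]_d) : centered P A -> centered P (fun w => - A w).
Proof.
move=> [iA mA]; split.
  move=> i j; have [ra ca] := iA i j; split.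
    have := integrableN ra.
    by congr (_.-integrable _ _); apply/funext => w /=; rewrite mxE raddfN.
  have := integrableN ca.
  by congr (_.-integrable _ _); apply/funext => w /=; rewrite mxE raddfN.
apply/matrixP => i j; have [ra ca] := iA i j.
have /matrixP/(_ i j) := mA.
rewrite !mxE !unlock => -[ra0 ca0]; congr Complex.
  transitivity (\int[P]_w (- 1 * complex.Re (A w i j))).
    by apply: eq_Rintegral => w _; rewrite mxE raddfN mulN1r.
  by rewrite RintegralZl // /Rintegral ra0 mulr0.
transitivity (\int[P]_w (- 1 * complex.Im (A w i j))).
  by apply: eq_Rintegral => w _; rewrite mxE raddfN mulN1r.
by rewrite RintegralZl // /Rintegral ca0 mulr0.
Qed.

Context {n d : nat}.
Variable W : 'I_n -> T -> 'M[R[i]]_d.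
Hypothesis d0 : (0 < d)%N.
Hypothesis mW : forall k, random_mx (W k).
Hypothesis hW : forall k w, W k w \is hermsymmx.
Hypothesis cW : forall k, centered P (W k).
Hypothesis iW : mutual_indep P (fun k => mx_sigma (W k)).

Local Notation out := (outcome W).

Lemma measurable_mx_rv k : measurable_mx (W k).
Proof.
have mo := measurable_outcome mW.
by move=> i j; split; [exact: (measurableT_comp (measurable_Re_coord k i j) mo)
  |exact: (measurableT_comp (measurable_Im_coord k i j) mo)].
Qed.

Lemma centered_psum Q e : centered P (fun w => psum Q e (out w)).
Proof.
rewrite /psum; elim: (index_enum _) => [|k r IH].
  by under eq_fun do rewrite big_nil; exact: centered0.
under eq_fun do rewrite big_cons; case: (Q k) => //; apply: centeredD IH.
by case: (e k); [apply: centeredN|]; exact: cW.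
Qed.

Lemma herm_psum Q e w : psum Q e (out w) \is hermsymmx.
Proof.
apply: herm_sum => k; case: (e k); first apply: hermN; exact: hW.
Qed.

Lemma measurable_norm_psum Q e (p : R) :
  measurable_fun setT (fun x : mxfamily R n d => opnorm (psum Q e x) `^ p).
Proof.
apply: (measurableT_comp (measurable_powR p)).
exact: (@measurable_psum R n d id d0 (@measurable_mx_coord R n d)).
Qed.

Lemma measurable_integral_mix J (h : mxfamily R n d -> \bar R) :
  measurable_fun setT h -> (forall x, (0 <= h x)%E) ->
  measurable_fun setT (fun w => (\int[P]_w' h (mix J (out w) (out w')))%E).
Proof.
move=> mh h0; have mo := measurable_outcome mW.
pose f (z : T * T) := h (mix J (out z.1) (out z.2)).
apply: (@measurable_fun_fubini_tonelli_F _ _ _ _ _ P f); last by move=> z; exact: h0.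
apply: (measurableT_comp mh); apply: (measurableT_comp (@measurable_mix R n d J)
  (g := fun z : T * T => (out z.1, out z.2))).
by apply: measurable_fun_pair; [exact: measurableT_comp mo measurable_fst
  |exact: measurableT_comp mo measurable_snd].
Qed.

(** Given the summands in Q, the others add a centered matrix, which by Jensen does not lower the
    conditional p-th moment. *)
Lemma jensen_psum p Q e : 1 <= p ->
  (\int[P]_w (opnorm (psum Q e (out w)) `^ p)%:E <=
   \int[P]_w (opnorm (psum predT e (out w)) `^ p)%:E)%E.
Proof.
move=> p1; have mo := measurable_outcome mW.
pose J : {set 'I_n} := finset Q.
have mh : measurable_fun setT (fun x : mxfamily R n d => (opnorm (psum predT e x) `^ p)%:E).
  by apply/measurable_EFinP; exact: measurable_norm_psum.
have h0 (x : mxfamily R n d) : (0 <= (opnorm (psum predT e x) `^ p)%:E)%E.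
  by rewrite lee_fin powR_ge0.
have eq_ge (x y : \bar R) : x = y -> (y <= x)%E by move=> ->.
apply: le_trans (eq_ge _ _ (integral_mix mW iW J mh h0)).
have E w w' : psum predT e (mix J (out w) (out w')) = psum Q e (out w) + psum (predC Q) e (out w').
  rewrite (psum_split Q); congr (_ + _); apply: psum_ext => k /= hk; split=> //.
    by rewrite /mix inE hk.
  by rewrite /mix inE (negbTE hk).
apply: ge0_le_integral => //.
- by move=> w _; rewrite lee_fin powR_ge0.
- by apply/measurable_EFinP; exact: (measurableT_comp (measurable_norm_psum Q e p) mo).
- exact: (measurable_integral_mix J mh h0).
- move=> w _; have [iZ mZ] := centered_psum (predC Q) e.
  have := jensen_opnorm d0 p1 (herm_psum Q e w) iZ mZ.
  move=> /(_ _)X; under eq_integral => w' _ do rewrite E; apply: X.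
    apply: measurable_mx_sum => k; case: (e k); first apply: measurable_mxN;
      exact: measurable_mx_rv.
Qed.

Lemma powR_addn_le (x y p : R) : 0 <= x -> 0 <= y -> 0 <= p ->
  (x + y) `^ p <= 2 `^ p * (x `^ p + y `^ p).
Proof.
move=> x0 y0 p0; wlog xy : x y x0 y0 / x <= y.
  move=> h; case: (leP x y) => [|/ltW] xy; first exact: h.
  by rewrite addrC (addrC (x `^ p)); apply: h.
apply: (@le_trans _ _ ((2 * y) `^ p)).
  apply: ge0_ler_powR => //; rewrite ?nnegrE ?addr_ge0 ?mulr_ge0 //; lra.
by rewrite powRM // ler_wpM2l ?powR_ge0 // lerDr powR_ge0.
Qed.

(** For a fixed pattern e the plain sum is the signed sum over the positive signs minus the signed
    sum over the negative ones, and [jensen_psum] bounds both by the full signed sum. As this holds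
    for each e, it can be averaged. *)
Lemma symmetrization p e : 1 <= p ->
  (\int[P]_w (opnorm (\sum_k W k w) `^ p)%:E <=
   (2 `^ p * 2)%:E * \int[P]_w (opnorm (psum predT e (out w)) `^ p)%:E)%E.
Proof.
move=> p1; have mo := measurable_outcome mW.
have p0 : 0 <= p by apply: le_trans p1.
pose Q : pred 'I_n := fun k => ~~ e k.
pose f Q' w := opnorm (psum Q' e (out w)) `^ p.
have mf Q' : measurable_fun setT (fun w => (f Q' w)%:E).
  by apply/measurable_EFinP; exact: (measurableT_comp (measurable_norm_psum Q' e p) mo).
have f0 Q' w : (0 <= (f Q' w)%:E)%E by rewrite lee_fin powR_ge0.
apply: (@le_trans _ _ (\int[P]_w ((2 `^ p)%:E * ((f Q w)%:E + (f (predC Q) w)%:E)))%E).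
  apply: ge0_le_integral => //.
  - by move=> w _; rewrite lee_fin powR_ge0.
  - apply/measurable_EFinP; apply: (measurableT_comp (measurable_powR p)).
    apply: measurable_opnorm => //; apply: measurable_mx_sum => k; exact: measurable_mx_rv.
  - by apply: measurable_funeM; exact: emeasurable_funD.
  move=> w _; rewrite -EFinD -EFinM lee_fin.
  apply: le_trans (powR_addn_le (opnorm_ge0 _) (opnorm_ge0 _) p0).
  apply: ge0_ler_powR => //; rewrite ?nnegrE ?addr_ge0 ?opnorm_ge0 //.
  rewrite -[X in _ <= _ + X]opnormN; apply: le_trans (opnormD _ _).
  rewrite le_eqVlt; apply/orP; left; apply/eqP; congr opnorm.
  rewrite (bigID Q) /= /psum; congr (_ + _); last rewrite -sumrN.
    by apply: eq_bigr => k; rewrite /Q => /negbTE ->.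
  by apply: eq_bigr => k; rewrite /Q /= => /negPn ->; rewrite opprK.
rewrite ge0_integralZl //; last 2 first.
- exact: emeasurable_funD.
- by move=> w _; rewrite adde_ge0.
rewrite ge0_integralD // EFinM -muleA; apply: lee_wpmul2l; first by rewrite lee_fin powR_ge0.
have -> (x : \bar R) : (0 <= x)%E -> (2%:E * x = x + x)%E.
  by move=> x0; rewrite -[2%:E]/((1 + 1)%:E) EFinD ge0_muleDl ?mul1e.
  by apply: leeD; exact: jensen_psum.
by apply: integral_ge0 => w _; exact: (f0 predT).
Qed.
End Symmetrization.

(** Above B the ratio f / B is at least 1, so raising its exponent from p to 2m only increases
    it. *)
Lemma powR_split (R : realType) (f B p : R) m : 0 <= f -> 0 < B -> 0 <= p -> p <= (2 * m)%:R ->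
  f `^ p <= B `^ p + B `^ p / B ^+ (2 * m) * f ^+ (2 * m).
Proof.
move=> f0 B0 p0 pm; case: (leP f B) => fB.
  apply: (@le_trans _ _ (B `^ p)); first by apply: ge0_ler_powR => //; rewrite nnegrE // ltW.
  by rewrite lerDl mulr_ge0 ?divr_ge0 ?powR_ge0 ?exprn_ge0 ?(ltW B0).
have fp : 0 < f by apply: lt_trans fB.
rewrite -[leLHS]add0r lerD ?powR_ge0 // -mulrA -exprVn mulrC.
have x1 : 1 <= f / B by rewrite ler_pdivlMr // mul1r ltW.
have -> : f `^ p = (f / B) `^ p * B `^ p.
  by rewrite -powRM ?divr_ge0 ?ltW // divfK // gt_eqF.
rewrite -exprMn mulrC [X in X ^+ _]mulrC.
rewrite mulrC ler_wpM2r ?powR_ge0 // -powR_mulrn; last by apply: le_trans x1.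
exact: ler_powR.
Qed.

Section BoundedPart.
Context {dT : measure_display} {T : measurableType dT} {R : realType}.
Variable P : probability T R.
Context {n d : nat}.
Variable W : 'I_n -> T -> 'M[R[i]]_d.
Hypothesis d0 : (0 < d)%N.
Hypothesis mW : forall k, random_mx (W k).
Hypothesis iW : mutual_indep P (fun k => mx_sigma (W k)).
Hypothesis hW : forall k w, W k w \is hermsymmx.

Variables (phi : 'M[R[i]]_d -> 'M[R[i]]_d) (u : R).
Hypothesis mphi : forall k, measurable_mx (fun x : mxfamily R n d => phi (x k)).
Hypothesis hphi : forall A, A \is hermsymmx -> phi A \is hermsymmx.
Hypothesis phiu : forall A, opnorm (phi A) <= u.

(* f^p <= B^p + B^(p - 2m) f^(2m), and B^(2m) dominates the moment of order 2m. *)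
Lemma bounded_part p m (V : 'M[R[i]]_d) (B : R) :
  V \is hermsymmx -> psd (V - \sum_k mean_mx P (fun w => phi (W k w) ^+ 2)) ->
  0 <= p -> p <= (2 * m.+1)%:R -> 0 < B ->
  (2 * m.+1)%:R ^+ m.+1 * (rtr V * (2 * (opnorm V + m.+1%:R * u ^+ 2)) ^+ m) <= B ^+ (2 * m.+1) ->
  (\sum_e \int[P]_w (signed_norm W phi e w `^ p)%:E <= (2 ^+ n * (2 * B `^ p))%:E)%E.
Proof.
move=> hV pV p0 pm B0 hB.
have BM : 0 < B ^+ (2 * m.+1) by exact: exprn_gt0.
pose c := B `^ p / B ^+ (2 * m.+1).
have c0 : 0 <= c by rewrite divr_ge0 ?powR_ge0 // ltW.
have cB : c * B ^+ (2 * m.+1) = B `^ p by rewrite divfK // gt_eqF.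
have sumc (t : R) : \sum_(e : {ffun 'I_n -> bool}) t = 2 ^+ n * t by exact: sum_sign_const.
pose A (e : {ffun 'I_n -> bool}) w := psum predT e (fun k => phi (W k w)).
have hA e w : A e w \is hermsymmx.
  apply: herm_sum => k; case: (e k); first apply: hermN; exact: hphi.
have bA e : bounded_rmx (A e).
  apply: bounded_rmx_sum => k; have bk := bounded_phi mW mphi phiu k.
  case: (e k); last exact: bk.
  have [mk [a ha]] := bk; split; first exact: measurable_mxN.
  by exists a => w; rewrite opnormN.
pose F e w := rtr (A e w ^+ (2 * m.+1)).
have bF e : bounded_rv (F e) by apply: bounded_rv_rtr; exact: bounded_rmxX.
have bS : bounded_rv (fun w => rtr (sqr_sum phi (outcome W w) ^+ m.+1)).
  by apply: bounded_rv_rtr; apply: bounded_rmxX; exact: (bounded_sqr_sum mW mphi phiu).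
pose K := (2 * m.+1)%:R ^+ m.+1 * 2 ^+ n : R.
have K0 : 0 <= K by rewrite mulr_ge0 ?exprn_ge0.
have khin w : \sum_e F e w <= K * rtr (sqr_sum phi (outcome W w) ^+ m.+1).
  have := @khintchine R n d (fun k => phi (W k w)) m.+1 (fun k => hphi (hW k w)).
  rewrite mulrA; apply: le_trans; rewrite le_eqVlt; apply/orP; left; apply/eqP.
  by apply: eq_bigr => e _; rewrite sign_sum_psum.
have sumF : \sum_e \int[P]_w F e w <= 2 ^+ n * B ^+ (2 * m.+1).
  rewrite -(Ex_sum P _ _ bF).
  apply: (@le_trans _ _ (\int[P]_w (K * rtr (sqr_sum phi (outcome W w) ^+ m.+1)))).
    by apply: Ex_le khin; [exact: bounded_rv_sum|exact: bounded_rvZ].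
  rewrite (ExZ P _ bS).
  apply: le_trans (ler_wpM2l K0 (psd_moments mW iW mphi hphi phiu hW m hV pV)) _.
  by rewrite /K mulrAC mulrC ler_wpM2l // exprn_ge0.
have step e : (\int[P]_w (signed_norm W phi e w `^ p)%:E <= (B `^ p + c * \int[P]_w F e w)%:E)%E.
  have bG : bounded_rv (fun w => B `^ p + c * F e w).
    by apply: bounded_rvD; [exact: bounded_rv_cst|exact: bounded_rvZ].
  have -> : B `^ p + c * \int[P]_w F e w = \int[P]_w (B `^ p + c * F e w).
    rewrite (ExD P (bounded_rv_cst _) (bounded_rvZ c (bF e))) Ex_cst.
    by rewrite (ExZ P c (bF e)).
  rewrite -(Ex_fin P bG); apply: ge0_le_integral => //.
  - by move=> w _; rewrite lee_fin powR_ge0.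
  - apply/measurable_EFinP; apply: (measurableT_comp (measurable_powR p)).
    exact: measurable_signed_norm.
  - by apply/measurable_EFinP; case: bG.
  - move=> w _; rewrite lee_fin.
    apply: le_trans (powR_split (opnorm_ge0 _) B0 p0 pm) _.
    have X := opnorm_exp_le m.+1 d0 (hA e w).
    by rewrite lerD2l; exact: ler_wpM2l c0 _ _ X.
apply: le_trans (lee_sum _ (fun e _ => step e)) _.
rewrite sumEFin lee_fin big_split /= sumc -mulr_sumr.
apply: (@le_trans _ _ (2 ^+ n * B `^ p + c * (2 ^+ n * B ^+ (2 * m.+1)))).
  by rewrite lerD2l ler_wpM2l.
by rewrite mulrCA cB; lra.
Qed.
End BoundedPart.

(** * Sums of rare large summands *)

Section RareEvents.
Context {dT : measure_display} {T : measurableType dT} {R : realType}.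
Variable P : probability T R.
Context {n d : nat}.
Variable W : 'I_n -> T -> 'M[R[i]]_d.
Hypothesis mW : forall k, random_mx (W k).
Hypothesis iW : mutual_indep P (fun k => mx_sigma (W k)).

Lemma markov_set (S : set T) (f : T -> R) c : measurable S -> measurable_fun setT f ->
  (forall w, 0 <= f w) -> 0 <= c -> (forall w, S w -> c <= f w) ->
  (c%:E * P S <= \int[P]_w (f w)%:E)%E.
Proof.
move=> mS mf f0 c0 cf.
have mI : measurable_fun setT (fun w => (\1_S w : R)%:E) by apply/measurable_EFinP.
rewrite -[S in P S]setIT -integral_indic // -ge0_integralZl //.
apply: ge0_le_integral => //.
- by move=> w _; rewrite -EFinM lee_fin mulr_ge0.
- exact: measurable_funeM.
- exact/measurable_EFinP.
- move=> w _; rewrite -EFinM lee_fin indicE; case: (asboolP (S w)) => Sw.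
    by rewrite mem_set // mulr1 cf.
  by rewrite memNset // mulr0.
Qed.

Lemma integral_prod_indep (F : 'I_n -> 'M[R[i]]_d -> R) (r : seq 'I_n) : uniq r ->
  (forall k, measurable_fun setT (fun x : mxfamily R n d => F k (x k))) ->
  (forall k A, 0 <= F k A) ->
  (\int[P]_w (\prod_(k <- r) F k (W k w))%:E = \prod_(k <- r) \int[P]_w (F k (W k w))%:E)%E.
Proof.
move=> ur mF F0; elim: r ur => [|k r IH] /=.
  move=> _; rewrite big_nil; under eq_integral do rewrite big_nil.
  by rewrite (Ex_fin P (bounded_rv_cst 1)) Ex_cst.
move=> /andP[kr /IH {}IH]; rewrite big_cons -IH.
pose f (x : mxfamily R n d) := (F k (x k))%:E.
pose g (x : mxfamily R n d) := (\prod_(j <- r) F j (x j))%:E.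
have mf : measurable_fun setT f by apply/measurable_EFinP.
have mg : measurable_fun setT g by apply/measurable_EFinP; apply: measurable_prod.
have f0 x : (0 <= f x)%E by rewrite lee_fin.
have g0 x : (0 <= g x)%E by rewrite lee_fin prodr_ge0.
have hf x y : f (mix [set k]%SET x y) = f x by rewrite /f /mix inE eqxx.
have hg x y : g (mix [set k]%SET x y) = g y.
  congr EFin; apply: eq_big_seq => j jr; rewrite /mix inE.
  by case: eqP => // jk; move: kr; rewrite -jk jr.
rewrite -(integral_mixM mW iW mf mg f0 g0 hf hg).
by apply: eq_integral => w _; rewrite big_cons.
Qed.

(** [b] marks the large matrices, [G] is a nonnegative weight supported on them, and [H] dominates
    every G (W k), typically as a function of the maximum norm. *)
Variables (b : pred 'M[R[i]]_d) (G : 'M[R[i]]_d -> R) (H : T -> R) (h : R).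
Hypothesis mb : forall k, measurable_fun setT (fun x : mxfamily R n d => ind (b (x k)) : R).
Hypothesis mG : forall k, measurable_fun setT (fun x : mxfamily R n d => G (x k)).
Hypothesis G0 : forall A, 0 <= G A.
Hypothesis Gb : forall A, ~~ b A -> G A = 0.
Hypothesis rare : \int[P]_w ind [exists k, b (W k w)] <= 24^-1.
Hypothesis mH : measurable_fun setT H.
Hypothesis H0 : forall w, 0 <= H w.
Hypothesis GH : forall k w, G (W k w) <= H w.
Hypothesis Hh : (\int[P]_w (H w)%:E <= h%:E)%E.

(** Indicator that no summand but the k-th is large. It is a function of the other coordinates,
    hence independent of W k. *)
Definition others_quiet (k : 'I_n) (x : mxfamily R n d) : R :=
  \prod_j (if j == k then 1 else ind (~~ b (x j))).

Lemma measurable_quiet k : measurable_fun setT (others_quiet k).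
Proof.
apply: measurable_prod => j _; case: (j == k); first exact: measurable_cst.
by under eq_fun do rewrite ind_neg; exact: measurable_funB.
Qed.

Lemma quiet_ge0 k x : 0 <= others_quiet k x.
Proof. by apply: prodr_ge0 => j _; case: (j == k); rewrite ?ind_ge0. Qed.

Lemma quiet_le1 k x : others_quiet k x <= 1.
Proof.
apply: prodr_ile1 => j _; case: (j == k); first by rewrite ler01 lexx.
by case: (b (x j)); rewrite /ind /= ?ler01 ?lexx.
Qed.

Lemma bounded_quiet k : bounded_rv (fun w => others_quiet k (outcome W w)).
Proof.
apply: (bounded_out mW (measurable_quiet k)) => x.
by rewrite ger0_norm ?quiet_ge0 // quiet_le1.
Qed.

Lemma Ex_quiet_ge k : 1 - 24^-1 <= \int[P]_w others_quiet k (outcome W w).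
Proof.
have mE : measurable_fun setT (fun x : mxfamily R n d => ind [exists j, b (x j)] : R).
  under eq_fun do rewrite -[X in ind X]negbK negb_exists ind_neg ind_forall.
  apply: measurable_funB => //; apply: measurable_prod => j _.
  by under eq_fun do rewrite ind_neg; exact: measurable_funB.
have bE : bounded_rv (fun w => ind [exists j, b (W j w)] : R).
  by apply: (bounded_out mW mE) => x; exact: ind_bounded.
apply: (@le_trans _ _ (\int[P]_w (1 - ind [exists j, b (W j w)]))).
  by rewrite (ExB P (bounded_rv_cst 1) bE) Ex_cst lerB.
apply: Ex_le; [|exact: bounded_quiet|].
  by apply: bounded_rvB => //; exact: bounded_rv_cst.
move=> w; case: existsP => [_|E]; first by rewrite /ind subrr quiet_ge0.
rewrite /others_quiet big1 ?subr0 // => j _; case: (j == k) => //.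
by have /negbTE -> : ~~ b (outcome W w j) by apply/negP => bj; apply: E; exists j.
Qed.

(* At most one of the summands is nonzero, and it is bounded by H. *)
Lemma sum_quiet_le w : \sum_k G (W k w) * others_quiet k (outcome W w) <= H w.
Proof.
have [/existsP[k bk]|/existsPn nb] := boolP [exists k, b (W k w)]; last first.
  by rewrite big1 // => k _; rewrite Gb ?mul0r.
rewrite (bigD1 k) //= [X in _ + X]big1 ?addr0.
  by apply: le_trans (GH k w); rewrite ler_piMr // quiet_le1.
move=> j jk; rewrite /others_quiet (bigD1 k) //= eq_sym (negbTE jk).
by rewrite bk {1}/ind mul0r mulr0.
Qed.

(** By independence E G(W k) times the probability that the others are quiet, at least 23/24, is the
    expectation of the product; the products sum to at most H. *)
Lemma sum_integral_le : (\sum_k \int[P]_w (G (W k w))%:E <= (24 / 23 * h)%:E)%E.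
Proof.
have mo := measurable_outcome mW.
have mGo k : measurable_fun setT (fun w => (G (W k w))%:E).
  by apply/measurable_EFinP; exact: (measurableT_comp (mG k) mo).
have mGq k : measurable_fun setT (fun w => (G (W k w) * others_quiet k (outcome W w))%:E).
  apply/measurable_EFinP; apply: measurable_funM; first exact: (measurableT_comp (mG k) mo).
  exact: (measurableT_comp (measurable_quiet k) mo).
have step k : ((23 / 24)%:E * \int[P]_w (G (W k w))%:E <=
    \int[P]_w (G (W k w) * others_quiet k (outcome W w))%:E)%E.
  pose f (x : mxfamily R n d) := (G (x k))%:E.
  pose g (x : mxfamily R n d) := (others_quiet k x)%:E.
  have mf : measurable_fun setT f by apply/measurable_EFinP.
  have mg : measurable_fun setT g by apply/measurable_EFinP; exact: measurable_quiet.
  have f0 x : (0 <= f x)%E by rewrite lee_fin.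
  have g0 x : (0 <= g x)%E by rewrite lee_fin quiet_ge0.
  have hf x y : f (mix [set k]%SET x y) = f x by rewrite /f /mix inE eqxx.
  have hg x y : g (mix [set k]%SET x y) = g y.
    by congr EFin; apply: eq_bigr => j _; rewrite /mix inE; case: (j == k).
  have E := integral_mixM mW iW mf mg f0 g0 hf hg.
  apply: (@le_trans _ _ (\int[P]_w f (outcome W w) * \int[P]_w g (outcome W w))%E).
    rewrite [leLHS]muleC; apply: lee_wpmul2l; first by apply: integral_ge0 => w _; rewrite lee_fin.
    rewrite (Ex_fin P (bounded_quiet k)) lee_fin.
    by apply: le_trans (Ex_quiet_ge k); lra.
  by rewrite -E.
have : ((23 / 24)%:E * \sum_k \int[P]_w (G (W k w))%:E <= h%:E)%E.
  rewrite ge0_sume_distrr; last by move=> k _; apply: integral_ge0 => w _; rewrite lee_fin.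
  apply: le_trans (lee_sum _ (fun k _ => step k)) _.
  rewrite -ge0_integral_sum //; last first.
  - by move=> k w _; rewrite lee_fin mulr_ge0 ?quiet_ge0.
  apply: le_trans Hh; apply: ge0_le_integral => //.
  - by move=> w _; apply: sume_ge0 => k _; rewrite lee_fin mulr_ge0 ?quiet_ge0.
  - exact: emeasurable_sum.
  - exact/measurable_EFinP.
  - by move=> w _; rewrite sumEFin lee_fin sum_quiet_le.
move=> /(@lee_wpmul2l _ (24 / 23)%:E _ _ _); rewrite muleA -!EFinM.
have -> : 24 / 23 * (23 / 24) = 1 :> R by field.
by rewrite mul1e; apply; rewrite lee_fin; lra.
Qed.

(** Markov's inequality for the product, whose expectation is by independence the product of the 1 +
    E G(W k), at most the exponential of the sum of the E G(W k). *)
Lemma product_tail (S : set T) c : measurable S -> 0 < c ->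
  (forall w, S w -> c <= \prod_k (1 + G (W k w))) ->
  (P S <= (expR (24 / 23 * h) / c)%:E)%E.
Proof.
move=> mS c0 hS; have mo := measurable_outcome mW.
have gE k : (\int[P]_w (G (W k w))%:E = (fine (\int[P]_w (G (W k w))%:E))%:E)%E.
  rewrite fineK // ge0_fin_numE; last by apply: integral_ge0 => w _; rewrite lee_fin.
  apply: (@le_lt_trans _ _ (24 / 23 * h)%:E); last by rewrite ltry.
  apply: le_trans sum_integral_le; rewrite (bigD1 k) //= leeDl //.
  by apply: sume_ge0 => j _; apply: integral_ge0 => w _; rewrite lee_fin.
pose g k := fine (\int[P]_w (G (W k w))%:E).
have g0 k : 0 <= g k by rewrite -lee_fin -gE integral_ge0 // => w _; rewrite lee_fin.
have sg : \sum_k g k <= 24 / 23 * h.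
  rewrite -lee_fin -sumEFin; apply: le_trans sum_integral_le.
  by rewrite le_eqVlt; apply/orP; left; apply/eqP; apply: eq_bigr => k _; rewrite gE.
have mP : measurable_fun setT (fun w => \prod_k (1 + G (W k w))).
  apply: measurable_prod => k _; apply: measurable_funD => //.
  exact: (measurableT_comp (mG k) mo).
have p0 w : 0 <= \prod_k (1 + G (W k w)) by apply: prodr_ge0 => k _; rewrite addr_ge0.
have E := markov_set mS mP p0 (ltW c0) hS.
have F := @integral_prod_indep (fun _ A => 1 + G A) _ (index_enum_uniq _).
have {F} F : (\int[P]_w (\prod_k (1 + G (W k w)))%:E = (\prod_k (1 + g k))%:E)%E.
  rewrite F -?prodEFin //; last 2 first.
  - by move=> k; exact: measurable_funD.
  - by move=> k A; rewrite addr_ge0.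
  apply: eq_bigr => k _; under eq_integral do rewrite EFinD.
  rewrite ge0_integralD //.
  - by rewrite (Ex_fin P (bounded_rv_cst 1)) Ex_cst gE.
  - by move=> w _; rewrite lee_fin.
  - by apply/measurable_EFinP; exact: (measurableT_comp (mG k) mo).
have {}E : (c%:E * P S <= (expR (24 / 23 * h))%:E)%E.
  apply: (le_trans E); rewrite F lee_fin.
  apply: (@le_trans _ _ (expR (\sum_k g k))); last by rewrite ler_expR.
  rewrite expR_sum; apply: ler_prod => k _; rewrite addr_ge0 //= expR_ge1Dx.
  by [].
rewrite EFinM muleC lee_pdivlMl //.
Qed.
End RareEvents.

(** * Numerical constants *)

Section Numerics.
Variable R : realType.
Implicit Types p : R.

Lemma expR1_ge2 : 2 <= expR 1 :> R.
Proof. by have := expR_ge1Dx (1 : R); lra. Qed.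

(** exp (-1/2) >= 1 - 1/2, hence exp (1/2) <= 2. *)
Lemma expR1_le4 : expR 1 <= 4 :> R.
Proof.
have h : expR (2^-1) <= 2 :> R.
  have := expR_ge1Dx (- 2^-1 : R); rewrite expRN => h.
  rewrite -[leRHS]invrK -[leLHS]invrK lef_pV2 ?posrE ?invr_gt0 ?expR_gt0 //.
  by apply: le_trans h; lra.
have -> : (1 : R) = 2^-1 + 2^-1 by field.
by rewrite expRD; have := expR_ge0 (2^-1 : R); nra.
Qed.

Lemma powR3_le p : 0 <= p -> 3 `^ p <= expR (2 * p).
Proof.
move=> p0; rewrite expRM; apply: ge0_ler_powR => //; rewrite ?nnegrE ?expR_ge0 //.
by have := expR_ge1Dx (2 : R); lra.
Qed.

Lemma expR_nat_ge k : 2 ^+ k <= expR k%:R :> R.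
Proof.
rewrite -[k%:R]mulr1 expRM_natl.
by apply: lerXn2r; rewrite ?nnegrE ?expR_ge0 ?expR1_ge2.
Qed.

(** Uses 2^k <= exp k and 3^p <= exp (2 p). The exponent 7 p leaves room for both tail estimates,
    where x is 24/23 or at most 4 p / 23. *)
Lemma tail_constant p (x : R) k : 0 <= p -> x + k%:R + 2 * p <= 7 * p ->
  expR x / expR (7 * p) <= (2 ^+ k * 3 `^ p)^-1.
Proof.
move=> p0 h; have A : 0 < 2 ^+ k * 3 `^ p :> R by rewrite mulr_gt0 ?exprn_gt0 ?powR_gt0.
rewrite ler_pdivrMr ?expR_gt0 // mulrC ler_pdivlMr //.
apply: (@le_trans _ _ (expR x * (expR k%:R * expR (2 * p)))).
  apply: ler_wpM2l; first exact: expR_ge0.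
  by apply: ler_pM; rewrite ?exprn_ge0 ?powR_ge0 ?expR_nat_ge ?powR3_le.
by rewrite -!expRD ler_expR addrA.
Qed.

Lemma ln_e_mul p : 1 <= p -> ln (expR 1 * p) = 1 + ln p.
Proof. by move=> p1; rewrite lnM ?posrE ?expR_gt0 ?(lt_le_trans ltr01 p1) // expRK. Qed.

Lemma ln_e_mul_ge1 p : 1 <= p -> 1 <= ln (expR 1 * p).
Proof. by move=> p1; rewrite ln_e_mul // lerDl ln_ge0. Qed.

Lemma ln_e_mul_le p : 1 <= p -> ln (expR 1 * p) <= p.
Proof.
move=> p1; rewrite ln_e_mul //; have p0 := lt_le_trans ltr01 p1.
by have := expR_ge1Dx (ln p); rewrite lnK.
Qed.
End Numerics.

Lemma ind_mono (R : realType) (a b : bool) : (a -> b) -> ind a <= ind b :> R.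
Proof. by case: a; case: b => // h; rewrite /ind ?ler01 //; have := h isT. Qed.

Section RareSum.
Context {dT : measure_display} {T : measurableType dT} {R : realType}.
Variable P : probability T R.
Context {n d : nat}.
Variable W : 'I_n -> T -> 'M[R[i]]_d.
Hypothesis d0 : (0 < d)%N.
Hypothesis mW : forall k, random_mx (W k).
Hypothesis iW : mutual_indep P (fun k => mx_sigma (W k)).

Lemma ind_indic (b : T -> bool) w : ind (b w) = \1_[set w | b w] w :> R.
Proof.
rewrite indicE /ind; case E : (b w); first by rewrite mem_set.
by rewrite memNset //= E.
Qed.

Lemma Ex_ind (b : T -> bool) : measurable [set w | b w] ->
  (\int[P]_w (ind (b w))%:E = P [set w | b w])%E.
Proof.
move=> mS; rewrite -[X in P X]setIT -integral_indic //; apply: eq_integral => w _.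
by rewrite ind_indic.
Qed.

Lemma bounded_ind (b : T -> bool) : measurable [set w | b w] ->
  bounded_rv (fun w => ind (b w) : R).
Proof.
move=> mS; split; last by exists 1 => w; exact: ind_bounded.
rewrite (_ : (fun _ => _) = \1_[set w | b w]); first exact: measurable_indic.
by apply/funext => w; exact: ind_indic.
Qed.

Lemma Ex_ind_le (b : T -> bool) c : measurable [set w | b w] ->
  (P [set w | b w] <= c%:E)%E -> \int[P]_w ind (b w) <= c.
Proof. by move=> mS; rewrite -Ex_ind // (Ex_fin P (bounded_ind mS)) lee_fin. Qed.

Lemma measurable_maxnorm : measurable_fun setT (maxnorm W).
Proof.
exact: (@measurable_max_psi _ _ _ _ _ W mW id d0 (@measurable_mx_coord R n d)).
Qed.

Lemma maxnorm_ge0 w : 0 <= maxnorm W w.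
Proof. exact: (@max_psi_ge0 _ _ _ _ _ W id w). Qed.

Lemma opnorm_le_maxnorm k w : opnorm (W k w) <= maxnorm W w.
Proof.
have := @bigmax_le_cond R n (fun k => opnorm (W k w)) (maxnorm W w) (maxnorm_ge0 w).
by rewrite lexx => /esym/forallP/(_ k).
Qed.

Lemma exists_lt_maxnorm w t : 0 <= t -> [exists k, t < opnorm (W k w)] = (t < maxnorm W w).
Proof. exact: (@exists_exceed_max _ _ _ _ _ W id w t). Qed.

Lemma measurable_lt (f : T -> R) t : measurable_fun setT f -> measurable [set w | t < f w].
Proof.
move=> mf; rewrite (_ : [set _ | _] = setT `&` f @^-1` `]t, +oo[%classic).
  by apply: mf => //; exact: measurable_itv.
by rewrite setTI; apply/seteqP; split => w /=; rewrite in_itv /= andbT.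
Qed.

(** Markov's inequality at 24 times the bound a of E M. For a = 0 the division fails, but then M = 0
    almost surely. *)
Lemma rare_event a : 0 <= a -> (\int[P]_w (maxnorm W w)%:E <= a%:E)%E ->
  \int[P]_w ind [exists k, 24 * a < opnorm (W k w)] <= 24^-1.
Proof.
move=> a0 Ha; have ta : 0 <= 24 * a by rewrite mulr_ge0.
rewrite (_ : \int[P]_w _ = \int[P]_w ind (24 * a < maxnorm W w)); last first.
  by apply: eq_Rintegral => w _; rewrite exists_lt_maxnorm.
have mS := measurable_lt (24 * a) measurable_maxnorm.
apply: Ex_ind_le => //.
have [a00|an] := eqVneq a 0; last first.
  have ap : 0 < 24 * a by rewrite mulr_gt0 // lt_neqAle eq_sym an.
  have := markov_set P mS measurable_maxnorm maxnorm_ge0 ta (fun w h => ltW h).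
  move=> /le_trans/(_ Ha); rewrite muleC -lee_pdivlMr // => /le_trans; apply.
  by rewrite -EFinM lee_fin le_eqVlt; apply/orP; left; apply/eqP; field; rewrite an.
have I0 : (\int[P]_w `|(maxnorm W w)%:E| = 0)%E.
  apply/eqP; rewrite eq_le; apply/andP; split; last by apply: integral_ge0.
  rewrite a00 in Ha; apply: le_trans Ha.
  rewrite le_eqVlt; apply/orP; left; apply/eqP; apply: eq_integral => w _.
  by rewrite gee0_abs // lee_fin maxnorm_ge0.
have mM : measurable_fun setT (fun w => (maxnorm W w)%:E).
  by apply/measurable_EFinP; exact: measurable_maxnorm.
have [/(_ I0) ae _] := ae_eq_integral_abs P measurableT mM.
rewrite (_ : P _ = 0%E) ?lee_fin //; apply: measure_negligible => //.
apply: negligibleS ae => w /=; rewrite a00 mulr0 => h /(_ I) [] /eqP.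
by rewrite gt_eqF.
Qed.

Variables (t0 : R).
Hypothesis t00 : 0 <= t0.
Hypothesis rare : \int[P]_w ind [exists k, t0 < opnorm (W k w)] <= 24^-1.

Definition large_part (A : 'M[R[i]]_d) : 'M[R[i]]_d := if t0 < opnorm A then A else 0.

Definition large_sum (w : T) : R := \sum_k opnorm (large_part (W k w)).

Lemma measurable_large_part k : measurable_mx (fun x : mxfamily R n d => large_part (x k)).
Proof.
have mk := @measurable_mx_coord R n d k.
apply: measurable_mx_if; [|exact: mk|exact: measurable_mx_cst].
by apply: measurable_fun_ltr => //; exact: measurable_opnorm.
Qed.

Lemma measurable_large_sum : measurable_fun setT large_sum.
Proof.
have mo := measurable_outcome mW.
apply: measurable_sum => k.
exact: (measurableT_comp (measurable_opnorm d0 (measurable_large_part k)) mo).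
Qed.

Lemma measurable_exceed k :
  measurable_fun setT (fun x : mxfamily R n d => ind (t0 < opnorm (x k)) : R).
Proof.
apply: measurable_ind => //; apply: measurable_opnorm => //; exact: measurable_mx_coord.
Qed.

(** [product_tail] with G = exp (|large part| / r0) - 1: the product of the 1 + G is exp (large_sum
    / r0), and H = exp (M / r0) - 1 has expectation at most 1. *)
Lemma psi1_tail p r0 : 1 <= p -> 0 < r0 ->
  (\int[P]_w (expR (maxnorm W w / r0))%:E <= 2%:E)%E ->
  (P [set w | (7 * p * r0 < large_sum w)%R] <= ((8 * 3 `^ p)^-1)%:E)%E.
Proof.
move=> p1 r00 hE; have mS := measurable_lt (7 * p * r0) measurable_large_sum.
pose b : pred 'M[R[i]]_d := fun A => t0 < opnorm A.
pose G (A : 'M[R[i]]_d) := expR (opnorm (large_part A) / r0) - 1.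
pose H w := expR (maxnorm W w / r0) - 1.
have e1 (x : R) : 0 <= x -> 0 <= expR (x / r0) - 1.
  by move=> x0; rewrite subr_ge0 -[leLHS]expR0 ler_expR divr_ge0 // ltW.
have mG k : measurable_fun setT (fun x : mxfamily R n d => G (x k)).
  apply: measurable_funB => //; apply: measurableT_comp => //.
  apply: measurable_funM => //.
  exact: measurable_opnorm d0 (measurable_large_part k).
have G0 A : 0 <= G A by exact: e1 (opnorm_ge0 _).
have Gb A : ~~ b A -> G A = 0.
  by rewrite /b => nb; rewrite /G /large_part (negbTE nb) opnorm0 mul0r expR0 subrr.
have mexp : measurable_fun setT (fun w => expR (maxnorm W w / r0)).
  by apply: measurableT_comp => //; apply: measurable_funM => //; exact: measurable_maxnorm.
have mH : measurable_fun setT H by exact: measurable_funB.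
have H0 w : 0 <= H w by exact: e1 (maxnorm_ge0 w).
have GH k w : G (W k w) <= H w.
  rewrite /G /H lerD2r ler_expR ler_wpM2r ?invr_ge0 ?(ltW r00) // /large_part.
  by case: ifP => _; rewrite ?opnorm0 ?maxnorm_ge0 ?opnorm_le_maxnorm.
have Hh : (\int[P]_w (H w)%:E <= 1%:E)%E.
  have : (\int[P]_w (H w)%:E + 1%:E <= 1%:E + 1%:E)%E.
    rewrite -EFinD; apply: le_trans hE; rewrite le_eqVlt; apply/orP; left; apply/eqP.
    have {1}-> : (1%:E = \int[P]_w (1 : R)%:E)%E.
      by rewrite (Ex_fin P (bounded_rv_cst 1)) Ex_cst.
    rewrite -ge0_integralD //.
    - by apply: eq_integral => w _; rewrite -EFinD subrK.
    - by move=> w _; rewrite lee_fin.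
    - exact/measurable_EFinP.
  by rewrite leeD2rE.
have c0 : 0 < expR (7 * p) by exact: expR_gt0.
have hS w : [set w | 7 * p * r0 < large_sum w] w -> expR (7 * p) <= \prod_k (1 + G (W k w)).
  move=> /= h; rewrite (eq_bigr (fun k => expR (opnorm (large_part (W k w)) / r0))).
    by rewrite -expR_sum ler_expR -mulr_suml ler_pdivlMr // ltW.
  by move=> k _; rewrite /G addrC subrK.
apply: le_trans (product_tail mW iW (b := b) measurable_exceed mG G0 Gb rare mH H0 GH Hh mS c0 hS) _.
rewrite lee_fin mulr1.
have := @tail_constant R p (24 / 23) 3; rewrite (_ : 2 ^+ 3 = 8); last by ring.
by apply; lra.
Qed.

(* Outside two events of probability (16 * 3^p)^-1, the large summands are at most
   48 B and there are at most 7 p / l of them, l = ln (e p): their number has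
   exponential moment of order l at most expR (e p / 23). *)
Lemma poisson_tail p B : 1 <= p -> 0 < B ->
  (\int[P]_w (maxnorm W w `^ p)%:E <= (B `^ p)%:E)%E ->
  (P [set w | (336 * B * p / ln (expR 1 * p) < large_sum w)%R] <= ((8 * 3 `^ p)^-1)%:E)%E.
Proof.
move=> p1 B0 hE; set t := 336 * B * p / _.
have p0 : 0 < p by exact: lt_le_trans p1.
set l := ln (expR 1 * p) in t *; have l1 : 1 <= l by exact: ln_e_mul_ge1.
have l0 : 0 < l by exact: lt_le_trans l1.
have el : expR l = expR 1 * p by rewrite lnK // posrE mulr_gt0 ?expR_gt0.
pose b : pred 'M[R[i]]_d := fun A => t0 < opnorm A.
pose N w : R := \sum_k ind (b (W k w)).
have mo := measurable_outcome mW.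
have mN : measurable_fun setT N.
  by apply: measurable_sum => k; exact: (measurableT_comp (measurable_exceed k) mo).
have mSt := measurable_lt t measurable_large_sum.
have mS := measurable_lt (7 * p / l) mN.
have mU := measurable_lt (48 * B) measurable_maxnorm.
have cover : [set w | t < large_sum w] `<=`
    [set w | 7 * p / l < N w] `|` [set w | 48 * B < maxnorm W w].
  move=> w /= ht; case: (ltP (48 * B) (maxnorm W w)) => [|hM]; [by right|left].
  have B48 : 0 < 48 * B by rewrite mulr_gt0.
  have : large_sum w <= 48 * B * N w.
    rewrite mulr_sumr; apply: ler_sum => k _; rewrite /large_part /b.
    case: ifP => _; rewrite /ind /= ?mulr1 ?mulr0 ?opnorm0 //.
    exact: le_trans (opnorm_le_maxnorm k w) hM.
  move=> /(lt_le_trans ht); rewrite mulrC -ltr_pdivrMr //.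
  rewrite (_ : t / _ = 7 * p / l) // /t; field.
  by rewrite !gt_eqF.
apply: (@le_trans _ _ (P ([set w | 7 * p / l < N w] `|` [set w | 48 * B < maxnorm W w]))).
  by apply: le_measure cover; rewrite inE; [exact: mSt|exact: measurableU].
apply: le_trans (measureU2 _ _ _) _ => //.
have E3 : 0 < 3 `^ p :> R by rewrite powR_gt0.
have -> : ((8 * 3 `^ p)^-1)%:E = ((16 * 3 `^ p)^-1 + (16 * 3 `^ p)^-1)%:E :> \bar R.
  by congr EFin; field; rewrite gt_eqF.
rewrite EFinD; apply: leeD; last first.
  have cp : 0 < (48 * B) `^ p by rewrite powR_gt0 // mulr_gt0.
  have mp : measurable_fun setT (fun w => maxnorm W w `^ p).
    exact: (measurableT_comp (measurable_powR p) measurable_maxnorm).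
  have := markov_set P mU mp (fun w => powR_ge0 _ _) (ltW cp).
  have hU w : [set w | 48 * B < maxnorm W w] w -> (48 * B) `^ p <= maxnorm W w `^ p.
    move=> /= h; apply: ge0_ler_powR; rewrite ?nnegrE ?(ltW p0) ?maxnorm_ge0 ?(ltW h) //.
    by rewrite mulr_ge0 // ltW.
  move=> /(_ hU)/le_trans/(_ hE); rewrite muleC -lee_pdivlMr // => /le_trans; apply.
  rewrite -EFinM lee_fin powRM ?(ltW B0) // invfM mulrCA divff ?gt_eqF ?powR_gt0 // mulr1.
  rewrite lef_pV2 ?posrE ?powR_gt0 ?mulr_gt0 //.
  (* (48 B)^p is at least 16 * 3^p * B^p because p >= 1. *)
  rewrite (_ : 48 = 16 * 3); last by ring.
  by rewrite powRM // ler_wpM2r ?(ltW E3) // -[leLHS]powRr1 // ler_powR // ler1n.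
pose G (A : 'M[R[i]]_d) := (expR l - 1) * ind (b A).
pose H w := (expR l - 1) * ind [exists k, t0 < opnorm (W k w)].
have el0 : 0 <= expR l - 1 by rewrite subr_ge0 -[leLHS]expR0 ler_expR ltW.
have mG k : measurable_fun setT (fun x : mxfamily R n d => G (x k)).
  apply: measurable_funM => //; exact: measurable_exceed.
have G0 A : 0 <= G A by rewrite mulr_ge0 ?ind_ge0.
have Gb A : ~~ b A -> G A = 0 by move=> nb; rewrite /G (negbTE nb) mulr0.
have bI : bounded_rv (fun w => ind [exists k, t0 < opnorm (W k w)] : R).
  have -> : (fun w => ind [exists k, t0 < opnorm (W k w)] : R) = (fun w => ind (t0 < maxnorm W w)).
    by apply/funext => w; rewrite exists_lt_maxnorm.
  by apply: bounded_ind; apply: measurable_lt; exact: measurable_maxnorm.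
have bH : bounded_rv H by exact: bounded_rvZ.
have H0 w : 0 <= H w by rewrite mulr_ge0 ?ind_ge0.
have GH k w : G (W k w) <= H w.
  apply: ler_wpM2l; first exact: el0.
  by apply: ind_mono => h; apply/existsP; exists k.
have Hh : (\int[P]_w (H w)%:E <= ((expR l - 1) * 24^-1)%:E)%E.
  by rewrite (Ex_fin P bH) lee_fin (ExZ P _ bI) ler_wpM2l.
have c0 : 0 < expR (7 * p) by exact: expR_gt0.
have hS w : [set w | 7 * p / l < N w] w -> expR (7 * p) <= \prod_k (1 + G (W k w)).
  move=> /=; rewrite ltr_pdivrMr // => h.
  rewrite (eq_bigr (fun k => expR (ind (b (W k w)) * l))).
    by rewrite -expR_sum ler_expR -mulr_suml ltW.
  move=> k _; rewrite /G; case: (b _); rewrite /ind /= ?mulr1 ?mul1r ?mulr0 ?mul0r ?expR0 ?addr0 //.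
  by rewrite addrC subrK.
apply: le_trans (product_tail mW iW (b := b) measurable_exceed mG G0 Gb rare bH.1 H0 GH Hh mS c0 hS) _.
rewrite lee_fin.
have := @tail_constant R p (24 / 23 * ((expR l - 1) / 24)) 4.
rewrite (_ : 2 ^+ 4 = 16); last by ring.
apply; first exact: ltW.
(* The exponent x is (e p - 1) / 23, for which the bound e <= 4 suffices. *)
by rewrite el; have := @expR1_le4 R; nra.
Qed.
End RareSum.

(** * Random signs and averages over sign patterns *)

Section RandomSigns.
Context {dT : measure_display} {T : measurableType dT} {R : realType}.
Variable P : probability T R.
Context {n d : nat}.
Variable W : 'I_n -> T -> 'M[R[i]]_d.
Variable eps : 'I_n -> {RV P >-> R}.
Hypothesis d0 : (0 < d)%N.
Hypothesis mW : forall k, random_mx (W k).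
Hypothesis beps : forall k, symmetric_bernoulli P (eps k).
Hypothesis ieps : mutual_indep P (fun k => rv_sigma (eps k)).
Hypothesis iepsW : indep P (joint_sigma (fun k => rv_sigma (eps k)))
  (joint_sigma (fun k => mx_sigma (W k))).
Variable t0 : R.

Local Notation D k w := (large_part t0 (W k w)).
Local Notation DD w := (fun k => large_part t0 (W k w)).

Definition signed_sum (w : T) : 'M[R[i]]_d := \sum_k (eps k w)%:C%C *: D k w.

Lemma measurable_mx_scale (f : T -> R) (A : T -> 'M[R[i]]_d) :
  measurable_fun setT f -> measurable_mx A -> measurable_mx (fun w => (f w)%:C%C *: A w).
Proof.
move=> mf mA i j; have [mR mI] := mA i j; split.
  rewrite (_ : (fun _ => _) = (fun w => f w * complex.Re (A w i j))).
    exact: measurable_funM.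
  by apply/funext => w; rewrite mxE; case: (A w i j) => a b /=; rewrite mul0r subr0.
rewrite (_ : (fun _ => _) = (fun w => f w * complex.Im (A w i j))).
  exact: measurable_funM.
by apply/funext => w; rewrite mxE; case: (A w i j) => a b /=; rewrite mul0r addr0.
Qed.

Lemma measurable_mx_large k : measurable_mx (fun w => D k w).
Proof.
have mo := measurable_outcome mW.
move=> i j; have [h1 h2] := measurable_large_part d0 t0 k i j.
by split; [exact: (measurableT_comp h1 mo)|exact: (measurableT_comp h2 mo)].
Qed.

Lemma measurable_norm_signed_sum : measurable_fun setT (fun w => opnorm (signed_sum w)).
Proof.
apply: measurable_opnorm => //; apply: measurable_mx_sum => k.
by apply: measurable_mx_scale; [exact: measurable_funPT|exact: measurable_mx_large].
Qed.

Definition sign_event (e : {ffun 'I_n -> bool}) : set T := [set w | forall k, eps k w = sgn (e k)].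

Lemma sgn_eps_sigma k (b : bool) : rv_sigma (eps k) [set w | eps k w = sgn b :> R].
Proof. by exists [set sgn b]; [exact: measurable_set1|rewrite setTI]. Qed.

Lemma P_sgn k (b : bool) : P [set w | eps k w = sgn b :> R] = (2^-1)%:E.
Proof. by have [h1 h2] := beps k; case: b; rewrite /sgn ?expr1 ?expr0. Qed.

Lemma sign_event_cap e : sign_event e = \bigcap_(k in [set` [set: 'I_n]%SET]) [set w | eps k w = sgn (e k)].
Proof.
by apply/seteqP; split => w h; [move=> k _; exact: h|move=> k; apply: h => /=; rewrite inE].
Qed.

Lemma P_sign_event e : P (sign_event e) = (2 ^- n)%:E.
Proof.
rewrite sign_event_cap ieps; last by move=> k _; exact: sgn_eps_sigma.
rewrite (eq_bigr (fun=> (2^-1)%:E)); last by move=> k _; exact: P_sgn.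
by rewrite prodEFin prodr_const cardsT card_ord exprVn.
Qed.

Lemma sign_event_sigma e : joint_sigma (fun k => rv_sigma (eps k)) (sign_event e).
Proof.
pose X := \bigcup_k rv_sigma (eps k).
rewrite sign_event_cap.
apply: (@fin_bigcap_measurable _ (g_sigma_algebraType X)) => // k _.
by apply: sub_sigma_algebra; exists k => //; exact: sgn_eps_sigma.
Qed.

(** Independence from the signs is stated for the sigma-algebra generated by the W k, so events have
    to be measurable in it and not only in the ambient one. *)
Lemma outcome_sigma (E : set (mxfamily R n d)) : measurable E ->
  joint_sigma (fun k => mx_sigma (W k)) (outcome W @^-1` E).
Proof.
move=> mE; pose X := \bigcup_k mx_sigma (W k).
have mo : measurable_fun setT (outcome W : g_sigma_algebraType X -> mxfamily R n d).
  apply: measurable_fun_family => k F hF; apply: sub_sigma_algebra.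
  by exists k => //; exact: mx_sigma_preimage.
by have := mo measurableT _ mE; rewrite setTI.
Qed.

Local Notation tail_event t e := [set w | t < opnorm (psum predT e (DD w))].

Lemma tail_event_sigma t e : joint_sigma (fun k => mx_sigma (W k)) (tail_event t e).
Proof.
have mp := measurable_psum d0 (measurable_large_part d0 t0) predT e.
exact: (outcome_sigma (measurable_lt t mp)).
Qed.

Lemma measurable_tail_event t e : measurable (tail_event t e).
Proof.
apply: measurable_lt.
exact: (measurable_signed_norm mW d0 (measurable_large_part d0 t0) e).
Qed.

Lemma measurable_eps_eq k c : measurable [set w | eps k w = c].
Proof.
rewrite -[X in measurable X]setTI.
exact: (measurable_funPT (eps k) measurableT _ (measurable_set1 c)).
Qed.

Lemma measurable_sign_event e : measurable (sign_event e).
Proof.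
rewrite sign_event_cap; apply: fin_bigcap_measurable => // k _.
exact: measurable_eps_eq.
Qed.

Lemma signed_sum_event e w : sign_event e w -> signed_sum w = psum predT e (DD w).
Proof. by move=> h; rewrite -sign_sum_psum; apply: eq_bigr => k _; rewrite h. Qed.

Lemma sign_event_inj e e' w : sign_event e w -> sign_event e' w -> e = e'.
Proof.
move=> h h'; apply/ffunP => k; move: (h k); rewrite (h' k) /sgn.
by case: (e k); case: (e' k) => //; rewrite expr0 expr1 => E; exfalso; lra.
Qed.

(* The signs eps form the pattern e with probability 2^-n, independently of W. *)
Lemma sign_tail_le t :
  ((2 ^- n * sign_tail P W (large_part t0) t)%:E <= P [set w | (t < opnorm (signed_sum w))%R])%E.
Proof.
have mS := measurable_lt t measurable_norm_signed_sum.
pose F e (w : T) : R := \1_(tail_event t e `&` sign_event e) w.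
have mF e : measurable (tail_event t e `&` sign_event e).
  by apply: measurableI; [exact: measurable_tail_event|exact: measurable_sign_event].
have EF e : (\int[P]_w (F e w)%:E = (2 ^- n * \int[P]_w ind (t < opnorm (psum predT e (DD w))))%:E)%E.
  rewrite integral_indic // setIT.
  rewrite setIC; apply: etrans (iepsW (sign_event_sigma e) (tail_event_sigma t e)) _.
  rewrite P_sign_event.
  have mt := measurable_tail_event t e.
  by rewrite EFinM -(Ex_fin P (bounded_ind mt)) (Ex_ind P mt).
rewrite /sign_tail mulr_sumr -sumEFin.
rewrite (eq_bigr (fun e => \int[P]_w (F e w)%:E)%E); last by move=> e _; rewrite EF.
rewrite -ge0_integral_sum //; last 2 first.
- by move=> e; apply/measurable_EFinP; exact: measurable_indic.
- by move=> e w _; rewrite lee_fin.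
rewrite -(Ex_ind P mS); apply: ge0_le_integral => //.
- by move=> w _; apply: sume_ge0 => e _; rewrite lee_fin.
- apply: emeasurable_sum => e; apply/measurable_EFinP; exact: measurable_indic.
- by apply/measurable_EFinP; apply: measurable_ind => //; exact: measurable_norm_signed_sum.
move=> w _; rewrite sumEFin lee_fin.
have F0 e : ~ sign_event e w -> F e w = 0.
  by move=> h; rewrite /F indicE memNset // => -[].
case: (pselect (exists e, sign_event e w)) => [[e he]|no]; last first.
  by rewrite big1 ?ind_ge0 // => e _; apply: F0 => h; apply: no; exists e.
rewrite (bigD1 e) //= big1 ?addr0; last first.
  by move=> e' ne; apply: F0 => h; move/eqP: ne; apply; exact: sign_event_inj h he.
rewrite /F indicE (signed_sum_event he) /ind.
by case: (boolP (w \in _)) => //; rewrite inE => -[/= -> _].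
Qed.

(** The triangle inequality uses |eps k| = 1, which holds only almost surely. The null events [N k]
    where it may fail are added on the right and integrate to 0. *)
Lemma signed_sum_tail_le t :
  (P [set w | (t < opnorm (signed_sum w))%R] <= P [set w | (t < large_sum W t0 w)%R])%E.
Proof.
have mS := measurable_lt t measurable_norm_signed_sum.
have mL := measurable_lt t (measurable_large_sum d0 mW t0).
pose A k : set T := [set w | eps k w = 1]; pose B k : set T := [set w | eps k w = -1].
have mA k : measurable (A k).
  exact: measurable_eps_eq.
have mB k : measurable (B k).
  exact: measurable_eps_eq.
pose N k := ~` (A k `|` B k).
have mN k : measurable (N k) by apply: measurableC; exact: measurableU.
have PN k : P (N k) = 0%E.
  rewrite probability_setC; last exact: measurableU.
  rewrite measureU //; last first.
    by apply/seteqP; split => // w [h1 h2]; exfalso; rewrite /A /B /= in h1 h2; lra.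
  have [h1 h2] := beps k.
  have halves (x y : \bar R) : x = (2^-1)%:E -> y = (2^-1)%:E -> (1 - (x + y) = 0)%E.
    have e : 1 - (2^-1 + 2^-1) = 0 :> R by field.
    by move=> -> ->; exact: (congr1 EFin e).
  exact: halves h1 h2.
have IN k : (\int[P]_w (\1_(N k) w : R)%:E = 0)%E by rewrite integral_indic // setIT; exact: PN.
rewrite -(Ex_ind P mS) -(Ex_ind P mL).
have mI k : measurable_fun setT (fun w => (\1_(N k) w : R)%:E).
  by apply/measurable_EFinP; exact: measurable_indic.
have mLi : measurable_fun setT (fun w => (ind (t < large_sum W t0 w) : R)%:E).
  by apply/measurable_EFinP; apply: measurable_ind => //; exact: measurable_large_sum.
apply: (@le_trans _ _ (\int[P]_w ((ind (t < large_sum W t0 w))%:E + \sum_k (\1_(N k) w)%:E))%E).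
  apply: ge0_le_integral => //.
  - by move=> w _; rewrite lee_fin ind_ge0.
  - by apply/measurable_EFinP; apply: measurable_ind => //; exact: measurable_norm_signed_sum.
  - by apply: emeasurable_funD => //; exact: emeasurable_sum.
  move=> w _; rewrite sumEFin -EFinD lee_fin.
  case: (pselect (exists k, N k w)) => [[k hk]|no].
    rewrite (bigD1 k) //= [\1__ w]indicE mem_set //.
    have := @ind_bounded R (t < opnorm (signed_sum w)); rewrite ger0_norm ?ind_ge0 // => h.
    apply: (le_trans h); rewrite addrCA lerDl addr_ge0 ?ind_ge0 //.
    by apply: sumr_ge0.
  rewrite -[leLHS]addr0 lerD ?sumr_ge0 //; apply: ind_mono => /lt_le_trans; apply.
  apply: le_trans (opnorm_sum _ _ _) _; apply: ler_sum => k _.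
  rewrite opnormZ.
  have -> : `|eps k w| = 1; last by rewrite mul1r.
  have : ~ N k w by move=> h; apply: no; exists k.
  by move=> /contrapT [/= ->|/= ->]; rewrite ?normrN normr1.
rewrite ge0_integralD //.
- by rewrite ge0_integral_sum // ?big1 ?adde0 // => k w _; rewrite lee_fin.
- by move=> w _; rewrite lee_fin ind_ge0.
- by move=> w _; apply: sume_ge0 => k _; rewrite lee_fin.
- exact: emeasurable_sum.
Qed.
End RandomSigns.

(** * The moment inequalities *)

(** With N = m + 1 and X = 2 (c + N u^2), r <= exp N * c <= 4^N X, so the left side is at most (8 N
    X)^N. Since N <= 2 q, 8 N X <= 32 q c + 64 q^2 u^2, which the square of 8 (sqrt (q c) + q u)
    dominates. *)
Lemma bounded_constant (R : realType) (q r c u B : R) m :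
  1 <= q -> q <= m.+1%:R -> m.+1%:R <= 2 * q -> 0 <= c -> 0 <= u -> r <= expR q * c ->
  8 * (Num.sqrt q * Num.sqrt c + q * u) <= B ->
  (2 * m.+1)%:R ^+ m.+1 * (r * (2 * (c + m.+1%:R * u ^+ 2)) ^+ m) <= B ^+ (2 * m.+1).
Proof.
move=> q1 qm mq c0 u0 rq hB; set N : R := m.+1%:R in qm mq *.
have q0 : 0 < q by exact: lt_le_trans q1.
have N0 : 0 < N by rewrite ltr0n.
set X := 2 * (c + N * u ^+ 2).
have u2 : 0 <= u ^+ 2 by exact: sqr_ge0.
have Nu : 0 <= N * u ^+ 2 by rewrite mulr_ge0 // ltW.
have X0 : 0 <= X by rewrite mulr_ge0 ?addr_ge0.
have cX : c <= X by rewrite /X; lra.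
have e4 : expR N <= 4 ^+ m.+1.
  rewrite /N -[m.+1%:R]mulr1 expRM_natl; apply: lerXn2r; rewrite ?nnegrE ?expR_ge0 //.
  exact: expR1_le4.
have rX : r <= 4 ^+ m.+1 * X.
  apply: (le_trans rq); apply: ler_pM; rewrite ?expR_ge0 //.
  by apply: le_trans e4; rewrite ler_expR.
apply: (@le_trans _ _ ((2 * N) ^+ m.+1 * (4 ^+ m.+1 * X * X ^+ m))).
  rewrite natrM; apply: ler_wpM2l; first by rewrite exprn_ge0 // mulr_ge0 // ltW.
  by apply: ler_wpM2r; rewrite ?exprn_ge0.
rewrite -mulrA -exprS -!exprMn exprM; apply: lerXn2r; rewrite ?nnegrE ?sqr_ge0 //.
  by have N0' := ltW N0; apply: mulr_ge0; apply: mulr_ge0.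
set a := Num.sqrt q * Num.sqrt c in hB; set b := q * u in hB.
have a0 : 0 <= a by rewrite mulr_ge0 ?sqrtr_ge0.
have b0 : 0 <= b by rewrite mulr_ge0 // ltW.
have a2 : a ^+ 2 = q * c by rewrite exprMn !sqr_sqrtr // ltW.
have b2 : b ^+ 2 = q ^+ 2 * u ^+ 2 by rewrite exprMn.
have hB2 : 64 * (a + b) ^+ 2 <= B ^+ 2.
  have -> : 64 * (a + b) ^+ 2 = (8 * (a + b)) ^+ 2 by ring.
  by apply: lerXn2r => //; rewrite nnegrE ?mulr_ge0 ?addr_ge0 // (le_trans _ hB) // mulr_ge0 ?addr_ge0.
apply: le_trans hB2.
apply: (@le_trans _ _ (64 * (a ^+ 2 + b ^+ 2))); last first.
  by rewrite ler_pM2l // sqrrD; have := mulr_ge0 a0 b0; rewrite mulr2n; lra.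
rewrite a2 b2 /X; have h1 : N * c <= 2 * q * c by apply: ler_wpM2r.
have h2 : N * N <= 2 * q * (2 * q) by apply: ler_pM => //; exact: ltW.
have h3 := ler_wpM2r u2 h2.
have qc : 0 <= q * c by rewrite mulr_ge0 // ltW.
rewrite expr2 [q ^+ 2]expr2 in h3 *; nra.
Qed.

Section MeanPsd.
Context {dT : measure_display} {T : measurableType dT} {R : realType}.
Variable P : probability T R.

Lemma herm_mean_mx d (A : T -> 'M[R[i]]_d) : bounded_rmx A -> (forall w, A w \is hermsymmx) ->
  mean_mx P A \is hermsymmx.
Proof.
move=> bA hA; apply/hermP/matrixP => i j; rewrite !mxE /=.
have E w : A w i j = (A w j i)^*%C.
  by have /hermP E := hA w; rewrite -[in LHS]E !mxE.
congr Complex; rewrite !unlock.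
  by congr fine; apply: eq_integral => w _; rewrite E; case: (A w j i).
have := ExZ P (-1) (bounded_rmx_Im j i bA); rewrite mulN1r => <-.
by apply: eq_Rintegral => w _; rewrite E mulN1r; case: (A w j i).
Qed.

Lemma integral_le_add (F G H : T -> R) c :
  measurable_fun setT H -> measurable_fun setT F -> measurable_fun setT G ->
  (forall w, 0 <= F w) -> (forall w, 0 <= G w) -> (forall w, 0 <= H w) -> 0 <= c ->
  (forall w, H w <= c * (F w + G w)) ->
  (\int[P]_w (H w)%:E <= c%:E * (\int[P]_w (F w)%:E + \int[P]_w (G w)%:E))%E.
Proof.
move=> mH mF mG F0 G0 H0 c0 h.
have mFE : measurable_fun setT (fun w => (F w)%:E) by exact/measurable_EFinP.
have mGE : measurable_fun setT (fun w => (G w)%:E) by exact/measurable_EFinP.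
rewrite -ge0_integralD //; last 2 first.
- by move=> w _; rewrite lee_fin.
- by move=> w _; rewrite lee_fin.
rewrite -ge0_integralZl //; last 2 first.
- exact: emeasurable_funD.
- by move=> w _; rewrite adde_ge0 ?lee_fin.
apply: ge0_le_integral => //.
- by move=> w _; rewrite lee_fin.
- exact/measurable_EFinP.
- by apply: measurable_funeM; exact: emeasurable_funD.
by move=> w _; rewrite -EFinD -EFinM lee_fin.
Qed.

Lemma integral_powR_le (f g : T -> R) p : measurable_fun setT f -> measurable_fun setT g ->
  (forall w, 0 <= f w) -> (forall w, f w <= g w) -> 0 <= p ->
  (\int[P]_w (f w `^ p)%:E <= \int[P]_w (g w `^ p)%:E)%E.
Proof.
move=> mf mg f0 fg p0; apply: ge0_le_integral => //.
- by move=> w _; rewrite lee_fin powR_ge0.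
- by apply/measurable_EFinP; exact: (measurableT_comp (measurable_powR p)).
- by apply/measurable_EFinP; exact: (measurableT_comp (measurable_powR p)).
by move=> w _; rewrite lee_fin; apply: ge0_ler_powR; rewrite ?nnegrE // (le_trans (f0 w)).
Qed.

Lemma psd_mean_mx d (A : T -> 'M[R[i]]_d) : bounded_rmx A -> (forall w, psd (A w)) ->
  psd (mean_mx P A).
Proof.
move=> bA pA; split; first by apply: herm_mean_mx => // w; case: (pA w).
move=> x; rewrite rdot_rtr -(Ex_rtr_mul P (x *m x ^t*) bA).
apply: Rintegral_ge0 => w _; rewrite -rdot_rtr; exact: (pA w).2.
Qed.
End MeanPsd.

(** * Small and large summands combined *)

Section Core.
Context {dT : measure_display} {T : measurableType dT} {R : realType}.
Variable P : probability T R.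
Context {n d : nat}.
Variable W : 'I_n -> T -> 'M[R[i]]_d.
Hypothesis d0 : (0 < d)%N.
Hypothesis mW : forall k, random_mx (W k).
Hypothesis hW : forall k w, W k w \is hermsymmx.
Hypothesis cW : forall k, centered P (W k).
Hypothesis iW : mutual_indep P (fun k => mx_sigma (W k)).
Variable t0 : R.
Hypothesis t00 : 0 <= t0.

Definition small_part (A : 'M[R[i]]_d) : 'M[R[i]]_d := if opnorm A <= t0 then A else 0.

Lemma small_large A : A = small_part A + large_part t0 A.
Proof. by rewrite /small_part /large_part leNgt; case: (t0 < opnorm A) => /=; rewrite ?add0r ?addr0. Qed.

Lemma opnorm_small A : opnorm (small_part A) <= t0.
Proof. by rewrite /small_part; case: ifP => // _; rewrite opnorm0. Qed.

Lemma herm_small A : A \is hermsymmx -> small_part A \is hermsymmx.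
Proof. by rewrite /small_part; case: ifP => // _ _; exact: herm0. Qed.

Lemma measurable_small_part k : measurable_mx (fun x : mxfamily R n d => small_part (x k)).
Proof.
have mk := @measurable_mx_coord R n d k.
apply: measurable_mx_if; [|exact: mk|exact: measurable_mx_cst].
by apply: measurable_fun_ler => //; exact: measurable_opnorm.
Qed.

Lemma psd_small_variance : psd (\sum_k mean_mx P (fun w => small_part (W k w) ^+ 2)).
Proof.
apply: psd_sum => k; apply: psd_mean_mx.
  exact: (bounded_rmxX 2 (bounded_phi mW measurable_small_part opnorm_small k)).
by move=> w; apply: psd_sqr; exact: herm_small.
Qed.

Lemma moment_split p e : 1 <= p ->
  (\int[P]_w (opnorm (psum predT e (outcome W w)) `^ p)%:E <=
   (2 `^ p)%:E * (\int[P]_w (signed_norm W small_part e w `^ p)%:E +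
                  \int[P]_w (signed_norm W (large_part t0) e w `^ p)%:E))%E.
Proof.
move=> p1; have p0 : 0 <= p by apply: le_trans p1.
have mo := measurable_outcome mW.
apply: integral_le_add; try by move=> w; exact: powR_ge0.
- exact: (measurableT_comp (measurable_norm_psum d0 predT e p) mo).
- apply: (measurableT_comp (measurable_powR p)).
  exact: (measurable_signed_norm mW d0 measurable_small_part e).
- apply: (measurableT_comp (measurable_powR p)).
  exact: (measurable_signed_norm mW d0 (measurable_large_part d0 t0) e).
- exact: powR_ge0.
move=> w.
apply: le_trans (powR_addn_le (opnorm_ge0 _) (opnorm_ge0 _) p0).
have E : psum predT e (outcome W w) = psum predT e (fun k => small_part (W k w)) +
    psum predT e (fun k => large_part t0 (W k w)).
  rewrite /psum -big_split; apply: eq_bigr => k _; rewrite /outcome {1 2}(small_large (W k w)).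
  by case: (e k) => //; exact: opprD.
have := opnormD (psum predT e (fun k => small_part (W k w)))
  (psum predT e (fun k => large_part t0 (W k w))); rewrite -E => h.
by apply: ge0_ler_powR; rewrite ?nnegrE ?addr_ge0 ?opnorm_ge0.
Qed.

(** 56 = 4 * 14: the inequality (x + y)^p <= 2^p (x^p + y^p) is used twice and gives 4^p, while 14 =
    2 (2 + 2 + 3) collects the factors of symmetrization and of the two moment bounds and is at most
    14^p. *)
Lemma moment_core p q s mm (V : 'M[R[i]]_d) :
  1 <= p -> p <= q -> V \is hermsymmx ->
  psd (V - \sum_k mean_mx P (fun w => small_part (W k w) ^+ 2)) ->
  rtr V <= expR q * opnorm V -> 0 < s ->
  2 ^- n * sign_tail P W (large_part t0) (s / 2) <= (8 * 3 `^ p)^-1 ->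
  0 <= mm -> (\int[P]_w (maxnorm W w `^ p)%:E <= (mm `^ p)%:E)%E ->
  (\int[P]_w (opnorm (\sum_k W k w) `^ p)%:E <=
   ((56 * (8 * (Num.sqrt q * Num.sqrt (opnorm V) + q * t0) + 2 * s + 9 * mm)) `^ p)%:E)%E.
Proof.
move=> p1 pq hV pV rV s0 tail mm0 hM.
have lin (x y z t : R) : x <= t -> y <= t -> z <= t -> 2 * (2 * x + (2 * y + 3 * z)) <= 14 * t.
  by move=> *; lra.
have p0 : 0 < p by exact: lt_le_trans p1.
have q1 : 1 <= q by exact: le_trans pq.
have q0 : 0 < q by exact: lt_le_trans q1.
set b := 8 * (_ + _); have b0 : 0 <= b.
  by rewrite mulr_ge0 ?addr_ge0 ?mulr_ge0 ?sqrtr_ge0 // ltW.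
set Z := b + _ + _.
have s0' := ltW s0.
have Z0 : 0 <= Z.
  exact: addr_ge0 (addr_ge0 b0 (mulr_ge0 (ler0n R 2) s0')) (mulr_ge0 (ler0n R 9) mm0).
(* m + 1 lies between q and 2 q: the order 2 (m + 1) exceeds p and is large enough to absorb the
   effective rank. *)
pose m := Num.truncn q.
have /andP[mq qm] := truncn_itv (ltW q0).
have mq2 : m.+1%:R <= 2 * q by rewrite -natr1; lra.
have pm : p <= (2 * m.+1)%:R by rewrite natrM; have : q < m.+1%:R by []; lra.
(* [bounded_part] takes a positive B, while b is 0 when V and t0 vanish; s is added for this
   reason. *)
have B0 : 0 < b + s by exact: ltr_wpDl.
have hB : b <= b + s by rewrite lerDl ltW.
have small := bounded_part d0 mW iW hW measurable_small_part herm_small opnorm_small hV pV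
  (ltW p0) pm B0 (bounded_constant q1 (ltW qm) mq2 (opnorm_ge0 V) t00 rV hB).
have s20 : 0 < s / 2 by exact: divr_gt0.
have hM' : (\int[P]_w (max_psi W (large_part t0) w `^ p)%:E <= (mm `^ p)%:E)%E.
  apply: le_trans hM; apply: (integral_powR_le P _ _ (max_psi_ge0 _ _) _ (ltW p0)).
  - exact: (measurable_max_psi mW d0 (measurable_large_part d0 t0)).
  - exact: measurable_maxnorm.
  move=> w.
  rewrite /max_psi (bigmax_le_cond _ (maxnorm_ge0 W w)); apply/forallP => k.
  by rewrite /large_part; case: ifP => _; rewrite ?opnorm0 ?maxnorm_ge0 ?opnorm_le_maxnorm.
have large := hj_moment mW iW d0 (measurable_large_part d0 t0) p1 s20 (powR_ge0 mm p) tail hM'.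
set I := (\int[P]_w _)%E.
have step e : (I <= (2 `^ p * 2 * 2 `^ p)%:E *
    (\int[P]_w (signed_norm W small_part e w `^ p)%:E +
     \int[P]_w (signed_norm W (large_part t0) e w `^ p)%:E))%E.
  apply: le_trans (symmetrization d0 mW hW cW iW e p1) _.
  rewrite [in leRHS]EFinM -muleA; apply: lee_wpmul2l; last exact: moment_split.
  by rewrite lee_fin mulr_ge0 ?powR_ge0.
have nn psi e : (0 <= \int[P]_w (signed_norm W psi e w `^ p)%:E)%E.
  by apply: integral_ge0 => w _; rewrite lee_fin powR_ge0.
(* The signed moments are controlled only on average over e, so the inequalities [step] are summed
   over all patterns and 2^n is cancelled afterwards. *)
have sumI : ((2 ^+ n)%:E * I <= (2 ^+ n * (2 `^ p * 2 * 2 `^ p *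
     (2 * (b + s) `^ p + (2 * (3 * (s / 2)) `^ p + 3 * 9 `^ p * mm `^ p))))%:E)%E.
  have -> : ((2 ^+ n)%:E * I = \sum_(e : {ffun 'I_n -> bool}) I)%E.
    have <- : \sum_(e : {ffun 'I_n -> bool}) 1 = 2 ^+ n :> R by rewrite sum_sign_const mulr1.
    rewrite -sumEFin ge0_sume_distrl; last by move=> e _; rewrite lee_fin.
    by apply: eq_bigr => e _; rewrite mul1e.
  apply: le_trans (lee_sum _ (fun e _ => step e)) _.
  rewrite -ge0_sume_distrr; last by move=> e _; rewrite adde_ge0.
  rewrite [in leRHS]mulrCA [in leRHS]EFinM; apply: lee_wpmul2l; first by rewrite lee_fin !mulr_ge0 ?powR_ge0.
  by rewrite big_split /= mulrDr EFinD; apply: leeD.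
have n0 : 0 < 2 ^+ n :> R by exact: exprn_gt0.
move: sumI; rewrite EFinM lee_pmul2l ?lte_fin // => /le_trans; apply; rewrite lee_fin.
have le1 x : 0 <= x -> x <= Z -> x `^ p <= Z `^ p.
  by move=> x0 xZ; apply: ge0_ler_powR; rewrite ?nnegrE ?(ltW p0).
have e1 : (b + s) `^ p <= Z `^ p by apply: le1; rewrite /Z; lra.
have e2 : (3 * (s / 2)) `^ p <= Z `^ p by apply: le1; rewrite /Z; lra.
have e3 : 9 `^ p * mm `^ p <= Z `^ p.
  by rewrite -powRM //; apply: le1; rewrite /Z; lra.
have ZP : 0 <= Z `^ p by exact: powR_ge0.
have P2 : 2 `^ p * 2 `^ p = 4 `^ p :> R by rewrite -powRM //; congr (_ `^ _); ring.
have h14 : 14 <= 14 `^ p :> R by rewrite -[leLHS]powRr1 // ler_powR // ler1n.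
apply: (@le_trans _ _ (4 `^ p * 14 * Z `^ p)).
  rewrite (_ : 2 `^ p * 2 * 2 `^ p = 4 `^ p * 2); last by rewrite mulrAC P2.
  rewrite -!mulrA; apply: ler_wpM2l; first exact: powR_ge0.
  exact: lin e1 e2 e3.
rewrite (_ : 56 = 4 * 14); last by ring.
rewrite powRM ?mulr_ge0 // powRM //; apply: ler_wpM2r => //.
by apply: ler_wpM2l; rewrite ?powR_ge0.
Qed.
End Core.

Section Moments.
Context {dT : measure_display} {T : measurableType dT} {R : realType}.
Variable P : probability T R.

Lemma pmoment_le p (Z : T -> R) z : 0 < p -> 0 <= z ->
  (\int[P]_w (Z w `^ p)%:E <= (z `^ p)%:E)%E -> (pmoment P p Z <= z%:E)%E.
Proof.
move=> p0 z0 h; rewrite /pmoment unlock.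
have -> : z%:E = ((z `^ p)%:E `^ p^-1)%E.
  by rewrite poweR_EFin -powRrM divff ?gt_eqF // powRr1.
apply: gt0_ler_poweR => //; rewrite ?invr_ge0 ?(ltW p0) // in_itv /= leey ?andbT.
  by apply: integral_ge0 => w _; rewrite lee_fin powR_ge0.
by rewrite lee_fin powR_ge0.
Qed.

Lemma pmoment_ge0 p (Z : T -> R) : (0 <= pmoment P p Z)%E.
Proof. exact: poweR_ge0. Qed.

Lemma pmoment_fin p (Z : T -> R) : 0 < p -> (pmoment P p Z != +oo)%E ->
  exists mm : R, [/\ 0 <= mm, pmoment P p Z = mm%:E & (\int[P]_w (Z w `^ p)%:E = (mm `^ p)%:E)%E].
Proof.
move=> p0; rewrite /pmoment unlock; set I := (\int[P]_w _)%E => fin.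
have I0 : (0 <= I)%E by apply: integral_ge0 => w _; rewrite lee_fin powR_ge0.
have : I \is a fin_num.
  rewrite ge0_fin_numE // ltey; apply: contra fin => /eqP ->.
  by rewrite poweRyr // invr_eq0 gt_eqF.
case: I I0 {fin} => [r| |] //; rewrite lee_fin => r0 _.
exists (r `^ p^-1); rewrite powR_ge0 poweR_EFin; split => //.
by rewrite -powRrM mulVf ?gt_eqF // powRr1.
Qed.
End Moments.

(** * The three inequalities for given data *)

Section Assembly.
Context {dT : measure_display} {T : measurableType dT} {R : realType}.
Variable P : probability T R.
Context {n d : nat}.
Variable W : 'I_n -> T -> 'M[R[i]]_d.
Variable eps : 'I_n -> {RV P >-> R}.
Variable V : 'M[R[i]]_d.
Hypothesis d0 : (0 < d)%N.
Hypothesis mW : forall k, random_mx (W k).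
Hypothesis hW : forall k w, W k w \is hermsymmx.
Hypothesis cW : forall k, centered P (W k).
Hypothesis iW : mutual_indep P (fun k => mx_sigma (W k)).
Hypothesis beps : forall k, symmetric_bernoulli P (eps k).
Hypothesis ieps : mutual_indep P (fun k => rv_sigma (eps k)).
Hypothesis iepsW : indep P (joint_sigma (fun k => rv_sigma (eps k)))
  (joint_sigma (fun k => mx_sigma (W k))).
Hypothesis hV : V \is hermsymmx.
Hypothesis VW : loewner_ge V (truncated_variance P W).

(** M is at most the sum of the absolute values of all real and imaginary parts, integrable by
    [centered]. Hence the truncation level is a real number. *)
Lemma Ex_maxnorm_fin : exists2 a : R, 0 <= a & ('E_P[maxnorm W] = a%:E)%E.
Proof.
rewrite unlock; set I := (\int[P]_w _)%E.
have I0 : (0 <= I)%E by apply: integral_ge0 => w _; rewrite lee_fin maxnorm_ge0.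
suff fI : I \is a fin_num by exists (fine I); rewrite ?fine_ge0 ?fineK.
have iabs (f : T -> R) : P.-integrable setT (EFin \o f) ->
    P.-integrable setT (fun w => (`|f w|)%:E).
  by move=> /(integrable_abse); apply: eq_integrable.
have iS : P.-integrable setT (fun w => \sum_k \sum_i \sum_j
    ((`|complex.Re (W k w i j)|)%:E + (`|complex.Im (W k w i j)|)%:E))%E.
  apply: integrable_sum => // k _; apply: integrable_sum => // i _; apply: integrable_sum => // j _.
  have [r c] := (cW k).1 i j.
  by apply: integrableD => //; exact: iabs.
apply: (integrable_fin_num measurableT).
apply: le_integrable iS => //.
  by apply/measurable_EFinP; exact: measurable_maxnorm.
move=> w _ /=; rewrite ger0_norm ?maxnorm_ge0 //.
under eq_bigr => k _ do under eq_bigr => i _ do rewrite sumEFin.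
under eq_bigr => k _ do rewrite sumEFin.
rewrite sumEFin lee_fin; apply: le_trans (ler_norm _).
have s0 k : 0 <= \sum_i \sum_j (`|complex.Re (W k w i j)| + `|complex.Im (W k w i j)|).
  by apply: sumr_ge0 => i _; apply: sumr_ge0 => j _; rewrite addr_ge0.
rewrite /maxnorm (bigmax_le_cond _ (sumr_ge0 _ (fun k _ => s0 k))); apply/forallP => k.
apply: le_trans (opnorm_entries (W k w)) _.
rewrite [leRHS](bigD1 k) //= lerDl; apply: sumr_ge0 => j _; exact: s0.
Qed.

Variable a : R.
Hypothesis a0 : 0 <= a.
Hypothesis aE : ('E_P[maxnorm W] = a%:E)%E.

Let t0 := 24 * a.

Let t00 : 0 <= t0. Proof. by rewrite mulr_ge0. Qed.

Lemma int_maxnorm : (\int[P]_w (maxnorm W w)%:E = a%:E)%E.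
Proof. by rewrite -aE unlock. Qed.

Let rare : \int[P]_w ind [exists k, t0 < opnorm (W k w)] <= 24^-1.
Proof. by apply: rare_event => //; rewrite int_maxnorm. Qed.

Lemma levelE : level P W = t0%:E.
Proof. by rewrite /level aE -EFinM. Qed.

Lemma DeltaE w : \sum_(k < n) Delta P W (fun k => eps k) k w = signed_sum W eps t0 w.
Proof.
apply: eq_bigr => k _; rewrite /Delta levelE lte_fin /large_part.
by case: ifP => // _; rewrite scaler0.
Qed.

Lemma truncated_varianceE :
  truncated_variance P W = \sum_k mean_mx P (fun w => small_part t0 (W k w) ^+ 2).
Proof.
apply: eq_bigr => k _; congr mean_mx; apply/funext => w.
by rewrite levelE lee_fin /small_part expr2; case: ifP => // _; rewrite mul0r.
Qed.

Lemma psd_excess : psd (V - \sum_k mean_mx P (fun w => small_part t0 (W k w) ^+ 2)).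
Proof. by rewrite -truncated_varianceE; exact: psdmx_psd. Qed.

Lemma psdV : psd V.
Proof.
rewrite -[V](subrK (\sum_k mean_mx P (fun w => small_part t0 (W k w) ^+ 2))).
by apply: psdD; [exact: psd_excess|exact: psd_small_variance].
Qed.

(** |V| <= tr V for psd V; in the degenerate case the effective rank is 0 and ln 0 = 0. *)
Lemma ln_eff_rank_ge0 : 0 <= ln (eff_rank V).
Proof.
have [v0|v0] := eqVneq (opnorm V) 0; first by rewrite /eff_rank v0 invr0 mulr0 ln0.
rewrite ln_ge0 // /eff_rank ler_pdivlMr ?mul1r; last by rewrite lt_neqAle eq_sym v0 opnorm_ge0.
exact: opnorm_le_rtr psdV.
Qed.

Lemma rtr_le_eff_rank q : ln (eff_rank V) <= q -> rtr V <= expR q * opnorm V.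
Proof.
move=> lq; have [v0|v0] := eqVneq (opnorm V) 0.
  have := rtr_mul_le psdV.1 (psdX 0 psdV); rewrite expr0 mulr1 v0 mul0r => h.
  by rewrite mulr0.
have vp : 0 < opnorm V by rewrite lt_neqAle eq_sym v0 opnorm_ge0.
rewrite -ler_pdivrMr // -[leLHS]/(eff_rank V).
have ep : 0 < eff_rank V.
  rewrite divr_gt0 // (lt_le_trans vp) //; exact: opnorm_le_rtr psdV.
by rewrite -[leLHS]lnK ?posrE // ler_expR.
Qed.

Lemma moment_bound p q s mm :
  1 <= p -> p <= q -> ln (eff_rank V) <= q -> 0 < s ->
  2 ^- n * sign_tail P W (large_part t0) (s / 2) <= (8 * 3 `^ p)^-1 ->
  0 <= mm -> (\int[P]_w (maxnorm W w `^ p)%:E <= (mm `^ p)%:E)%E ->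
  (pmoment P p (fun w => opnorm (\sum_(k < n) W k w)) <=
   (56 * (8 * (Num.sqrt q * Num.sqrt (opnorm V) + q * t0) + 2 * s + 9 * mm))%:E)%E.
Proof.
move=> p1 pq lq s0 tail mm0 hM.
have p0 : 0 < p by exact: lt_le_trans p1.
have q0 : 0 <= q by apply: le_trans pq; exact: ltW.
have core := moment_core d0 mW hW cW iW t00 p1 pq hV psd_excess (rtr_le_eff_rank lq) s0 tail mm0 hM.
apply: (pmoment_le p0 _ core); have s0' := ltW s0.
have c1 : 0 <= Num.sqrt q * Num.sqrt (opnorm V) + q * t0.
  exact: addr_ge0 (mulr_ge0 (sqrtr_ge0 _) (sqrtr_ge0 _)) (mulr_ge0 q0 t00).
apply: mulr_ge0 => //.
exact: addr_ge0 (addr_ge0 (mulr_ge0 (ler0n R 8) c1) (mulr_ge0 (ler0n R 2) s0'))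
  (mulr_ge0 (ler0n R 9) mm0).
Qed.

Lemma sign_tail_of_event p t :
  (P [set w | (t < opnorm (signed_sum W eps t0 w))%R] <= ((8 * 3 `^ p)^-1)%:E)%E ->
  2 ^- n * sign_tail P W (large_part t0) t <= (8 * 3 `^ p)^-1.
Proof.
by move=> h; rewrite -lee_fin; apply: le_trans (sign_tail_le d0 mW beps ieps iepsW t0 t) h.
Qed.

Lemma sign_tail_of_sum p t :
  (P [set w | (t < large_sum W t0 w)%R] <= ((8 * 3 `^ p)^-1)%:E)%E ->
  2 ^- n * sign_tail P W (large_part t0) t <= (8 * 3 `^ p)^-1.
Proof.
move=> h; apply: sign_tail_of_event; apply: le_trans h.
exact: (signed_sum_tail_le d0 mW beps t0 t).
Qed.

Definition quantile_set p : set R := [set s : R | 0 < s /\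
  (P [set w | (s / 2 < opnorm (\sum_(k < n) Delta P W (fun k => eps k) k w))%R]
     <= (8^-1 * 3 `^ (- p))%R%:E)%E].

Lemma quantile_setP p s : 1 <= p -> quantile_set p s <->
  0 < s /\ (P [set w | (s / 2 < opnorm (signed_sum W eps t0 w))%R] <= ((8 * 3 `^ p)^-1)%:E)%E.
Proof.
move=> p1; rewrite /quantile_set /= powRN -invfM.
have eq_le_ (x y : \bar R) : x = y -> (x <= y)%E by move=> ->.
have PE : P [set w | s / 2 < opnorm (\sum_(k < n) Delta P W (fun k => eps k) k w)] =
    P [set w | s / 2 < opnorm (signed_sum W eps t0 w)].
  apply: (congr1 (fun A : set T => P A)); apply/funext => w.
  exact: (congr1 (fun A => is_true (s / 2 < opnorm A)) (DeltaE w)).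
split=> -[h1 h2]; split; [exact: h1| |exact: h1|].
  exact: le_trans (eq_le_ _ _ (esym PE)) h2.
exact: le_trans (eq_le_ _ _ PE) h2.
Qed.

(** 672 = 2 * 336, because the quantile is defined through s / 2. This also shows the set to be
    nonempty when E M^p is finite, so that its infimum is not the default value. *)
Lemma quantile_set_poisson p B : 1 <= p -> 0 < B ->
  (\int[P]_w (maxnorm W w `^ p)%:E <= (B `^ p)%:E)%E ->
  quantile_set p (672 * B * p / ln (expR 1 * p)).
Proof.
move=> p1 B0 hM; apply/(quantile_setP _ p1).
have c0 : 0 < 672 :> R by rewrite ltr0n.
have p0 : 0 < p by exact: lt_le_trans p1.
have l1 : 0 < ln (expR 1 * p) by apply: lt_le_trans (ln_e_mul_ge1 p1).
split; first exact: divr_gt0 (mulr_gt0 (mulr_gt0 c0 B0) p0) l1.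
have -> : 672 * B * p / ln (expR 1 * p) / 2 = 336 * B * p / ln (expR 1 * p).
  by field; rewrite gt_eqF.
apply: le_trans (signed_sum_tail_le d0 mW beps t0 _) _.
exact: (poisson_tail d0 mW iW t00 rare p1 B0 hM).
Qed.

Lemma moment_quantile p q s mm :
  1 <= p -> p <= q -> ln (eff_rank V) <= q -> quantile_set p s ->
  0 <= mm -> (\int[P]_w (maxnorm W w `^ p)%:E <= (mm `^ p)%:E)%E ->
  (pmoment P p (fun w => opnorm (\sum_(k < n) W k w)) <=
   (56 * (8 * (Num.sqrt q * Num.sqrt (opnorm V) + q * t0) + 2 * s + 9 * mm))%:E)%E.
Proof.
move=> p1 pq lq /(quantile_setP _ p1)[s0 hs] mm0 hM.
exact: moment_bound p1 pq lq s0 (sign_tail_of_event hs) mm0 hM.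
Qed.

(** Both bounds come from 1 + y <= exp y: at y = M / r0 for the mean, and as M <= p r0 exp (M / (p
    r0)), raised to the power p, for the moment. *)
Lemma psi1_moments p r0 : 1 <= p -> 0 < r0 ->
  (\int[P]_w (expR (maxnorm W w / r0))%:E <= 2%:E)%E ->
  a <= r0 /\ (\int[P]_w (maxnorm W w `^ p)%:E <= ((2 * p * r0) `^ p)%:E)%E.
Proof.
move=> p1 r00 hE; have p0 : 0 < p by exact: lt_le_trans p1.
have mM := measurable_maxnorm d0 mW.
have mexp : measurable_fun setT (fun w => (expR (maxnorm W w / r0))%:E).
  by apply/measurable_EFinP; apply: measurableT_comp => //; exact: measurable_funM.
have scale c : 0 <= c -> (\int[P]_w (c * expR (maxnorm W w / r0))%:E <= (c * 2)%:E)%E.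
  move=> c0; under eq_integral do rewrite EFinM.
  rewrite ge0_integralZl //.
  by rewrite EFinM; apply: lee_wpmul2l.
have mscale c : measurable_fun setT (fun w => (c * expR (maxnorm W w / r0))%:E).
  by under eq_fun do rewrite EFinM; exact: measurable_funeM.
split.
  have : (a%:E + r0%:E <= (r0 * 2)%:E)%E.
    apply: le_trans (scale r0 (ltW r00)).
    have {1}-> : (r0%:E = \int[P]_w r0%:E)%E by rewrite (Ex_fin P (bounded_rv_cst r0)) Ex_cst.
    rewrite -int_maxnorm -ge0_integralD //.
    - apply: ge0_le_integral => //.
      + by move=> w _; rewrite adde_ge0 // lee_fin ?maxnorm_ge0 // ltW.
      + by apply: emeasurable_funD => //; exact/measurable_EFinP.
      move=> w _; rewrite -EFinD lee_fin -ler_pdivrMl // mulrDr mulVf ?gt_eqF // addrC mulrC.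
      exact: expR_ge1Dx.
    - by move=> w _; rewrite lee_fin maxnorm_ge0.
    - exact/measurable_EFinP.
    - by move=> w _; rewrite lee_fin ltW.
  by rewrite -EFinD lee_fin; lra.
have pr0 : 0 < p * r0 by exact: mulr_gt0.
apply: (@le_trans _ _ ((p * r0) `^ p * 2)%:E).
  apply: le_trans (scale _ (powR_ge0 _ _)).
  apply: ge0_le_integral => //.
  - by move=> w _; rewrite lee_fin powR_ge0.
  - by apply/measurable_EFinP; exact: (measurableT_comp (measurable_powR p)).
  move=> w _; rewrite lee_fin.
  have -> : maxnorm W w / r0 = maxnorm W w / (p * r0) * p by field; rewrite !gt_eqF.
  rewrite expRM -powRM ?expR_ge0 ?(ltW pr0) //.
  have X0 : 0 <= p * r0 * expR (maxnorm W w / (p * r0)) by exact: mulr_ge0 (ltW pr0) (expR_ge0 _).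
  have X : maxnorm W w <= p * r0 * expR (maxnorm W w / (p * r0)).
    rewrite mulrC -ler_pdivrMr //; apply: le_trans (expR_ge1Dx _).
    by rewrite lerDr.
  exact: ge0_ler_powR (ltW p0) _ _ (maxnorm_ge0 W w) X0 X.
have -> : (2 * p * r0) `^ p = 2 `^ p * (p * r0) `^ p.
  by rewrite -mulrA [LHS]powRM // ltW.
rewrite lee_fin [leLHS]mulrC; apply: ler_wpM2r; first exact: powR_ge0.
by rewrite -[leLHS]powRr1 // ler_powR // ler1n.
Qed.

Lemma moment_psi1 p q r0 : 1 <= p -> p <= q -> ln (eff_rank V) <= q -> 0 < r0 ->
  (\int[P]_w (expR (maxnorm W w / r0))%:E <= 2%:E)%E ->
  (pmoment P p (fun w => opnorm (\sum_(k < n) W k w)) <=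
   (56 * (8 * (Num.sqrt q * Num.sqrt (opnorm V) + q * t0) + 2 * (14 * p * r0) + 9 * (2 * p * r0)))%:E)%E.
Proof.
move=> p1 pq lq r00 hE; have [_ hM] := psi1_moments p1 r00 hE.
have p0 : 0 < p by exact: lt_le_trans p1.
apply: moment_bound => //; rewrite ?mulr_gt0 //; last by rewrite !mulr_ge0 // ltW.
apply: sign_tail_of_sum.
have -> : 14 * p * r0 / 2 = 7 * p * r0 by field.
exact: (psi1_tail d0 mW iW rare p1 r00 hE).
Qed.

(** 56 is the constant of [moment_core]. 1400 exceeds 2 * 672 + 9, the coefficient of the moment of
    M in the inequality with p / ln (e p), and is ample for the other terms, such as 8 * 24 for q E
    M. *)
Local Notation K := (56 * 1400 : R).
Local Notation S := (fun w => opnorm (\sum_(k < n) W k w)).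

Let K0 : 0 < K. Proof. by apply: mulr_gt0; rewrite ltr0n. Qed.

(** The infimum may not be attained; an element of the set within e / 112 of it, 112 = 2 * 56, gives
    the bound up to e. If E M^p is infinite, so is the right side. *)
Lemma ineq_quantile p q : 1 <= p -> p <= q -> ln (eff_rank V) <= q ->
  (pmoment P p S <= K%:E * ((Num.sqrt q * Num.sqrt (opnorm V))%:E + q%:E * a%:E
     + (tail_quantile P W (fun k => eps k) p)%:E + pmoment P p (maxnorm W)))%E.
Proof.
have lin (x y r m e s : R) : 0 <= x -> 0 <= y -> 0 <= r -> 0 <= m -> s < r + e / 112 ->
    56 * (8 * (x + 24 * y) + 2 * s + 9 * m) <= 56 * 1400 * (x + y + r + m) + e.
  by move=> *; lra.
move=> p1 pq lq; have p0 : 0 < p by exact: lt_le_trans p1.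
have q0 : 0 <= q by apply: le_trans pq; exact: ltW.
have [->|fM] := eqVneq (pmoment P p (maxnorm W)) +oo%E.
  by rewrite -EFinM -!EFinD addey // gt0_muley ?lte_fin // leey.
have [mm [mm0 -> hM]] := pmoment_fin p0 fM.
(* mm may be 0, while [quantile_set_poisson] takes a positive bound; any such bound shows that the
   set is nonempty. *)
have mm1 : 0 < mm + 1 by exact: ltr_wpDl.
have hM1 : (\int[P]_w (maxnorm W w `^ p)%:E <= ((mm + 1) `^ p)%:E)%E.
  rewrite hM lee_fin; apply: ge0_ler_powR; rewrite ?nnegrE ?(ltW p0) ?(ltW mm1) //.
  by rewrite lerDl.
have ne : quantile_set p !=set0 by eexists; exact: quantile_set_poisson p1 mm1 hM1.
have lb : lbound (quantile_set p) 0 by move=> s [/ltW].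
have r0 : 0 <= inf (quantile_set p) by exact: lb_le_inf.
have cmb (k x u v r m : R) :
  (k%:E * (x%:E + u%:E * v%:E + r%:E + m%:E) = (k * (x + u * v + r + m))%:E)%E by [].
rewrite cmb -[tail_quantile _ _ _ _]/(inf (quantile_set p)).
apply/lee_addgt0Pr => e e0; rewrite -EFinD.
have e112 : 0 < e / 112 by exact: divr_gt0.
have [s hs hsr] := inf_adherent e112 (conj ne (ex_intro _ 0 lb)).
have := moment_quantile p1 pq lq hs mm0; rewrite hM lexx => /(_ isT)/le_trans; apply.
rewrite lee_fin (_ : q * t0 = 24 * (q * a)); last by rewrite /t0 mulrCA.
by apply: lin => //; rewrite mulr_ge0 ?sqrtr_ge0.
Qed.

(** The element of the quantile set given by [quantile_set_poisson] is used, with B slightly above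
    E^{1/p} M^p to be positive. With c = p / ln (e p) the excess e / (56 * 1344 * c) contributes
    exactly e to the bound. *)
Lemma ineq_log p q : 1 <= p -> p <= q -> ln (eff_rank V) <= q ->
  (pmoment P p S <= K%:E * ((Num.sqrt q * Num.sqrt (opnorm V))%:E + q%:E * a%:E
     + (p / ln (expR 1 * p))%:E * pmoment P p (maxnorm W)))%E.
Proof.
have lin (x y m e c : R) : 0 <= x -> 0 <= y -> 0 <= m -> 1 <= c -> 0 < e ->
    56 * (8 * (x + 24 * y) + 2 * (672 * (m + e / (56 * 1344 * c)) * c) + 9 * m) <=
    56 * 1400 * (x + y + c * m) + e.
  move=> x0 y0 m0 c1 e0; have c0 : 0 < c by lra.
  have -> : 2 * (672 * (m + e / (56 * 1344 * c)) * c) = 1344 * (c * m) + e / 56.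
    by field; rewrite gt_eqF.
  have : m <= c * m by rewrite ler_peMl.
  by move: (c * m) => z; lra.
move=> p1 pq lq; have p0 : 0 < p by exact: lt_le_trans p1.
have q0 : 0 <= q by apply: le_trans pq; exact: ltW.
have l0 : 0 < ln (expR 1 * p) by apply: lt_le_trans (ln_e_mul_ge1 p1).
have c1 : 1 <= p / ln (expR 1 * p) by rewrite ler_pdivlMr // mul1r ln_e_mul_le.
have c0 : 0 < p / ln (expR 1 * p) by exact: divr_gt0.
have [->|fM] := eqVneq (pmoment P p (maxnorm W)) +oo%E.
  by rewrite gt0_muley ?lte_fin // -EFinM -!EFinD addey // gt0_muley ?lte_fin // leey.
have [mm [mm0 -> hM]] := pmoment_fin p0 fM.
have cmb (k x u v c m : R) :
  (k%:E * (x%:E + u%:E * v%:E + c%:E * m%:E) = (k * (x + u * v + c * m))%:E)%E by [].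
rewrite cmb.
apply/lee_addgt0Pr => e e0; rewrite -EFinD.
set c := p / _ in c1 c0 *.
have d1 : 0 < e / (56 * 1344 * c).
  apply: divr_gt0 e0 _; apply: mulr_gt0 _ c0.
  by apply: mulr_gt0; rewrite ltr0n.
have mm1 : 0 < mm + e / (56 * 1344 * c) by exact: ltr_wpDl.
have hM1 : (\int[P]_w (maxnorm W w `^ p)%:E <= ((mm + e / (56 * 1344 * c)) `^ p)%:E)%E.
  rewrite hM lee_fin; apply: ge0_ler_powR; rewrite ?nnegrE ?(ltW p0) ?(ltW mm1) //.
  by rewrite lerDl ltW.
have hs := quantile_set_poisson p1 mm1 hM1.
have := moment_quantile p1 pq lq hs mm0; rewrite hM lexx => /(_ isT)/le_trans; apply.
rewrite lee_fin (_ : q * t0 = 24 * (q * a)); last by rewrite /t0 mulrCA.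
have -> : 672 * (mm + e / (56 * 1344 * c)) * p / ln (expR 1 * p) =
    672 * (mm + e / (56 * 1344 * c)) * c by rewrite -[LHS]mulrA.
by apply: lin => //; rewrite mulr_ge0 ?sqrtr_ge0.
Qed.

(** q <= ln r(V) + p splits q E M, and p E M is absorbed in p r because every r admissible for the
    psi_1 norm is at least E M. *)
Lemma ineq_psi1 p q : 1 <= p -> p <= q -> ln (eff_rank V) <= q -> q <= ln (eff_rank V) + p ->
  (pmoment P p S <= K%:E * ((Num.sqrt q * Num.sqrt (opnorm V))%:E + (ln (eff_rank V))%:E * a%:E
     + p%:E * psi1_norm P (maxnorm W)))%E.
Proof.
move=> p1 pq lq qlp; have p0 : 0 < p by exact: lt_le_trans p1.
have := ln_eff_rank_ge0; set l := ln (eff_rank V) in lq qlp * => l0.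
set x := Num.sqrt q * Num.sqrt (opnorm V); have x0 : 0 <= x by rewrite mulr_ge0 ?sqrtr_ge0.
have lin (r : R) : 0 < r -> a <= r ->
    56 * (8 * (x + q * t0) + 2 * (14 * p * r) + 9 * (2 * p * r)) <= K * (x + l * a + p * r).
  move=> r0 ar; have h1 : q * a <= (l + p) * a by exact: ler_wpM2r.
  have h2 : p * a <= p * r by rewrite ler_pM2l.
  have h3 : 0 <= l * a by exact: mulr_ge0.
  have h4 : 0 < p * r by exact: mulr_gt0.
  have -> : q * t0 = 24 * (q * a) by rewrite /t0 mulrCA.
  rewrite -!mulrA; move: h1; rewrite mulrDl.
  move: (q * a) (l * a) (p * a) (p * r) h2 h3 h4 x0 => {l l0 lq qlp} u v y z *; lra.
have bound r : 0 < r -> ('E_P[fun w => expR (`|maxnorm W w| / r)%R] <= 2%:E)%E ->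
    (pmoment P p S <= (K * (x + l * a + p * r))%:E)%E.
  move=> r0; rewrite unlock => hE.
  have {}hE : (\int[P]_w (expR (maxnorm W w / r))%:E <= 2%:E)%E.
    by apply: le_trans hE; rewrite le_eqVlt; apply/orP; left; apply/eqP;
      apply: eq_integral => w _; rewrite ger0_norm ?maxnorm_ge0.
  have [ar _] := psi1_moments p1 r0 hE.
  apply: le_trans (moment_psi1 p1 pq lq r0 hE) _.
  by rewrite lee_fin; exact: lin.
have [psiE|psiN] := eqVneq (psi1_norm P (maxnorm W)) +oo%E.
  by rewrite psiE gt0_muley ?lte_fin // -EFinM -!EFinD addey // gt0_muley ?lte_fin // leey.
have [_ [[r [r0 hr] <-] _]] : exists y, [set r%:E | r in [set r : R | 0 < r /\
    ('E_P[fun w => expR (`|maxnorm W w| / r)%R] <= 2%:E)%E]] y /\ (y < +oo)%E.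
  have : (ereal_inf [set r%:E | r in [set r : R | (0 < r)%R /\
    ('E_P[fun w => expR (`|maxnorm W w| / r)%R] <= 2%:E)%E]] < +oo)%E by rewrite ltey.
  by move=> /ereal_inf_lt[y hy yl]; exists y.
move: (pmoment_ge0 P p S) (bound r r0 hr); case E : (pmoment P p S) => [y| |] // _ _.
(* The bound holds for every admissible r; it is solved for r so that the infimum can be taken. *)
have lb : (((y / K - x - l * a) / p)%:E <= psi1_norm P (maxnorm W))%E.
  apply: le_ereal_inf_tmp => _ [t [t0' ht] <-]; have := bound t t0' ht.
  rewrite E !lee_fin ler_pdivrMr // => h.
  have : y / K <= x + l * a + p * t by rewrite ler_pdivrMr // mulrC.
  by move: (y / K) => z; rewrite (mulrC t); move: (p * t) (l * a) => *; lra.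
case F : (psi1_norm P (maxnorm W)) psiN lb => [t| |] // _.
rewrite lee_fin ler_pdivrMr // => h.
have cmb (k x' u v c m : R) :
  (k%:E * (x'%:E + u%:E * v%:E + c%:E * m%:E) = (k * (x' + u * v + c * m))%:E)%E by [].
rewrite cmb lee_fin -ler_pdivrMl // mulrC.
by move: h; rewrite (mulrC t); move: (y / K) (p * t) (l * a) => *; lra.
Qed.
End Assembly.

Theorem theorem2p2 (R : realType) :
  exists K : R, 0 < K /\
  forall (dT : measure_display) (T : measurableType dT) (P : probability T R)
    (n d : nat) (W : 'I_n -> T -> 'M[R[i]]_d) (eps : 'I_n -> {RV P >-> R})
    (V2 : 'M[R[i]]_d),
  (0 < n)%N -> (0 < d)%N ->
  (forall k, random_mx (W k)) ->
  (forall k w, W k w \is hermsymmx) ->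
  (forall k, centered P (W k)) ->
  mutual_indep P (fun k => mx_sigma (W k)) ->
  (forall k, symmetric_bernoulli P (eps k)) ->
  mutual_indep P (fun k => rv_sigma (eps k)) ->
  indep P (joint_sigma (fun k => rv_sigma (eps k)))
          (joint_sigma (fun k => mx_sigma (W k))) ->
  V2 \is hermsymmx ->
  loewner_ge V2 (truncated_variance P W) ->
  let M := maxnorm W in
  let sigma := Num.sqrt (opnorm V2) in
  let S := fun w => opnorm (\sum_(k < n) W k w) in
  forall p : R, 1 <= p ->
  let q := Num.max (ln (eff_rank V2)) p in
  [/\ (pmoment P p S <=
         K%:E * ((Num.sqrt q * sigma)%R%:E + q%:E * 'E_P[M]
                 + (tail_quantile P W (fun k => eps k) p)%:E
                 + pmoment P p M))%E,
      (pmoment P p S <=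
         K%:E * ((Num.sqrt q * sigma)%R%:E + q%:E * 'E_P[M]
                 + (p / ln (expR 1 * p))%R%:E * pmoment P p M))%E
    & (pmoment P p S <=
         K%:E * ((Num.sqrt q * sigma)%R%:E + (ln (eff_rank V2))%:E * 'E_P[M]
                 + p%:E * psi1_norm P M))%E].
Proof.
exists (56 * 1400); split; first by apply: mulr_gt0; rewrite ltr0n.
move=> dT T P n d W eps V2 _ d0 mW hW cW iW beps ieps iepsW hV VW M sigma S p p1 q.
have [a a0 aE] := Ex_maxnorm_fin d0 mW cW.
have pq : p <= q by rewrite le_max lexx orbT.
have lq : ln (eff_rank V2) <= q by rewrite le_max lexx.
have ln0 := ln_eff_rank_ge0 d0 mW hW VW a0 aE.
have qlp : q <= ln (eff_rank V2) + p.
  by rewrite ge_max lerDl lerDr ln0 andbT (le_trans ler01 p1).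
rewrite aE; split.
- exact: (ineq_quantile d0 mW hW cW iW beps ieps iepsW hV VW a0 aE p1 pq lq).
- exact: (ineq_log d0 mW hW cW iW beps ieps iepsW hV VW a0 aE p1 pq lq).
- exact: (ineq_psi1 d0 mW hW cW iW beps ieps iepsW hV VW a0 aE p1 pq lq qlp).
Qed.
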